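(* Let $H$ be a locally finite, countably infinite bipartite graph, and let $\lambda=\liminf_{n\to\infty}\frac{\mu(H,n)}{n}$. Suppose that for every $\lambda'>\lambda$ there exist infinitely many pairwise disjoint finite non-empty independent sets $I_1,I_2,\dots$ in $H$, all of the same size, with $\frac{|N(I_i)|}{|I_i|}\leq\lambda'$ for every $i$. Then $\rho(H)=f(\lambda)$.
   Context: A graph is locally finite if every vertex has finite degree. Let $K_{\mathbb{N}}$ be the complete graph on the natural numbers $\mathbb{N}=\{1,2,\dots\}$, and $[n]=\{1,\dots,n\}$. For $S\subseteq\mathbb{N}$ the (upper) density is $\bar d(S)=\limsup_{n\to\infty}|S\cap[n]|/n$, and for a subgraph $H'\subseteq K_{\mathbb{N}}$ we set $\bar d(H')=\bar d(V(H'))$. For a countably infinite graph $H$ (vertex set of the same cardinality as $\mathbb{N}$), the Ramsey upper density $\rho(H)$ is the supremum of the values $\lambda$ for which, for every two-coloring of $E(K_{\mathbb{N}})$, there exists a monochromatic (not necessarily induced) subgraph $H'\subseteq K_{\mathbb{N}}$, isomorphic to $H$, with $\bar d(H')\geq\lambda$. For $S\subseteq V(H)$, $N(S)=\left(\bigcup_{v\in S}N(v)\right)\setminus S$ is the set of vertices outside $S$ with a neighbor in $S$. $\mu(H,n)$ is the minimum value of $|N(I)|$ over independent sets $I$ of $H$ of size $n$. The liminf is taken in $[0,+\infty]$, and $\lambda'$ ranges over real numbers. Definition of $f:[0,+\infty]\to\mathbb{R}$. Let $\gamma\in(-1,1)$. For a continuous $g:[0,+\infty)\to\mathbb{R}$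 let $\Gamma^+_\gamma(g,t)=\min\{x:\gamma x+g(x)\geq t\}$ and $\Gamma^-_\gamma(g,t)=\min\{x:\gamma x-g(x)\geq t\}$, the minimum of the empty set being $+\infty$. Let $h(\gamma)=\inf_g\limsup_{t\to\infty}\frac{\Gamma^+_\gamma(g,t)+\Gamma^-_\gamma(g,t)}{t}$, the infimum being over all 1-Lipschitz functions $g:[0,+\infty)\to\mathbb{R}$ with $g(0)=0$ (1-Lipschitz: $|g(x)-g(y)|\leq|x-y|$ for all $x,y$). For $\lambda\in(0,+\infty)$ set \[f(\lambda)=1-\frac{1}{\frac{2\lambda}{(1+\lambda)^2}h\left(\frac{\lambda-1}{\lambda+1}\right)+\frac{2\lambda}{1+\lambda}},\] and $f(0)=1$, $f(+\infty)=1/2$. *)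

(* Defs.v *)
From HB Require Import structures.
From mathcomp Require Import all_boot all_order all_algebra finmap.
From mathcomp Require Import all_classical all_reals all_analysis.

Set Implicit Arguments.
Unset Strict Implicit.
Unset Printing Implicit Defensive.

Import Order.TTheory GRing.Theory Num.Theory.
Import numFieldNormedType.Exports.

Local Open Scope classical_set_scope.
Local Open Scope ring_scope.

Record graph (T : Type) := Graph {
  vert : set T;
  adj : T -> T -> Prop;
  adj_vert : forall u v, adj u v -> vert u /\ vert v;
  adj_sym : forall u v, adj u v -> adj v u;
  adj_irr : forall u, ~ adj u u }.

Section Graphs.
Context {T : Type}.
Implicit Types (G : graph T) (S I : set T).

(* The cardinality of a finite set; 0 on infinite sets.  The type {classic T}
   is T equipped with a choice structure by classical logic. *)
Definition ncard S : nat := #|` fset_set (S : set {classic T})|.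

Definition nbr G (v : T) : set T := [set w | adj G v w].

Definition nbrs G S : set T := (\bigcup_(v in S) nbr G v) `\` S.

Definition locally_finite G := forall v, vert G v -> finite_set (nbr G v).

Definition countably_infinite G := (vert G #= [set: nat])%card.

Definition independent G I :=
  I `<=` vert G /\ forall u v, I u -> I v -> ~ adj G u v.

Definition bipartite G := exists A B : set T,
  [/\ A `|` B = vert G, A `&` B = set0, independent G A & independent G B].

Definition subgraph G1 G2 :=
  vert G1 `<=` vert G2 /\ forall u v, adj G1 u v -> adj G2 u v.

End Graphs.

Definition isomorphic (T T' : Type) (G : graph T) (G' : graph T') :=
  exists phi : T -> T', set_bij (vert G) (vert G') phi /\
    forall u v, vert G u -> vert G v -> (adj G u v <-> adj G' (phi u) (phi v)).

Definition posnat : set nat := [set n | (0 < n)%N].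

Definition KN_adj (m n : nat) : Prop := [/\ posnat m, posnat n & m <> n].

Lemma KN_adj_vert m n : KN_adj m n -> posnat m /\ posnat n.
Proof. by case. Qed.

Lemma KN_adj_sym m n : KN_adj m n -> KN_adj n m.
Proof. by case=> ? ? neq; split=> // /esym. Qed.

Lemma KN_adj_irr n : ~ KN_adj n n.
Proof. by case. Qed.

Definition KN : graph nat := Graph KN_adj_vert KN_adj_sym KN_adj_irr.

(* A two-coloring of the edges of KN is a symmetric function; its values on
   pairs that are not edges of KN play no role. *)
Definition coloring (c : nat -> nat -> bool) := forall m n, c m n = c n m.

Definition monochromatic (c : nat -> nat -> bool) (G : graph nat) :=
  exists b : bool, forall m n, adj G m n -> c m n = b.

Section Densities.
Context {R : realType}.
Local Open Scope ereal_scope.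

(* The term at n = 0 is 0 / 0 = 0, which does not affect the limit superior. *)
Definition upper_density (S : set nat) : \bar R :=
  limn_esup (fun n =>
    ((ncard (S `&` [set k | (1 <= k <= n)%N]))%:R / n%:R)%R%:E).

Definition ramsey_upper_density (T : Type) (H : graph T) : \bar R :=
  ereal_sup [set l%:E | l in [set l : R |
    forall c : nat -> nat -> bool, coloring c ->
    exists H' : graph nat, [/\ subgraph H' KN, isomorphic H H',
      monochromatic c H' & l%:E <= upper_density (vert H')]]].

(* An infimum of natural numbers, hence a minimum as soon as H has an
   independent set of size n; this is the case for every n when H is infinite
   and locally finite, and the sets N(I) are then finite. *)
Definition mu (T : Type) (H : graph T) (n : nat) : \bar R :=
  ereal_inf [set ((ncard (nbrs H I))%:R)%:E | I in [set I : set T |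
    [/\ independent H I, finite_set I & ncard I = n]]].

Definition expansion (T : Type) (H : graph T) : \bar R :=
  limn_einf (fun n => mu H n * (n%:R^-1)%:E).

(* For continuous g the sets below are closed in [0, +oo[, so these infima are
   minima whenever the sets are nonempty; the infimum of set0 is +oo. *)
Definition Gamma_plus (gamma : R) (g : R -> R) (t : R) : \bar R :=
  ereal_inf [set x%:E | x in [set x : R | (0 <= x /\ t <= gamma * x + g x)%R]].

Definition Gamma_minus (gamma : R) (g : R -> R) (t : R) : \bar R :=
  ereal_inf [set x%:E | x in [set x : R | (0 <= x /\ t <= gamma * x - g x)%R]].

(* A function on [0, +oo[ is represented by a function on R whose values on
   negative numbers are never used. *)
Definition h (gamma : R) : \bar R :=
  ereal_inf [set limf_esup
      (fun t : R => (Gamma_plus gamma g t + Gamma_minus gamma g t)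
                    * (t^-1)%:E) (pinfty_nbhs R)
    | g in [set g : R -> R |
        1.-lipschitz_[set x : R | (0 <= x)%R] g /\ g 0%R = 0%R]].

(* h takes finite values on ]-1, 1[, so that fine loses no information; the
   values of f outside [0, +oo] are irrelevant. *)
Definition f (l : \bar R) : R :=
  match l with
  | r%:E => if r == 0%R then 1%R else
      (1 - 1 / (2 * r / (1 + r) ^+ 2 * fine (h ((r - 1) / (r + 1)))
                + 2 * r / (1 + r)))%R
  | +oo => (1 / 2)%R
  | -oo => 0%R
  end.

End Densities.

(* Main.v *)
Require Import Defs.
From HB Require Import structures.
From mathcomp Require Import all_boot all_order all_algebra finmap.
From mathcomp Require Import all_classical all_reals all_analysis.
From mathcomp Require Import zify ring lra.

Set Implicit Arguments.
Unset Strict Implicit.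
Unset Printing Implicit Defensive.

Import Order.TTheory GRing.Theory Num.Theory.
Import numFieldNormedType.Exports.

Local Open Scope classical_set_scope.
Local Open Scope ring_scope.


(** Let lam be the expansion of H, and let gamma = (lam - 1) / (lam + 1).

    Upper bound.  A lattice path made of steps of two types, true and false,
    orders the vertices of KN, each of which inherits the type of a step; an
    edge gets the type of its earlier end as its colour.  In a copy of H of
    colour b the vertices of type ~~ b among the first x steps are independent,
    and all their neighbours are of type b and lie among these x steps.  So
    there are, asymptotically, at most 1 / lam times as many of them as there
    are steps of type b, and the copy misses [excess (~~ b) x / lam] vertices,
    where the excess is lam times the number of steps of type ~~ b minus the
    number of steps of type b.  If the path follows a 1-Lipschitz g, in the
    sense that type true leads type false by g x after x steps, then the excesses are
    (1 + lam) / 2 times gamma x + g x and gamma x - g x.  The vertices are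
    numbered so that the greatest excesses reached in the two types stay
    balanced; the first n vertices then consist of the steps of type true up to
    Gamma_plus t and those of type false up to Gamma_minus t, for a t with
    n = (Gamma_plus t + Gamma_minus t) / (1 + lam) + t, and a copy of either
    colour misses (1 + lam) / (2 lam) t of them.  Minimising over g gives f
    ([ramsey_density_le], [ramsey_upper_density_le_h]).

    Lower bound.  For a colouring c, a nonprincipal ultrafilter gives every
    vertex a type b such that finitely many vertices of type b always have a
    common neighbour in colour b outside any given finite set
    ([vertex_types_exist]).  If H has parts P and Q, a copy of H of colour b is
    built by placing Q on vertices of type b and each vertex of P, after all
    its neighbours, on a common neighbour of these.  Such a copy can contain all
    vertices of type b.  It can moreover contain the X of any finite family of
    disjoint complete bipartite tiles (X, Y) of colour b, with X of type ~~ b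
    and Y of type b: an independent set I of P with |I| = |X| and
    |N(I)| <= |Y| is placed there ([extend_tile], [monochromatic_copy]).

    The number of vertices of type ~~ b in [n] that can be tiled obeys a duality
    ([tiling_or_cut]): if it is small, there is a cut, that is, sets S of type
    ~~ b in [n] and W of type b such that |S| - |W| / lam is large and no big
    complete bipartite graph of colour b joins S to the vertices of type b
    outside W.  If neither colour had a dense copy, both colours would have cuts
    (S, W) and (S', W') at all large n and m.  By the bipartite Ramsey theorem
    |S| <= |W'| or |S'| <= |W|, up to a bounded error ([cuts_cross]).  Without
    the error this is exactly the condition under which some 1-Lipschitz g
    satisfies g (|S| + |W|) <= |W| - |S| and g (|S'| + |W'|) >= |S'| - |W'| for
    all these cuts ([envelope_le_Up], [envelope_ge_Lo]).  Such a g has small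
    Gamma_plus and Gamma_minus, against the definition of h
    ([h_le_family], [dense_copy_pos]).

    In the extreme cases no optimisation remains: for lam = 0 a cut of each
    colour at the same n already contradicts [cuts_cross], and for lam = +oo
    one of the two types has upper density at least 1 / 2. *)

(** * Hall's theorem and disjoint subsets of prescribed size *)

Section Hall.
Local Open Scope nat_scope.
Local Open Scope fset_scope.

(** By induction on J: a proper subfamily with equality in Hall's condition can
    be served first, on its own union; if there is none, any choice for one
    index leaves the condition true for the others. *)
Lemma hall (I T : choiceType) (x0 : T) (J : {fset I}) (A : I -> {fset T}) :
    (forall J' : {fset I}, J' `<=` J -> #|` J'| <= #|` \bigcup_(i <- J') A i|) ->
  exists f : I -> T, {in J &, injective f} /\ {in J, forall i, f i \in A i}.
Proof.
have [n] := ubnP #|` J|; elim: n J A => // n IH J A; rewrite ltnS => ltJn hallA.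
have [->|/fset0Pn[i iJ]] := eqVneq J fset0; first by exists (fun=> x0).
have [[J1 [J1J J1n0 tight]]|ntight] := pselect (exists J1 : {fset I},
    [/\ J1 `<` J, J1 != fset0 & #|` \bigcup_(i <- J1) A i| <= #|` J1|]).
  have [f1 [f1inj f1A]] : exists f : I -> T,
      {in J1 &, injective f} /\ {in J1, forall i, f i \in A i}.
    apply: IH => [|J' J'J1]; first exact: leq_trans (fproper_ltn_card J1J) ltJn.
    by apply: hallA; apply: fsubset_trans J'J1 (fproper_sub J1J).
  set U := \bigcup_(i <- J1) A i.
  have [f2 [f2inj f2A]] : exists f : I -> T,
      {in J `\` J1 &, injective f} /\ {in J `\` J1, forall i, f i \in A i `\` U}.
    apply: IH => [|J' J'J].
      apply: leq_trans ltJn; apply: fproper_ltn_card; rewrite fproperE fsubsetDl.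
      apply/negP => /fsubsetP sub; case/fset0Pn: J1n0 => j jJ1.
      by have := sub j (fsubsetP (fproper_sub J1J) j jJ1); rewrite inE jJ1.
    have dis : J' `&` J1 = fset0.
      apply/fsetP => j; rewrite !inE; apply/negP => /andP[jJ' jJ1].
      by have := fsubsetP J'J j jJ'; rewrite inE jJ1.
    have := hallA (J' `|` J1); rewrite fsubUset (fproper_sub J1J) andbT.
    have -> : J' `<=` J by apply: fsubset_trans J'J (fsubsetDl _ _).
    rewrite cardfsU dis cardfs0 subn0 => /(_ isT) le1.
    suff le2 : #|` \bigcup_(i <- J' `|` J1) A i|
            <= #|` \bigcup_(i <- J') (A i `\` U)| + #|` U|.
      by rewrite -(leq_add2r #|` J1|) (leq_trans le1)// (leq_trans le2)// leq_add2l.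
    apply: leq_trans (_ : #|` (\bigcup_(i <- J') (A i `\` U)) `|` U| <= _);
      last by rewrite cardfsU leq_subr.
    apply: fsubset_leq_card; apply/fsubsetP => x /bigfcupP[j].
    rewrite !inE andbT => jJ xA; case xU : (x \in U); rewrite ?orbT// orbF.
    apply/bigfcupP; exists j; last by rewrite inE xU.
    rewrite andbT; case/orP: jJ => // jJ1; case/negP: (negbT xU).
    by apply/bigfcupP; exists j; rewrite ?jJ1.
  exists (fun j => if j \in J1 then f1 j else f2 j); split=> [j k jJ kJ|j jJ].
  - have f1U l : l \in J1 -> f1 l \in U.
      by move=> lJ; apply/bigfcupP; exists l; rewrite ?lJ ?f1A.
    case: ifPn => jJ1; case: ifPn => kJ1 ejk.
    + exact: f1inj.
    + have : f2 k \in A k `\` U by apply: f2A; rewrite inE kJ1.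
      by rewrite inE -ejk f1U.
    + have : f2 j \in A j `\` U by apply: f2A; rewrite inE jJ1.
      by rewrite inE ejk f1U.
    + by apply: f2inj; rewrite // inE ?jJ1 ?kJ1.
  - case: ifPn => jJ1; first exact: f1A.
    by have := f2A j; rewrite !inE jJ1 jJ => /(_ isT)/andP[].
have [x xA] : exists x, x \in A i.
  have := hallA [fset i]; rewrite fsub1set => /(_ iJ); rewrite cardfs1 big_seq_fset1.
  by rewrite cardfs_gt0 => /fset0Pn.
have [f [finj fA]] : exists f : I -> T,
    {in J `\ i &, injective f} /\ {in J `\ i, forall j, f j \in A j `\ x}.
  apply: IH => [|J' J'J]; first by rewrite (cardfsD1 i) iJ in ltJn.
  have [->|J'n0] := eqVneq J' fset0; first by rewrite cardfs0.
  have J'p : J' `<` J.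
    rewrite fproperE (fsubset_trans J'J (fsubsetDl _ _)) /=.
    by apply/negP => /fsubsetP/(_ i iJ)/(fsubsetP J'J); rewrite !inE eqxx.
  have lt : #|` J'| < #|` \bigcup_(i <- J') A i|.
    by rewrite ltnNge; apply/negP => le; apply: ntight; exists J'.
  rewrite -ltnS (leq_trans lt)//.
  apply: leq_trans (_ : #|` x |` \bigcup_(i <- J') (A i `\ x)| <= _).
    apply: fsubset_leq_card; apply/fsubsetP => y /bigfcupP[j jJ yA].
    rewrite !inE; case: eqVneq => //= yx; apply/bigfcupP; exists j => //.
    by rewrite !inE yx.
  by rewrite cardfsU1; case: (_ \notin _).
exists (fun j => if j == i then x else f j); split=> [j k jJ kJ|j jJ].
- have fne l : l \in J -> l != i -> f l != x.
    by move=> lJ li; have := fA l; rewrite !inE li lJ => /(_ isT)/andP[].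
  case: eqVneq => [->|ji]; case: eqVneq => [->//|ki] e.
  + by move: (fne k kJ ki); rewrite -e eqxx.
  + by move: (fne j jJ ji); rewrite e eqxx.
  + by apply: finj => //; rewrite !inE ?ji ?ki.
- case: eqVneq => [->//|ji].
  by have := fA j; rewrite !inE ji jJ => /(_ isT)/andP[].
Qed.

Lemma sum_mem_fset (T : choiceType) (X U : {fset T}) :
  X `<=` U -> \sum_(v <- U) (v \in X) = #|` X|.
Proof.
move=> XU; rewrite -big_mkcond /= -big_filter sum1_size.
apply: perm_size; apply: uniq_perm; rewrite ?filter_uniq ?fset_uniq//.
by move=> v; rewrite mem_filter; apply: andb_idr => /(fsubsetP XU).
Qed.

(** The sets overlap at most k-fold, so any family of them has a union at least
    as large as s times its number; Hall's theorem applied to s copies of each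
    set then gives disjoint subsets of size s. *)
Lemma disjoint_thinning (T : choiceType) (n k s : nat)
    (X : 'I_n -> {fset T}) : 0 < k ->
    (forall i, #|` X i| = k * s) ->
    (forall v, \sum_(i < n) (v \in X i) <= k) ->
  exists Y : 'I_n -> {fset T}, [/\ forall i, Y i `<=` X i,
    forall i, #|` Y i| = s & forall i j, i != j -> [disjoint Y i & Y j]%fset].
Proof.
move=> k0 cX loadX.
have [s0|spos] := posnP s.
  exists (fun=> fset0); split=> [i|i|i j _]; first exact: fsub0set.
    by rewrite cardfs0.
  exact: fdisjoint0X.
have [n0|npos] := posnP n.
  by exists X; split=> [i|i|i j _]; move: (ltn_ord i); rewrite {2}n0.
have [x0 _] : exists x0, x0 \in X (Ordinal npos).
  by apply/fset0Pn; rewrite -cardfs_gt0 cX muln_gt0 k0.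
have [|f [finj fA]] := @hall ('I_n * 'I_s)%type T x0
    [fset p | p in {: 'I_n * 'I_s}] (fun p => X p.1).
  move=> J _; pose K := [fset p.1 | p in J].
  set U := \bigcup_(p <- J) X p.1.
  have XU i : i \in K -> X i `<=` U.
    case/imfsetP => p pJ ->; apply/fsubsetP => x xX.
    by apply/bigfcupP; exists p; rewrite ?andbT.
  have leJ : #|` J| <= #|` K| * s.
    rewrite -[s in _ * s]card_ord cardE -(size_allpairs pair).
    apply: uniq_leq_size (fset_uniq _) _ => -[i j] pJ.
    by apply/allpairsP; exists (i, j); rewrite mem_enum; split=> //; apply/imfsetP; exists (i, j).
  apply: leq_trans leJ _; rewrite -(leq_pmul2l k0).
  have -> : k * (#|` K| * s) = \sum_(i <- K) #|` X i|.
    by under eq_bigr do rewrite cX; rewrite big_const_seq count_predT iter_addn_0 (mulnC #|` K|) mulnA.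
  have -> : \sum_(i <- K) #|` X i| = \sum_(i <- K) \sum_(v <- U) (v \in X i).
    by rewrite [LHS]big_seq [RHS]big_seq; apply: eq_bigr => i iK; rewrite sum_mem_fset// XU.
  rewrite exchange_big /=; apply: leq_trans (_ : \sum_(v <- U) k <= _).
    apply: leq_sum => v _; apply: leq_trans (loadX v).
    rewrite [leqRHS](bigID (fun i => i \in K)) /=; apply: leq_trans (leq_addr _ _).
    by rewrite big_uniq ?fset_uniq.
  by rewrite big_const_seq count_predT iter_addn_0.
have inJ (p : 'I_n * 'I_s) : p \in [fset p | p in {: 'I_n * 'I_s}].
  by apply/imfsetP; exists p.
exists (fun i => [fset f (i, j) | j in 'I_s]); split=> [i|i|i j ij].
- by apply/fsubsetP => x /imfsetP[j _ ->]; apply: (fA (i, j)).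
- rewrite card_imfset /= -?cardE ?card_ord//.
  by move=> j j' e; case: (finj _ _ (inJ _) (inJ _) e).
- apply/fdisjointP => x /imfsetP[l _ ->]; apply/negP => /imfsetP[l' _ e].
  by case: (finj _ _ (inJ _) (inJ _) e) => /eqP; rewrite (negPf ij).
Qed.
End Hall.

(** * Fractional tilings by complete bipartite graphs and their duals *)

Section PriceFunction.
Local Open Scope nat_scope.
Variables m T : nat.
Hypotheses (m_gt0 : 0 < m) (T_gt0 : 0 < T).

(** The price of using a vertex that is already used l times: 0 for an unused
    vertex, so that finite families have finite cost, and otherwise
    (1 + 1/m)^l up to a factor that makes all prices with l <= T + 1 integral.
    The price at l = T is what a tile is worth. *)
Definition price l := if l == 0 then 0 else m.+1 ^ l * m ^ (T.+1 - l).

Definition total_price l := \sum_(j < l) price j.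

Lemma price_le l l' : l <= l' -> price l <= price l'.
Proof.
move=> /subnK <-; elim: (l' - l) => // d IH; apply: leq_trans IH _.
rewrite addSn; move: (d + l) => {l l' d}l.
rewrite /price /=; case: eqP => // _; rewrite expnS.
case: (leqP l T) => lT.
  by rewrite subSS subSn// expnS mulnA leq_mul2r (mulnC (_ ^ _)) leq_mul2r leqnSn !orbT.
have -> : T.+1 - l = 0 by lia.
have -> : T.+1 - l.+1 = 0 by lia.
by rewrite expn0 !muln1 leq_pmull.
Qed.

Lemma price_step l : 0 < l <= T -> m * price l.+1 = m.+1 * price l.
Proof.
case/andP=> l0 lT; rewrite /price /= eqn0Ngt l0 /= subSS subSn// !expnS.
by rewrite mulnCA -!mulnA; congr (_ * _); rewrite mulnCA.
Qed.

Lemma price_gt l : T < l -> price T < price l.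
Proof.
move=> Tl; apply: leq_trans (price_le Tl).
rewrite /price /= eqn0Ngt T_gt0 /= subnn expn0 muln1 subSn// subnn expn1.
by rewrite expnS mulnC ltn_mul2r expn_gt0 /= ltnSn.
Qed.

Lemma price_gt0 : 0 < price T.
Proof. by rewrite /price eqn0Ngt T_gt0 /= muln_gt0 !expn_gt0 /= m_gt0. Qed.

Lemma total_priceS l : total_price l.+1 = total_price l + price l.
Proof. by rewrite /total_price big_ord_recr. Qed.

Lemma total_price_ge l : price T * l <= total_price l + price T * T.
Proof.
elim: l => [|l IH]; first by rewrite muln0.
rewrite total_priceS; case: (leqP T l) => lT.
  by rewrite mulnS addnC addnAC leq_add// price_le.
by apply: leq_trans (leq_addl _ _); rewrite leq_mul2l lT orbT.
Qed.

(** Consecutive prices have ratio 1 + 1/m, so the price to enter a vertex of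
    load l is at most (1 + 1/m) (l / L) times the price to leave it once l is at
    least L; below L the price itself is bounded by that at L. *)
Lemma price_split L l : 1 < L -> l <= T.+1 ->
  m * L * price l <= l * (m * L * price L) + m.+1 * (l * price l.-1).
Proof.
move=> L1 lT; have [lL|Ll] := ltnP l L.
  case: l lT lL => [|l] lT lL; first by rewrite /price muln0.
  apply: leq_trans (leq_addr _ _); rewrite -[leqLHS]mul1n leq_mul//.
  by rewrite leq_mul// price_le// ltnW.
apply: leq_trans (leq_addl _ _).
case: l lT Ll => [|l] lT Ll; first by lia.
rewrite mulnAC price_step; last by lia.
by rewrite /= -mulnA leq_mul2l mulnC leq_mul2r Ll orbT.
Qed.

End PriceFunction.

Section Tiles.
Local Open Scope fset_scope.
Local Open Scope nat_scope.

Definition tile (E : nat -> nat -> Prop) (X A : set nat) (a b : nat)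
    (Z : {fset nat} * {fset nat}) : Prop :=
  [/\ forall x, x \in Z.1 -> X x, #|` Z.1| = a,
      forall y, y \in Z.2 -> A y, #|` Z.2| = b
    & forall x y, x \in Z.1 -> y \in Z.2 -> E x y].

Definition load (F : seq ({fset nat} * {fset nat})) (v : nat) :=
  \sum_(Z <- F) (v \in Z.1 `|` Z.2).

Lemma load_cons Z F v : load (Z :: F) v = (v \in Z.1 `|` Z.2) + load F v.
Proof. by rewrite /load big_cons. Qed.

Lemma sum_fset_ord (N : nat) (U : {fset nat}) (f : nat -> nat) :
  (forall v, v \in U -> v < N) ->
  \sum_(v < N | (v : nat) \in U) f v = \sum_(v <- U) f v.
Proof.
move=> UN; rewrite -(big_mkord (fun v => v \in U)) -big_filter.
apply: perm_big; apply: uniq_perm; rewrite ?filter_uniq ?iota_uniq ?fset_uniq//.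
move=> v; rewrite mem_filter mem_index_iota /=.
by apply: andb_idr => /UN.
Qed.

Lemma fset_bounded (U : {fset nat}) : exists N, forall v, v \in U -> v < N.
Proof.
exists (\max_(v <- U) v).+1 => v vU.
by rewrite ltnS; apply: leq_bigmax_seq.
Qed.

Lemma sum_fsetU (U V : {fset nat}) (f : nat -> nat) : [disjoint U & V] ->
  \sum_(v <- U `|` V) f v = \sum_(v <- U) f v + \sum_(v <- V) f v.
Proof.
move=> /fdisjointP dis; rewrite -big_cat; apply: perm_big; apply: uniq_perm => [||v].
- exact: fset_uniq.
- rewrite cat_uniq !fset_uniq /= andbT; apply/hasPn => v vV.
  by apply/negP => /dis; rewrite vV.
- by rewrite mem_cat inE.
Qed.

Definition inside N (F : seq ({fset nat} * {fset nat})) :=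
  forall Z, Z \in F -> forall v, v \in Z.1 `|` Z.2 -> v < N.

Lemma load_out N F v : inside N F -> N <= v -> load F v = 0.
Proof.
move=> inF Nv; rewrite /load big_seq big1// => Z ZF.
by case: (boolP (v \in _)) => // /(inF Z ZF); lia.
Qed.

Lemma inside_ex F : exists N, inside N F.
Proof.
elim: F => [|Z F [N inF]]; first by exists 0.
have [N' inZ] := fset_bounded (Z.1 `|` Z.2).
exists (maxn N N') => Z'; rewrite inE => /orP[/eqP->|Z'F] v vZ.
  by rewrite leq_max inZ// orbT.
by rewrite leq_max (inF Z').
Qed.

Lemma inside_le N N' F : N <= N' -> inside N F -> inside N' F.
Proof. by move=> NN' inF Z ZF v vZ; apply: leq_trans NN'; apply: inF vZ. Qed.

Lemma load_perm F F' v : perm_eq F F' -> load F v = load F' v.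
Proof. by move=> FF'; rewrite /load (perm_big _ FF'). Qed.

Section Fixed.
Variables (m T : nat).
Hypotheses (m_gt0 : 0 < m) (T_gt0 : 0 < T).
Variables (E : nat -> nat -> Prop) (X : {fset nat}) (A : set nat) (a b : nat).
Hypothesis a_gt0 : 0 < a.

Local Notation K := (price m T T).
Local Notation D := (price m T).
Local Notation Q := (total_price m T).
Local Notation tl := (tile E [set` X] A a b).

Definition cost N F := \sum_(v < N) Q (load F v).

Lemma cost_le N N' F : N <= N' -> inside N F -> cost N' F = cost N F.
Proof.
move=> NN' inF; rewrite /cost -!(big_mkord xpredT (fun v => Q (load F v))).
rewrite (@big_cat_nat _ _ _ N) //= [X in _ + X]big_nat_cond [X in _ + X]big1 ?addn0//.
by move=> v /andP[/andP[Nv _] _]; rewrite (load_out inF Nv) /total_price big_ord0.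
Qed.

Lemma cost_cons N Z F :
  cost N (Z :: F) = cost N F + \sum_(v < N | (v : nat) \in Z.1 `|` Z.2) D (load F v).
Proof.
rewrite /cost [X in _ + X]big_mkcond /= -big_split /=; apply: eq_bigr => v _.
rewrite load_cons; case: ifP => _; last by rewrite addn0.
by rewrite add1n total_priceS.
Qed.

Lemma cost_perm N F F' : perm_eq F F' -> cost N F = cost N F'.
Proof.
by move=> FF'; apply: eq_bigr => v _; rewrite /load (perm_big _ FF').
Qed.

(** The worth of the tiles minus their cost is bounded, because prices above T
    eat up the worth of a tile already on its vertices in X. *)
Lemma benefit_bounded N F p : inside N F -> (forall Z, Z \in F -> tl Z) ->
  p + cost N F = K * size F -> p <= K * T * #|` X|.
Proof.
move=> inF tF e; have [N' NX] := fset_bounded X.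
pose M := maxn N N'.
have costM : cost M F = cost N F by apply: cost_le inF; rewrite leq_maxl.
have XM v : v \in X -> v < M by move/NX => lt; rewrite leq_max lt orbT.
rewrite -(leq_add2r (cost N F)) e -costM.
have le1 : size F <= \sum_(v < M | (v : nat) \in X) load F v.
  rewrite /load exchange_big /= -sum1_size big_seq [leqRHS]big_seq.
  apply: leq_sum => Z ZF; have [ZX ca _ _ _] := tF Z ZF.
  have /fset0Pn[x xZ] : Z.1 != fset0 by rewrite -cardfs_gt0 ca.
  have xX := ZX x xZ; rewrite (bigD1 (Ordinal (XM x xX)))//= inE xZ.
  by rewrite leq_addr.
have le2 : K * size F <= \sum_(v < M | (v : nat) \in X) (Q (load F v) + K * T).
  apply: leq_trans (_ : K * (\sum_(v < M | (v : nat) \in X) load F v) <= _).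
    by rewrite leq_mul2l le1 orbT.
  by rewrite big_distrr /=; apply: leq_sum => v _; apply: total_price_ge.
apply: leq_trans le2 _; rewrite big_split /= addnC leq_add//.
  by rewrite (sum_fset_ord (fun=> K * T) XM) big_const_seq count_predT iter_addn_0.
by rewrite /cost [leqRHS](bigID (fun v : 'I_M => (v : nat) \in X)) /= leq_addr.
Qed.

(** A family of tiles, repetitions allowed, of maximal worth minus cost.  Adding
    a tile does not help, so current prices form a fractional cover of all
    tiles; removing one does not help either, so each tile of the family pays
    for itself at the prices before it was added.  This is linear programming
    duality in integral form. *)
Lemma optimal_family : exists N F, [/\ inside N F,
  forall Z, Z \in F -> tl Z,
  forall Z, tl Z -> K <= \sum_(v <- Z.1 `|` Z.2) D (load F v) &
  forall Z, Z \in F -> \sum_(v <- Z.1 `|` Z.2) D (load F v).-1 <= K].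
Proof.
pose P p := exists N F, [/\ inside N F, forall Z, Z \in F -> tl Z
  & p + cost N F = K * size F].
have P0 : exists p, `[< P p >].
  exists 0; apply/asboolP; exists 0, [::]; split=> //.
  by rewrite /cost big_ord0 muln0.
have Pb p : `[< P p >] -> p <= K * T * #|` X|.
  by move=> /asboolP[N [F [inF tF e]]]; apply: benefit_bounded e.
case: (ex_maxnP P0 Pb) => p /asboolP[N [F [inF tF e]]] pmax.
exists N, F; split=> // Z.
  move=> tZ; rewrite leqNgt; apply/negP => lt.
  have [N' inZ] := inside_ex [:: Z].
  pose M := maxn N N'.
  have inFM : inside M F by apply: inside_le inF; rewrite leq_maxl.
  have inZM : inside M [:: Z] by apply: inside_le inZ; rewrite leq_maxr.
  have ZM v : v \in Z.1 `|` Z.2 -> v < M by apply: inZM; rewrite inE.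
  have costM : cost M F = cost N F by apply: cost_le inF; rewrite leq_maxl.
  set S := \sum_(v <- _) _ in lt.
  suff : p + (K - S) <= p by lia.
  apply: pmax; apply/asboolP; exists M, (Z :: F); split.
  - by move=> Z'; rewrite inE => /orP[/eqP->|/inFM].
  - by move=> Z'; rewrite inE => /orP[/eqP->|/tF].
  - rewrite cost_cons costM (sum_fset_ord (fun v => D (load F v)) ZM) -/S /= mulnS; lia.
move=> ZF; rewrite leqNgt; apply/negP => lt.
have FF' := perm_to_rem ZF; set F' := rem Z F in FF'.
have inF' : inside N F' by move=> Z' /mem_rem; apply: inF.
have tF' Z' : Z' \in F' -> tl Z' by move=> /mem_rem; apply: tF.
have sF : size F = (size F').+1 by rewrite (perm_size FF').
have ZN := inF Z ZF.
have eS : \sum_(v <- Z.1 `|` Z.2) D (load F v).-1 = \sum_(v <- Z.1 `|` Z.2) D (load F' v).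
  rewrite big_seq [RHS]big_seq; apply: eq_bigr => v vZ.
  by rewrite (load_perm v FF') load_cons vZ.
move: lt; rewrite eS; set S := \sum_(v <- _) _ => lt.
suff : p + (S - K) <= p by lia.
apply: pmax; apply/asboolP; exists N, F'; split=> //.
move: e; rewrite (cost_perm N FF') cost_cons.
rewrite (sum_fset_ord (fun v => D (load F' v)) ZN) -/S sF mulnS.
by move: (K * _) lt => B; clearbody S; move: (cost _ _) K => C k; clear; lia.
Qed.


End Fixed.

Lemma sum_lt_le (n c : nat) : \sum_(j < n) (j < c) <= c.
Proof.
elim: n => [|n IH]; first by rewrite big_ord0.
rewrite big_ord_recr /=; case: (ltnP n c) => nc; last by rewrite addn0.
rewrite addn1; apply: leq_ltn_trans nc.
apply: leq_trans (_ : \sum_(j < n) 1 <= _); last by rewrite sum1_card card_ord.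
by apply: leq_sum => j _; case: (_ < _).
Qed.

Lemma le_average (n : nat) (f : nat -> nat) : 0 < n ->
  exists2 j, j < n & n * f j <= \sum_(i < n) f i.
Proof.
move=> n0; have [//|h] := pselect (exists2 j, j < n & n * f j <= \sum_(i < n) f i).
exfalso; suff : \sum_(i < n) (\sum_(i < n) f i).+1 <= \sum_(i < n) n * f i.
  by rewrite -big_distrr sum_nat_const card_ord leq_mul2l eqn0Ngt n0 /= ltnn.
apply: leq_sum => i _; rewrite ltnNge; apply/negP => le; apply: h.
by exists (i : nat).
Qed.

Section Cut.
Variables (E : nat -> nat -> Prop) (X : {fset nat}) (A : set nat) (a b : nat).
Hypothesis XA : forall x, x \in X -> ~ A x.
Local Notation tl := (tile E [set` X] A a b).

Lemma tile_card N F Z : inside N F -> Z \in F -> tl Z ->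
  \sum_(v < N) ((v : nat) \in Z.1 `|` Z.2) = a + b.
Proof.
move=> inF ZF [ZX ca ZA cb _].
rewrite -big_mkcond /= (sum_fset_ord (fun=> 1) (inF Z ZF)) sum1_size.
rewrite cardfsU (_ : Z.1 `&` Z.2 = fset0) ?cardfs0 ?subn0 ?ca ?cb//.
apply/fsetP => v; rewrite !inE; apply/negP => /andP[/ZX vX /ZA vA].
exact: (XA vX).
Qed.

(** From a fractional cover c of the tiles by vertices to a cut: for a threshold
    j the vertices x of X with a c(x) <= j and the vertices y of A with
    b c(y) <= k0 - j - 1 span no tile, as such a tile would be covered by less
    than k0.  Summing over j counts each vertex at most a c or b c times, so some
    j is at least as good as the average. *)
Lemma cut_of_dual N (c : nat -> nat) k0 : 0 < a -> 0 < b -> 0 < k0 -> (forall x, x \in X -> x < N) ->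
    (forall v, N <= v -> c v = 0) ->
    (forall Z, tl Z -> k0 <= \sum_(v <- Z.1 `|` Z.2) c v) ->
  exists S V : {fset nat}, [/\ S `<=` X, forall y, y \in V -> A y,
    forall Z, ~ tile E [set` S] (A `\` [set` V])%classic a b Z
  & k0 * (b * #|` X `\` S| + a * #|` V|) <= a * b * \sum_(v < N) c v].
Proof.
move=> a_gt0 b_gt0 k0_gt0 XN c0 cover.
pose S j := [fset x in X | a * c x <= j].
pose AN : {fset nat} := [fset y in iota 0 N | `[< A y >]].
pose V j := [fset y in AN | k0 - j.+1 < b * c y].
have [j jK] := le_average (fun j => b * #|` X `\` S j| + a * #|` V j|) k0_gt0.
have -> : \sum_(i < k0) (b * #|` X `\` S i| + a * #|` V i|) =
    b * (\sum_(x <- X) \sum_(i < k0) (i < a * c x)) +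
    a * (\sum_(y <- AN) \sum_(i < k0) (k0 - i.+1 < b * c y)).
  rewrite big_split /= -!big_distrr /= [in RHS]exchange_big [\sum_(y <- AN) _]exchange_big.
  congr (b * _ + a * _); apply: eq_bigr => i _.
    rewrite -big_mkcond -big_filter sum1_size; apply: perm_size.
    apply: uniq_perm; rewrite ?filter_uniq ?fset_uniq// => x.
    by rewrite mem_filter !inE /= ltnNge; case: (x \in X); rewrite ?andbF//= !andbT.
  rewrite -big_mkcond -big_filter sum1_size; apply: perm_size.
  apply: uniq_perm; rewrite ?filter_uniq ?fset_uniq// => x.
  by rewrite mem_filter !inE /= andbC.
move=> le; exists (S j), (V j); split.
- by apply/fsubsetP => x; rewrite !inE => /andP[].
- by move=> y; rewrite !inE => /andP[/andP[_ /asboolP]].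
- move=> Z [Z1 c1 Z2 c2 EZ].
  have tZ : tl Z.
    by split=> // [x /Z1 /=|y /Z2 []//]; rewrite !inE => /andP[].
  have dis : [disjoint Z.1 & Z.2].
    apply/fdisjointP => v /Z1 /=; rewrite !inE => /andP[vX _]; apply/negP => /Z2[vA _].
    exact: (XA vX).
  have := cover Z tZ; rewrite sum_fsetU//=.
  apply/negP; rewrite -ltnNge -(@ltn_pmul2l (a * b)) ?muln_gt0 ?a_gt0// mulnDr.
  have le1 : a * b * \sum_(x <- Z.1) c x <= a * b * j.
    rewrite (mulnC a) -!mulnA leq_mul2l; apply/orP; right.
    rewrite big_distrr /=; apply: leq_trans (_ : \sum_(x <- Z.1) j <= _).
      rewrite big_seq [leqRHS]big_seq; apply: leq_sum => x /Z1 /=.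
      by rewrite !inE => /andP[].
    by rewrite big_const_seq count_predT iter_addn_0 c1 mulnC.
  have le2 : a * b * \sum_(y <- Z.2) c y <= a * b * (k0 - j.+1).
    rewrite -!mulnA leq_mul2l; apply/orP; right.
    rewrite big_distrr /=; apply: leq_trans (_ : \sum_(y <- Z.2) (k0 - j.+1) <= _).
      rewrite big_seq [leqRHS]big_seq; apply: leq_sum => y /Z2[yA yV].
      have [yN|Ny] := ltnP y N; last by rewrite c0// muln0.
      rewrite leqNgt; apply/negP => lt; apply: yV.
      by rewrite /= !inE mem_iota /= yN lt andbT; apply/asboolP.
    by rewrite big_const_seq count_predT iter_addn_0 c2 mulnC.
  apply: leq_ltn_trans (leq_add le1 le2) _; rewrite -mulnDr ltn_pmul2l ?muln_gt0 ?a_gt0//.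
  by lia.
- apply: leq_trans le _.
  have dis : [disjoint X & AN].
    apply/fdisjointP => v vX; apply/negP; rewrite !inE => /andP[_ /asboolP].
    exact: XA.
  apply: leq_trans (_ : a * b * \sum_(v <- X `|` AN) c v <= _); last first.
    rewrite leq_mul2l; apply/orP; right.
    rewrite -(@sum_fset_ord N).
      by rewrite [leqRHS](bigID (fun v : 'I_N => (v : nat) \in X `|` AN)) /= leq_addr.
    by move=> v; rewrite !inE => /orP[/XN//|/andP[]]; rewrite mem_iota.
  rewrite sum_fsetU//= mulnDr leq_add//.
    rewrite (mulnC a) -mulnA leq_mul2l big_distrr /=; apply/orP; right.
    by apply: leq_sum => x _; apply: sum_lt_le.
  rewrite -mulnA leq_mul2l big_distrr /=; apply/orP; right.
  apply: leq_sum => y _; rewrite (reindex_inj rev_ord_inj) /=.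
  apply: leq_trans (sum_lt_le k0 _); apply: leq_sum => i _.
  have := ltn_ord i => ik; rewrite [k0 - _](_ : _ = i :> nat)//=; lia.
Qed.

End Cut.
End Tiles.

(** * Duality for disjoint tilings *)

Section TilingTheorem.
Local Open Scope fset_scope.
Local Open Scope nat_scope.

Definition tiling (E : nat -> nat -> Prop) (X A : set nat) (s r n : nat)
    (Y : 'I_n -> {fset nat} * {fset nat}) : Prop :=
  (forall i, tile E X A s r (Y i)) /\
  (forall i j, i != j ->
     [disjoint (Y i).1 & (Y j).1] /\ [disjoint (Y i).2 & (Y j).2]).

(** The optimal family of (k s, k r)-tiles has loads at most k, so its tiles can
    be thinned to disjoint (s, r)-tiles, as many of them; and the cut given by
    the final prices has almost the matching size, by [price_split]. *)
Lemma tiling_cut_nat (m q s r : nat) (E : nat -> nat -> Prop)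
    (X : {fset nat}) (A : set nat) :
    2 < m -> 0 < q -> 0 < s -> 0 < r -> (forall x, x \in X -> ~ A x) ->
  exists n (Y : 'I_n -> {fset nat} * {fset nat}) (S V : {fset nat}),
  let k := (m * q).+1 in
  [/\ tiling E [set` X] A s r Y, S `<=` X, forall y, y \in V -> A y,
      forall Z, ~ tile E [set` S] (A `\` [set` V])%classic (k * s) (k * r) Z &
      m * (m.-1 * q) * m.+1 ^ q * (r * #|` X `\` S| + s * #|` V|) <=
      s * r * n * (m ^ q * (m * (m.-1 * q) * (k * k * (s + r))) + k * m.+1 * m.+1 ^ q)].
Proof.
move=> m2 q0 s0 r0 XA; set k := (m * q).+1.
have m0 : 0 < m by lia.
pose T := m * q; have T0 : 0 < T by rewrite muln_gt0 m0.
pose L := m.-1 * q; have L1 : 1 < L by rewrite /L; nia.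
have k0 : 0 < k by [].
have a0 : 0 < k * s by rewrite muln_gt0.
have b0 : 0 < k * r by rewrite muln_gt0.
have [N1 [F [inF1 tF dual primal]]] := @optimal_family m T m0 T0 E X A (k * s) (k * r) a0.
have [N2 XN2] := fset_bounded X.
pose N := maxn N1 N2.
have inF : inside N F by apply: inside_le inF1; rewrite leq_maxl.
have XN x : x \in X -> x < N by move/XN2 => lt; rewrite leq_max lt orbT.
have loadk v : load F v <= k.
  case: (posnP (load F v)) => [->//|lv].
  have [Z ZF vZ] : exists2 Z, Z \in F & v \in Z.1 `|` Z.2.
    move: lv; rewrite /load lt0n => /eqP lv; apply/hasP/negPn/negP.
    move=> /hasPn no; apply: lv; rewrite big_seq big1// => Z /no.
    by case: (_ \in _).
  have := primal Z ZF; rewrite (big_fsetD1 v)//= => le.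
  have {}le : price m T (load F v).-1 <= price m T T by apply: leq_trans le; exact: leq_addr.
  rewrite leqNgt; apply/negP => lt; move: le; apply/negP; rewrite -ltnNge.
  by apply: price_gt => //; rewrite /k -/T in lt; lia.
pose n := size F.
pose Fi (i : 'I_n) := nth (fset0, fset0) F i.
have FiF i : Fi i \in F by rewrite mem_nth.
have sumFi (f : {fset nat} * {fset nat} -> nat) : \sum_(i < n) f (Fi i) = \sum_(Z <- F) f Z.
  by rewrite (big_nth (fset0, fset0)) big_mkord.
have [Y1 [Y1F cY1 dY1]] : exists Y : 'I_n -> {fset nat}, [/\ forall i, Y i `<=` (Fi i).1,
    forall i, #|` Y i| = s & forall i j, i != j -> [disjoint Y i & Y j]].
  apply: (@disjoint_thinning _ n k) => // [i|v]; first by have [] := tF _ (FiF i).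
  apply: leq_trans (loadk v); rewrite (sumFi (fun Z => (v \in Z.1) : nat)).
  by apply: leq_sum => Z _; rewrite inE; case: (_ \in Z.1).
have [Y2 [Y2F cY2 dY2]] : exists Y : 'I_n -> {fset nat}, [/\ forall i, Y i `<=` (Fi i).2,
    forall i, #|` Y i| = r & forall i j, i != j -> [disjoint Y i & Y j]].
  apply: (@disjoint_thinning _ n k) => // [i|v]; first by have [] := tF _ (FiF i).
  apply: leq_trans (loadk v); rewrite (sumFi (fun Z => (v \in Z.2) : nat)).
  by apply: leq_sum => Z _; rewrite inE; case: (_ \in Z.2); rewrite ?orbT.
pose D := price m T; pose K := D T.
have [S [V [SX VA notile cut]]] := @cut_of_dual E X A (k * s) (k * r) XA N
  (fun v => D (load F v)) K a0 b0 (price_gt0 m0 T0) XN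
  (fun v Nv => congr1 (price m T) (load_out inF Nv)) dual.
exists n, (fun i => (Y1 i, Y2 i)), S, V; split=> //.
  split=> [i|i j ij]; last by split; [exact: dY1|exact: dY2].
  have [FX cF FA cF' FE] := tF _ (FiF i).
  split=> //= [x /(fsubsetP (Y1F i))/FX//|y /(fsubsetP (Y2F i))/FA//|x y].
  by move=> /(fsubsetP (Y1F i)) + /(fsubsetP (Y2F i)); exact: FE.
have sumload : \sum_(v < N) load F v = k * (s + r) * n.
  rewrite /load exchange_big /= big_seq.
  under eq_bigr => Z ZF do rewrite (tile_card XA inF ZF (tF Z ZF)).
  by rewrite -big_seq big_const_seq count_predT iter_addn_0 mulnDr.
have sumprimal : \sum_(v < N) load F v * D (load F v).-1 <= K * n.
  have -> : \sum_(v < N) load F v * D (load F v).-1 =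
      \sum_(Z <- F) \sum_(v <- Z.1 `|` Z.2) D (load F v).-1.
    rewrite [RHS]big_seq.
    under [RHS]eq_bigr => Z ZF do
      rewrite -(sum_fset_ord (fun v => D (load F v).-1) (inF Z ZF)) big_mkcond.
    rewrite -big_seq exchange_big /=; apply: eq_bigr => v _.
    rewrite /load big_distrl /=; apply: eq_bigr => Z _.
    by case: (_ \in _); rewrite ?mul1n ?mul0n.
  apply: leq_trans (_ : \sum_(Z <- F) K <= _); last first.
    by rewrite big_const_seq count_predT iter_addn_0.
  by rewrite big_seq [leqRHS]big_seq; apply: leq_sum => Z /primal.
have total : m * L * (\sum_(v < N) D (load F v)) <=
    (m * L * (k * (s + r)) * D L + m.+1 * K) * n.
  apply: leq_trans (_ : \sum_(v < N) (load F v * (m * L * D L) +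
      m.+1 * (load F v * D (load F v).-1)) <= _).
    rewrite big_distrr /=; apply: leq_sum => v _.
    by apply: price_split => //; exact: loadk.
  rewrite big_split /= -big_distrl -big_distrr /= sumload mulnDl leq_add//.
    by apply/eq_leq; ring.
  by rewrite -mulnA leq_mul2l sumprimal orbT.
(* The common factor of all prices involved is (m + 1) ^ L * m. *)
have eK : K = m.+1 ^ L * m.+1 ^ q * m.
  rewrite /K /D /price eqn0Ngt T0 /= subSn// subnn expn1 -expnD; congr (_ ^ _ * _).
  by rewrite /T /L -mulSnr prednK.
have eDL : D L = m.+1 ^ L * m ^ q * m.
  rewrite /D /price eqn0Ngt (ltn_trans _ L1)//= -mulnA -expnSr; congr (_ * _ ^ _).
  by rewrite /T /L; nia.
have P0 : 0 < k * m.+1 ^ L * m by rewrite !muln_gt0 expn_gt0 /= m0.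
rewrite -/L -(leq_pmul2l P0).
have := leq_mul (leqnn (m * L)) cut; rewrite mulnCA [leqRHS]mulnCA => cut'.
have := leq_trans cut' (leq_mul (leqnn (k * s * (k * r))) total).
by rewrite eK eDL => le; apply: leq_trans (leq_trans _ le) _; apply/eq_leq; ring.
Qed.

Lemma expn_bernoulli m u : m ^ u * u <= m * m.+1 ^ u.
Proof.
suff : m ^ u * (m + u) <= m * m.+1 ^ u.
  by move=> le; apply: leq_trans le; rewrite leq_mul2l leq_addl orbT.
elim: u => [|u IH]; first by rewrite addn0 !expn0 mul1n muln1.
apply: leq_trans (_ : m.+1 * (m ^ u * (m + u)) <= _); last first.
  by rewrite [m.+1 ^ _]expnS [leqRHS]mulnCA leq_mul2l IH orbT.
have -> : m ^ u.+1 * (m + u.+1) = m ^ u * (m * (m + u.+1)) by rewrite expnS; ring.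
by rewrite [leqRHS]mulnCA leq_mul2l; apply/orP; right; nia.
Qed.

Lemma small_error (m u c : nat) : 0 < m -> 0 < u -> u = 16 * m ^ 5 * c ->
  c * ((3 * (m * u)).+1 * (3 * (m * u)).+1) * m ^ (3 * u) <= m.+1 ^ (3 * u).
Proof.
move=> m0 u0 eu.
have k4 : (3 * (m * u)).+1 <= 4 * (m * u).
  by rewrite [4 * _]mulSn -add1n leq_add2r muln_gt0 m0.
apply: leq_trans (_ : c * (4 * (m * u) * (4 * (m * u))) * m ^ (3 * u) <= _).
  by rewrite leq_mul2r leq_mul2l leq_mul ?orbT.
have m30 : 0 < m ^ 3 by rewrite expn_gt0 m0.
rewrite -(leq_pmul2l m30).
have := leq_mul (expn_bernoulli m u) (leq_mul (expn_bernoulli m u) (expn_bernoulli m u)).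
rewrite ![3 * u]mulnC !expnM.
move: (m.+1 ^ u) (m ^ u) => a b le; apply: leq_trans (leq_trans _ le) _.
  rewrite [leqRHS](_ : _ = b * b * b * u * u * u); last by ring.
  by rewrite {3}eu; apply/eq_leq; ring.
by apply/eq_leq; ring.
Qed.

(** The cut explains why essentially no more of X can be tiled: a big tile has to
    meet X outside S or A inside W.  The enlargement k is the price for disjoint
    tiles instead of fractional ones; that it depends on e, s and r only is what
    makes the cuts of different n comparable. *)
Theorem tiling_or_cut (s r e : nat) : 0 < s -> 0 < r -> 0 < e ->
  exists2 k, 0 < k & forall (E : nat -> nat -> Prop) (X : {fset nat}) (A : set nat),
    (forall x, x \in X -> ~ A x) ->
  exists n (Y : 'I_n -> {fset nat} * {fset nat}) (S V : {fset nat}),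
  [/\ tiling E [set` X] A s r Y, S `<=` X, forall y, y \in V -> A y,
      forall Z, ~ tile E [set` S] (A `\` [set` V])%classic (k * s) (k * r) Z &
      e * (r * #|` X `\` S| + s * #|` V|) <= (e + 4) * (s * r * n)].
Proof.
move=> s0 r0 e0.
(* The ratio 1 + 1 / m of consecutive prices costs a factor (m + 1) / (m - 1);
   T = 3 m u makes the price at (m - 1) 3 u, the bound for vertices of low load,
   negligible even against the quadratic factor k * k. *)
have [m em] : exists m, m = (2 * e).+1 by eexists.
have [u eu] : exists u, u = 16 * m ^ 5 * ((s + r) * e) by eexists.
have m0 : 0 < m by rewrite em.
have u0 : 0 < u by rewrite eu 2!muln_gt0 expn_gt0 m0 muln_gt0 addn_gt0 s0.
have q0 : 0 < 3 * u by rewrite muln_gt0.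
have m2 : 2 < m by lia.
exists (m * (3 * u)).+1 => // E X A XA.
have [n [Y [S [V [tY SX VA no le]]]]] := tiling_cut_nat E m2 q0 s0 r0 XA.
exists n, Y, S, V; split=> //.
have le1 := small_error m0 u0 eu.
have le2 : e * ((m * (3 * u)).+1 * m.+1) <= m * (m.-1 * (3 * u)) * (e + 3).
  have le3 : e + 1 <= 2 * (m * (3 * u)) by nia.
  have -> : m.+1 = 2 * (e + 1) by lia.
  have -> : m.-1 = 2 * e by lia.
  have : ((m * (3 * u)).+1 * (e + 1)) <= (m * (3 * u)) * (e + 3) by nia.
  rewrite [m * (_ * (3 * u))]mulnCA; move: (m * (3 * u)) => w; nia.
have e3 : m * (3 * u) = 3 * (m * u) by rewrite mulnCA.
have P0 : 0 < m * (m.-1 * (3 * u)) * m.+1 ^ (3 * u).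
  have x0 : 0 < m.+1 ^ (3 * u) by rewrite expn_gt0.
  have y0 : 0 < m.-1 * (3 * u) by rewrite muln_gt0 q0 andbT; lia.
  by rewrite muln_gt0 x0 andbT muln_gt0 m0.
rewrite -(leq_pmul2l P0) mulnCA.
apply: leq_trans (leq_mul (leqnn e) le) _.
move: le1 le2; rewrite -e3; move: (m * (m.-1 * _)) (_.+1 ^ _) (m ^ _) (_ * _).+1.
move=> w a b k le1 le2.
rewrite [leqLHS](_ : _ =
  s * r * n * (w * ((s + r) * e * (k * k) * b) + e * (k * m.+1) * a)); last by ring.
rewrite [leqRHS](_ : _ = s * r * n * (w * a + w * (e + 3) * a)); last by ring.
by rewrite leq_mul2l leq_add ?orbT// leq_mul.
Qed.

End TilingTheorem.

(** * A bipartite Ramsey theorem and the types of the vertices *)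

Section Ramsey.
Local Open Scope fset_scope.
Local Open Scope nat_scope.

Lemma fsubset_card_ex (T : choiceType) (X : {fset T}) (k : nat) :
  k <= #|` X| -> exists2 X' : {fset T}, X' `<=` X & #|` X'| = k.
Proof.
move=> kX; exists [fset x in take k X].
  by apply/fsubsetP => x; rewrite inE => /mem_take.
rewrite card_fseq undup_id ?take_uniq ?fset_uniq// size_take.
by case: ltngtP kX => // ->.
Qed.

(** Fix 2 q vertices of X.  There are 2 ^ (2 q) ways to be joined to them, so q
    vertices of Y are joined to them in the same way, and this way uses one of
    the two colours at least q times. *)
Lemma bipartite_ramsey (q : nat) : exists M, forall (c : nat -> nat -> bool)
    (X Y : {fset nat}), M <= #|` X| -> M <= #|` Y| ->
  exists b (X' Y' : {fset nat}), [/\ X' `<=` X, Y' `<=` Y, #|` X'| = q, #|` Y'| = q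
    & forall x y, x \in X' -> y \in Y' -> c x y = b].
Proof.
exists (2 * q + q * 2 ^ (2 * q)) => c X Y leX leY.
have [X0 X0X cX0] := fsubset_card_ex (leq_trans (leq_addr _ _) leX).
pose nb y := [fset x in X0 | c x y].
have nbP y : nb y \in fpowerset X0.
  by rewrite fpowersetE; apply/fsubsetP => x; rewrite !inE => /andP[].
have [[P PX leP]|small] := pselect (exists2 P, P \in fpowerset X0 &
    q <= \sum_(y <- Y) (nb y == P)); last first.
  exfalso; have : \sum_(P <- fpowerset X0) (\sum_(y <- Y) (nb y == P)).+1
      <= \sum_(P <- fpowerset X0) q.
    rewrite big_seq [leqRHS]big_seq; apply: leq_sum => P PX.
    by rewrite ltnNge; apply/negP => le; apply: small; exists P.
  under eq_bigr do rewrite -addn1.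
  rewrite big_split /= !big_const_seq !count_predT !iter_addn_0 card_fpowerset cX0 mul1n.
  rewrite exchange_big /=.
  have -> : \sum_(y <- Y) \sum_(P <- fpowerset X0) (nb y == P) = #|` Y|.
    rewrite -sum1_size; apply: eq_bigr => y _.
    rewrite (big_fsetD1 (nb y))//= eqxx big_seq big1 ?addn0// => P.
    by rewrite !inE eq_sym => /andP[/negPf ->].
  have := expn_gt0 2 (2 * q); lia.
have {leP}leP : q <= #|` [fset y in Y | nb y == P]|.
  apply: leq_trans leP _; rewrite -big_mkcond -big_filter sum1_size.
  apply: eq_leq; apply: perm_size; apply: uniq_perm; rewrite ?filter_uniq ?fset_uniq//.
  by move=> y; rewrite mem_filter !inE andbC.
have [Y' Y'Y cY'] := fsubset_card_ex leP.
have Y'P y : y \in Y' -> y \in Y /\ nb y = P.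
  by move=> /(fsubsetP Y'Y); rewrite !inE => /andP[-> /eqP].
rewrite fpowersetE in PX.
have [qP|Pq] := leqP q #|` P|.
  have [X' X'P cX'] := fsubset_card_ex qP.
  exists true, X', Y'; split=> //.
  - exact: fsubset_trans X'P (fsubset_trans PX X0X).
  - by apply/fsubsetP => y /Y'P[].
  - move=> x y /(fsubsetP X'P) + /Y'P[_ eP]; rewrite -eP !inE => /andP[_].
    by [].
have qC : q <= #|` X0 `\` P| by rewrite cardfsDS// cX0; lia.
have [X' X'P cX'] := fsubset_card_ex qC.
exists false, X', Y'; split=> //.
- exact: fsubset_trans X'P (fsubset_trans (fsubsetDl _ _) X0X).
- by apply/fsubsetP => y /Y'P[].
- move=> x y /(fsubsetP X'P) + /Y'P[_ eP]; rewrite -eP !inE => /andP[+ xX0].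
  by rewrite xX0 => /negPf.
Qed.

End Ramsey.

Section VertexTypes.

(** V b is the set of vertices of type b.  The last clause is what an ultrafilter
    provides; it keeps every finite piece of a copy extendable. *)
Definition vertex_types (c : nat -> nat -> bool) (V : bool -> set nat) : Prop :=
  [/\ forall v, (0 < v)%N -> exists b, V b v,
      forall b v, V b v -> ~ V (~~ b) v,
      forall b v, V b v -> (0 < v)%N
    & forall b (Y Z : {fset nat}), (forall y, y \in Y -> V b y) ->
      exists w, [/\ (0 < w)%N, w \notin Z & forall y, y \in Y -> c y w = b]].

(** The type of v is the colour b for which the b-neighbourhood of v belongs to
    a fixed nonprincipal ultrafilter. *)
Lemma vertex_types_exist (c : nat -> nat -> bool) : exists V, vertex_types c V.
Proof.
have [U [UU ooU]] := @ultraFilterLemma nat \oo _.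
have FU : ProperFilter U by exact: ultra_proper.
have FU0 : Filter U by exact: filter_filter.
(* For b = false this is the failure of U, which an ultrafilter turns into
   membership of the complement. *)
pose V (b : bool) := [set v | (0 < v)%N /\ (U [set w | c v w = true] <-> b = true)].
exists V; split.
- move=> v v0; have [h|h] := pselect (U [set w | c v w = true]).
    by exists true; split.
  by exists false; split.
- by move=> b v [_ h1] [_ h2]; case: b h1 h2 => h1 h2;
    [have := h2.1 (h1.2 erefl)|have := h1.1 (h2.2 erefl)].
- by move=> b v [].
- move=> b Y Z YV.
  have UY : U [set w | forall y, y \in Y -> c y w = b].
    have : forall s : seq nat, {subset s <= Y} -> U [set w | forall y, y \in s -> c y w = b].
      elim=> [|x s IH] sub; first by apply: filterS filterT.
      have [x0 hx] := YV x (sub x (mem_head _ _)).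
      have Ux : U [set w | c x w = b].
        case: b hx {YV IH} => hx; first by apply/hx.
        case: (in_ultra_setVsetC [set w | c x w = true] UU) => [/hx//|].
        by apply: filterS => w /= /negP/negbTE.
      have sub' : {subset s <= Y} by move=> y ys; apply: sub; rewrite inE ys orbT.
      have UI := @filterI _ _ FU0 _ _ Ux (IH sub').
      apply: filterS UI => w [xw sw] y; rewrite inE => /orP[/eqP->|/sw//].
      exact: xw.
    by apply; move=> y.
  have UZ : U [set w | (0 < w)%N /\ w \notin Z].
    apply: ooU; exists (\max_(v <- Z) v).+1 => // w /= lt; split; first exact: leq_ltn_trans lt.
    apply/negP => wZ; move: lt; rewrite ltnNge => /negP; apply.
    by apply: leq_bigmax_seq.
  have [w [wY [w0 wZ]]] := filter_ex (@filterI _ _ FU0 _ _ UY UZ).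
  by exists w.
Qed.

End VertexTypes.

(** * Cardinalities and densities *)

Section Cardinality.

Lemma ncard_eqI (T : Type) (S : set T) n : (S #= `I_n)%card -> ncard S = n.
Proof. exact: (@card_fset_set {classic T}). Qed.

Lemma ncard_II (T : Type) (S : set T) : finite_set S -> (S #= `I_(ncard S))%card.
Proof. by move=> /finite_setP[n Sn]; rewrite (ncard_eqI Sn). Qed.

Lemma mem_fset_classic (T : Type) (A : set T) (x : T) : finite_set A ->
  (x : {classic T}) \in fset_set (A : set {classic T}) <-> A x.
Proof.
by move=> fA; rewrite (@in_fset_set {classic T} A fA); split; rewrite inE.
Qed.

Lemma ncard_fset (T : choiceType) (X : {fset T}) : ncard [set` X] = #|` X|.
Proof.
have [n Xn] := (finite_setP _).1 (finite_fset X).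
by rewrite (ncard_eqI Xn) -[in RHS](set_fsetK X) (card_fset_set Xn).
Qed.

Lemma ncard_image (T T' : Type) (f : T -> T') (S : set T) : finite_set S ->
  (forall x y, S x -> S y -> f x = f y -> x = y) -> ncard (f @` S) = ncard S.
Proof.
move=> fS finj; apply: ncard_eqI; apply: card_eq_trans (ncard_II fS).
by apply: inj_card_eq => x y; rewrite !inE; apply: finj.
Qed.

Lemma ncard_le (T : Type) (A B : set T) : finite_set B -> A `<=` B ->
  (ncard A <= ncard B)%N.
Proof.
move=> fB AB; apply: fsubset_leq_card; apply/fsubsetP => x.
have fA := sub_finite_set AB fB.
by move=> /(mem_fset_classic _ fA)/AB /(mem_fset_classic _ fB).
Qed.

Lemma ncard0 (T : Type) : ncard (set0 : set T) = 0%N.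
Proof. by apply: ncard_eqI; rewrite II0. Qed.

Lemma ncardU (T : Type) (A B : set T) : finite_set A -> finite_set B ->
  (forall x, A x -> ~ B x) -> ncard (A `|` B) = (ncard A + ncard B)%N.
Proof.
move=> fA fB dAB; rewrite /ncard (@fset_setU {classic T})// cardfsU.
rewrite (_ : (_ `&` _)%fset = fset0) ?cardfs0 ?subn0//.
apply/fsetP => x; rewrite !inE; apply/negP => /andP[].
by move=> /(mem_fset_classic _ fA)/dAB + /(mem_fset_classic _ fB).
Qed.

Lemma ncardU_le (T : Type) (A B : set T) : finite_set A -> finite_set B ->
  (ncard (A `|` B) <= ncard A + ncard B)%N.
Proof.
by move=> fA fB; rewrite /ncard (@fset_setU {classic T})// cardfsU leq_subr.
Qed.

Lemma ncard_eq0 (T : Type) (A : set T) : finite_set A -> ncard A = 0%N -> A = set0.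
Proof.
move=> fA /eqP; rewrite cardfs_eq0 => /eqP A0; apply/seteqP; split=> // x Ax.
have /(mem_fset_classic x fA) := Ax.
by rewrite A0 inE.
Qed.

Lemma ncard_inj_ex (T : Type) (S : set T) (X : {fset nat}) :
  finite_set S -> (ncard S <= #|` X|)%N ->
  exists f : T -> nat, [/\ forall x y, S x -> S y -> f x = f y -> x = y,
    forall x, S x -> f x \in X & (ncard S = #|` X|)%N -> forall y, y \in X -> exists2 x, S x & f x = y].
Proof.
move=> fS le; pose F := fset_set (S : set {classic T}).
pose f (x : {classic T}) := nth 0%N X (index x F).
have memF (x : {classic T}) : S x -> x \in F by move/(mem_fset_classic x fS).
have lt (x : {classic T}) : S x -> (index x F < #|` X|)%N.
  by move=> Sx; apply: leq_trans le; rewrite index_mem memF.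
exists f; split.
- move=> x y Sx Sy /eqP; rewrite nth_uniq ?fset_uniq ?lt// => /eqP e.
  rewrite -(@nth_index {classic T} x x F (memF x Sx)) e.
  by rewrite (@nth_index {classic T})// memF.
- by move=> x Sx; rewrite mem_nth// lt.
- move=> e y yX; have iy : (index y X < #|` F|)%N by rewrite -/(ncard S) e index_mem.
  have x0 : {classic T} by case: (enum_fset F) iy => [|x ?] //; rewrite ltn0.
  exists (nth x0 F (index y X)).
    by have /(mem_fset_classic _ fS) := mem_nth x0 iy.
  by rewrite /f index_uniq ?fset_uniq// nth_index.
Qed.

Definition count_upto (n : nat) (S : set nat) : nat :=
  ncard (S `&` [set k | (1 <= k <= n)%N]).

Lemma finite_upto n (S : set nat) : finite_set (S `&` [set k | (1 <= k <= n)%N]).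
Proof.
apply: (@sub_finite_set _ _ `I_n.+1); last exact: finite_II.
by move=> k [_ /= /andP[_ kn]].
Qed.

Lemma count_upto_le n (S S' : set nat) : S `<=` S' ->
  (count_upto n S <= count_upto n S')%N.
Proof.
by move=> SS'; apply: ncard_le (finite_upto n S') _ => k [Sk kn]; split=> //; apply: SS'.
Qed.

Lemma ncard_upto n : ncard [set k | (1 <= k <= n)%N] = n.
Proof.
rewrite (_ : [set _ | _] = succn @` `I_n).
  by rewrite ncard_image; [exact: ncard_eqI|exact: finite_II|move=> x y _ _ []].
apply/seteqP; split=> [[|k] //= kn|_ [k /= kn <-]]; last by [].
by exists k.
Qed.

Lemma count_upto_leq n (S : set nat) : (count_upto n S <= n)%N.
Proof.
rewrite -[leqRHS]ncard_upto; apply: ncard_le; last by move=> k [].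
by apply: sub_finite_set (finite_upto n setT) => k.
Qed.

End Cardinality.

Section Density.
Context {R : realType}.

Lemma limf_esup_le (X : choiceType) (Y : filteredType X) (u : Y -> \bar R)
    (F : set (set Y)) (l : \bar R) (A : set Y) :
  F A -> (forall x, A x -> (u x <= l)%E) -> (limf_esup u F <= l)%E.
Proof.
move=> FA ul; apply: ge_ereal_inf; exists (ereal_sup (u @` A)); first by exists A.
by apply: ge_ereal_sup => _ [x Ax <-]; apply: ul.
Qed.

Lemma limf_esup_ge (X : choiceType) (Y : filteredType X) (u : Y -> \bar R)
    (F : set (set Y)) (l : \bar R) :
  (forall A, F A -> exists2 x, A x & (l <= u x)%E) -> (l <= limf_esup u F)%E.
Proof.
move=> often; apply: le_ereal_inf_tmp => _ [A FA <-].
have [x Ax lx] := often A FA.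
by apply: le_trans lx _; apply: ereal_sup_ubound; exists x.
Qed.

Lemma upper_density_ge (S : set nat) (l : R) :
  (forall N, exists2 n, (N < n)%N & l * n%:R <= (count_upto n S)%:R) ->
  (l%:E <= upper_density S)%E.
Proof.
move=> often; apply: limf_esup_ge => A [N _ NA]; have [n Nn ln] := often N.
exists n; first by apply: NA; exact: ltnW.
by rewrite lee_fin ler_pdivlMr// ltr0n (leq_trans _ Nn).
Qed.

Lemma upper_density_le (S : set nat) (l : R) (N : nat) :
  (forall n, (N < n)%N -> (count_upto n S)%:R <= l * n%:R) ->
  (upper_density S <= l%:E)%E.
Proof.
move=> le; apply: (@limf_esup_le _ _ _ _ _ [set n | (N < n)%N]).
  by exists N.+1.
move=> n /= Nn; rewrite lee_fin ler_pdivrMr ?le//.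
by rewrite ltr0n (leq_trans _ Nn).
Qed.

End Density.

(** * Construction of monochromatic copies *)

Section Embedding.
Context {T : Type}.
Variables (H : graph T) (P Q : set T).
Variables (c : nat -> nat -> bool) (V : bool -> set nat) (b : bool).
Hypotheses (HPQ : vert H = P `|` Q) (dPQ : forall v, P v -> ~ Q v).
Hypotheses (iP : independent H P) (iQ : independent H Q).
Hypotheses (lfH : locally_finite H) (csym : coloring c) (tV : vertex_types c V).

(** A finite piece of a copy of H of colour b.  The vertices of P enter after
    all their neighbours, and those of Q sit on vertices of type b: so every
    neighbour of a new vertex of Q is new as well, and the neighbours of a new
    vertex of P have common neighbours of colour b. *)
Definition partial_copy (D : set T) (phi : T -> nat) : Prop :=
  [/\ finite_set D, D `<=` vert H,
      forall u v, D u -> D v -> phi u = phi v -> u = v,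
      forall v, D v -> (0 < phi v)%N
    & [/\ forall q, D q -> Q q -> V b (phi q),
          forall p u, D p -> P p -> adj H p u -> D u
        & forall u v, D u -> D v -> adj H u v -> c (phi u) (phi v) = b]].

Definition extends (D : set T) (phi : T -> nat) (D' : set T) (phi' : T -> nat) :=
  D `<=` D' /\ forall v, D v -> phi' v = phi v.

Lemma extends_refl D phi : extends D phi D phi.
Proof. by split. Qed.

Lemma extends_trans D1 phi1 D2 phi2 D3 phi3 : extends D1 phi1 D2 phi2 ->
  extends D2 phi2 D3 phi3 -> extends D1 phi1 D3 phi3.
Proof.
move=> [D12 e12] [D23 e23]; split=> [|v D1v]; first exact: subset_trans D23.
by rewrite e23 ?e12//; apply: D12.
Qed.

Lemma extends_image D phi D' phi' : extends D phi D' phi' ->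
  phi @` D `<=` phi' @` D'.
Proof. by move=> [DD' e] _ [v Dv <-]; exists v; [apply: DD'|apply: e]. Qed.

Lemma adj_of_P p u : P p -> adj H p u -> Q u.
Proof.
move=> Pp pu; have [_] := adj_vert pu; rewrite HPQ => -[Pu|//].
by case: (iP.2 p u Pp Pu pu).
Qed.

Lemma adj_of_Q q u : Q q -> adj H q u -> P u.
Proof.
move=> Qq qu; have [_] := adj_vert qu; rewrite HPQ => -[//|Qu].
by case: (iQ.2 q u Qq Qu qu).
Qed.

Lemma finite_nbr v : finite_set (nbr H v).
Proof.
have [Hv|nHv] := pselect (vert H v); first exact: lfH.
rewrite (_ : nbr H v = set0) ?finite_set0//.
by apply/seteqP; split=> // u vu; have [] := adj_vert vu.
Qed.

Lemma finite_nbrs (S : set T) : finite_set S -> finite_set (nbrs H S).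
Proof.
move=> fS; apply: sub_finite_set (@subDsetl _ _ _) _.
by apply: bigcup_finite => // v _; apply: finite_nbr.
Qed.

Lemma partial_copy_union D phi D0 psi : partial_copy D phi ->
    finite_set D0 -> D0 `<=` vert H -> (forall v, D0 v -> ~ D v) ->
    (forall u v, D0 u -> D0 v -> psi u = psi v -> u = v) ->
    (forall v, D0 v -> ~ (phi @` D) (psi v)) -> (forall v, D0 v -> (0 < psi v)%N) ->
    (forall q, D0 q -> Q q -> V b (psi q)) ->
    (forall p u, D0 p -> P p -> adj H p u -> D u \/ D0 u) ->
    (forall u v, D0 u -> D0 v -> adj H u v -> c (psi u) (psi v) = b) ->
    (forall u v, D0 u -> D v -> adj H u v -> c (psi u) (phi v) = b) ->
  exists phi', [/\ partial_copy (D `|` D0) phi', extends D phi (D `|` D0) phi'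
    & forall v, D0 v -> phi' v = psi v].
Proof.
move=> [fD DH injD posD [QD PD cD]] fD0 D0H dis injD0 offD posD0 QD0 PD0 cD0 cDD0.
pose phi' v := if `[< D0 v >] then psi v else phi v.
have e0 v : D0 v -> phi' v = psi v by move=> h; rewrite /phi'; case: asboolP.
have e1 v : D v -> phi' v = phi v.
  by move=> Dv; rewrite /phi'; case: asboolP => // /dis.
exists phi'; split; [|by split=> // v Dv; left|exact: e0].
split.
- by rewrite finite_setU; split.
- by move=> v [/DH|/D0H].
- move=> u v [Du|Du] [Dv|Dv]; rewrite ?(e0 _ Du) ?(e0 _ Dv) ?(e1 _ Du) ?(e1 _ Dv) => e.
  + exact: injD.
  + by case: (offD v Dv); exists u.
  + by case: (offD u Du); exists v.
  + exact: injD0.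
- by move=> v [Dv|Dv]; rewrite ?(e0 _ Dv) ?(e1 _ Dv); [apply: posD|apply: posD0].
- split.
  + by move=> q [Dv|Dv]; rewrite ?(e0 _ Dv) ?(e1 _ Dv); [apply: QD|apply: QD0].
  + move=> p u [Dp|Dp] Pp pu; last by case: (PD0 p u Dp Pp pu); [left|right].
    by left; apply: PD pu.
  + move=> u v [Du|Du] [Dv|Dv]; rewrite ?(e0 _ Du) ?(e0 _ Dv) ?(e1 _ Du) ?(e1 _ Dv) => uv.
    * exact: cD.
    * by rewrite csym; apply: cDD0 => //; apply: adj_sym.
    * exact: cDD0.
    * exact: cD0.
Qed.

(** A new vertex of Q has no neighbour in the domain, so it can be placed
    anywhere in type b.  The same holds for isolated vertices; without them the
    copy could not absorb all vertices of type b when Q is finite. *)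
Lemma extend_Q_or_isolated D phi v a : partial_copy D phi -> vert H v -> ~ D v ->
    Q v \/ (forall u, ~ adj H v u) -> V b a -> ~ (phi @` D) a ->
  exists D' phi', [/\ partial_copy D' phi', extends D phi D' phi', D' v & phi' v = a].
Proof.
move=> pD Hv nDv vQ Va na; have [_ _ posV _] := tV.
have [_ _ _ _ [QD PD cD]] := pD.
have [| | | | | | | | | |phi' [pD' ext e]] :=
    @partial_copy_union D phi [set v] (fun=> a) pD.
- exact: finite_set1.
- by move=> _ ->.
- by move=> _ ->.
- by move=> _ _ -> ->.
- by [].
- by move=> _ _; apply: posV Va.
- by [].
- move=> p u -> Pp vu; case: vQ => [/(dPQ Pp)//|no].
  by case: (no u).
- by move=> _ _ -> -> vv; case: (adj_irr vv).
- move=> _ u -> Du vu; case: vQ => [Qv|no]; last by case: (no u).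
  by case: nDv; apply: (PD u) (adj_sym vu) => //; apply: adj_of_Q vu.
- by exists (D `|` [set v]), phi'; split=> //; [right|rewrite e].
Qed.

Lemma extend_finite (A : Type) (S : set A)
    (G : A -> set T -> (T -> nat) -> Prop) : finite_set S ->
    (forall a D phi, S a -> partial_copy D phi ->
       exists D' phi', [/\ partial_copy D' phi', extends D phi D' phi' & G a D' phi']) ->
    (forall a D phi D' phi', extends D phi D' phi' -> G a D phi -> G a D' phi') ->
  forall D phi, partial_copy D phi ->
  exists D' phi', [/\ partial_copy D' phi', extends D phi D' phi'
    & forall a, S a -> G a D' phi'].
Proof.
move=> fS step mono.
have [X SX] := (@finite_fsetP {classic A} S).1 fS.
have key : forall s : seq {classic A}, {subset s <= X} -> forall D phi, partial_copy D phi ->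
    exists D' phi', [/\ partial_copy D' phi', extends D phi D' phi'
      & forall a, a \in s -> G a D' phi'].
  elim=> [|a s IH] sub D phi pD.
    by exists D, phi; split=> //; exact: extends_refl.
  have Sa : S a by rewrite SX; apply: sub; exact: mem_head.
  have [D1 [phi1 [p1 e1 G1]]] := step a D phi Sa pD.
  have [|D2 [phi2 [p2 e2 G2]]] := IH _ D1 phi1 p1.
    by move=> x xs; apply: sub; rewrite inE xs orbT.
  exists D2, phi2; split=> //; first exact: extends_trans e2.
  by move=> x; rewrite inE => /orP[/eqP->|/G2//]; apply: mono e2 G1.
move=> D phi pD; have [//|D' [phi' [p' e' G']]] := key X _ D phi pD.
by exists D', phi'; split=> // a; rewrite SX => /G'.
Qed.

Section Infinite.
Hypothesis Vb_infinite : forall Z : {fset nat}, exists2 a, V b a & a \notin Z.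

Lemma unused_vertex (D : set T) (phi : T -> nat) : finite_set D -> exists2 a, V b a & ~ (phi @` D) a.
Proof.
move=> fD; have [Z eZ] := (@finite_fsetP nat _).1 (finite_image phi fD).
have [a Va aZ] := Vb_infinite Z; exists a => //.
by rewrite eZ /=; apply/negP.
Qed.

(** For v in P, the finitely many neighbours of v are placed first, on vertices
    of type b; then v goes to an unused common neighbour of their images. *)
Lemma extend_dom D phi v : partial_copy D phi -> vert H v ->
  exists D' phi', [/\ partial_copy D' phi', extends D phi D' phi' & D' v].
Proof.
have addQ q D1 phi1 : Q q -> partial_copy D1 phi1 ->
    exists D' phi', [/\ partial_copy D' phi', extends D1 phi1 D' phi' & D' q].
  move=> Qq pD1; have [Dq|nDq] := pselect (D1 q).
    by exists D1, phi1; split=> //; exact: extends_refl.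
  have fD1 : finite_set D1 by case: pD1.
  have [a Va na] := unused_vertex phi1 fD1.
  have Hq : vert H q by rewrite HPQ; right.
  have [D' [phi' [? ? ? _]]] := extend_Q_or_isolated pD1 Hq nDq (or_introl Qq) Va na.
  by exists D', phi'.
move=> pD; rewrite HPQ => -[Pv|/addQ]; last exact.
have [|||D1 [phi1 [pD1 e1 N1]]] :=
    @extend_finite T (nbr H v) (fun u D _ => D u) _ _ _ D phi pD.
- exact: finite_nbr.
- by move=> u D1 phi1 vu; apply: addQ; apply: adj_of_P vu.
- by move=> u D1 phi1 D2 phi2 [sub _]; apply: sub.
have [Dv|nDv] := pselect (D1 v); first by exists D1, phi1.
have [fD1 DH _ _ [QD PD cD]] := pD1.
have [Z eZ] := (@finite_fsetP nat _).1 (finite_image phi1 fD1).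
have [Y eY] := (@finite_fsetP nat _).1 (finite_image phi1 (finite_nbr v)).
have [_ _ _ common] := tV.
have [|w [w0 wZ wY]] := common b Y Z.
  move=> y yY; have : [set` Y] y by [].
  rewrite -eY => -[u vu <-]; apply: QD; first exact: N1.
  exact: adj_of_P vu.
have nw : ~ (phi1 @` D1) w by rewrite eZ /=; apply/negP.
have [| | | | | | | | | |phi' [pD' ext e]] :=
    @partial_copy_union D1 phi1 [set v] (fun=> w) pD1.
- exact: finite_set1.
- by move=> _ ->; rewrite HPQ; left.
- by move=> _ ->.
- by move=> _ _ -> ->.
- by [].
- by [].
- by move=> q -> /(dPQ Pv).
- by move=> p u -> _ vu; left; apply: N1.
- by move=> _ _ -> -> vv; case: (adj_irr vv).
- move=> _ u -> Du vu; rewrite csym; apply: wY.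
  have : (phi1 @` nbr H v) (phi1 u) by exists u.
  by rewrite eY.
- exists (D1 `|` [set v]), phi'; split=> //; last by right.
  exact: extends_trans ext.
Qed.

Hypothesis free_vertex : forall D, finite_set D ->
  exists v, [/\ vert H v, ~ D v & Q v \/ (forall u, ~ adj H v u)].

Lemma extend_cover (S : set nat) D phi : finite_set S -> S `<=` V b ->
    partial_copy D phi ->
  exists D' phi', [/\ partial_copy D' phi', extends D phi D' phi' & S `<=` phi' @` D'].
Proof.
move=> fS SV pD.
have [|||D' [phi' [p' e' G']]] :=
    @extend_finite nat S (fun a D phi => (phi @` D) a) _ _ _ D phi pD => //.
- move=> a D1 phi1 Sa p1; have [Da|nDa] := pselect ((phi1 @` D1) a).
    by exists D1, phi1; split=> //; exact: extends_refl.
  have [v [Hv nDv vQ]] : exists v, [/\ vert H v, ~ D1 v & Q v \/ (forall u, ~ adj H v u)].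
    by apply: free_vertex; case: p1.
  have [D' [phi' [? ? D'v ea]]] := extend_Q_or_isolated p1 Hv nDv vQ (SV a Sa) nDa.
  by exists D', phi'; split=> //; exists v.
- by move=> a D1 phi1 D2 phi2 /extends_image; apply.
- by exists D', phi'.
Qed.

(** What tiles need of H: sets to be placed on them that are far away from
    everything placed before. *)
Definition rich (s r : nat) := forall D : set T, finite_set D ->
  exists I : set T, [/\ I `<=` P, finite_set I, ncard I = s,
    forall v, (I `|` nbrs H I) v -> ~ D v & (ncard (nbrs H I) <= r)%N].

Local Notation E := (fun x y => c x y = b).

(** The whole neighbourhood of I is placed together with I, so I may go to
    vertices of the wrong type. *)
Lemma extend_tile (s r : nat) (X : set nat) Z D phi : rich s r -> X `<=` V (~~ b) ->
    tile E X (V b) s r Z -> (forall v, v \in (Z.1 `|` Z.2)%fset -> ~ (phi @` D) v) ->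
    partial_copy D phi ->
  exists D' phi', [/\ partial_copy D' phi', extends D phi D' phi',
    [set` Z.1] `<=` phi' @` D'
    & phi' @` D' `<=` phi @` D `|` [set` (Z.1 `|` Z.2)%fset] ].
Proof.
move=> richsr XV [ZX cX ZV cV cZ] off pD.
have [fD DH _ _ [QD PD cD]] := pD.
have [I [IP fI cI IN_D cN]] := richsr D fD.
have fN := finite_nbrs fI; set N := nbrs H I in IN_D cN fN.
have [f [finj fX fsurj]] : exists f : T -> nat,
    [/\ forall x y, I x -> I y -> f x = f y -> x = y, forall x, I x -> f x \in Z.1
     & (ncard I = #|` Z.1|)%N -> forall y, y \in Z.1 -> exists2 x, I x & f x = y].
  by apply: ncard_inj_ex; rewrite ?cI ?cX.
have [g [ginj gV _]] : exists f : T -> nat,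
    [/\ forall x y, N x -> N y -> f x = f y -> x = y, forall x, N x -> f x \in Z.2
     & (ncard N = #|` Z.2|)%N -> forall y, y \in Z.2 -> exists2 x, N x & f x = y].
  by apply: ncard_inj_ex; rewrite ?cV.
have NQ v : N v -> Q v by move=> [[u Iu uv] _]; apply: adj_of_P uv; apply: IP.
have NnI v : N v -> ~ I v by move=> [].
have IN u v : I u -> adj H u v -> N v.
  move=> Iu uv; split; first by exists u.
  by move=> Iv; apply: iP.2 uv; apply: IP.
have [_ Vdis Vpos _] := tV.
have ZZ x : x \in Z.1 -> x \in Z.2 -> False.
  by move=> /ZX/XV Vx /ZV/Vdis.
pose psi v := if `[< I v >] then f v else g v.
have eI v : I v -> psi v = f v by move=> h; rewrite /psi; case: asboolP.
have eN v : N v -> psi v = g v by move/NnI => h; rewrite /psi; case: asboolP.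
have psiZ v : (I `|` N) v -> psi v \in (Z.1 `|` Z.2)%fset.
  by rewrite inE => -[h|h]; rewrite ?(eI _ h) ?(eN _ h) ?fX ?gV ?orbT.
have [| | | | | | | | | |phi' [pD' ext e]] :=
    @partial_copy_union D phi (I `|` N) psi pD.
- by rewrite finite_setU.
- by move=> v [/IP|/NQ]; rewrite HPQ; [left|right].
- exact: IN_D.
- move=> u v [Iu|Nu] [Iv|Nv]; rewrite ?(eI _ Iu) ?(eI _ Iv) ?(eN _ Nu) ?(eN _ Nv) => euv.
  + exact: finj.
  + by case: (ZZ (f u) (fX u Iu)); rewrite euv gV.
  + by case: (ZZ (f v) (fX v Iv)); rewrite -euv gV.
  + exact: ginj.
- by move=> v /psiZ; apply: off.
- move=> v [h|h]; rewrite ?(eI _ h) ?(eN _ h).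
    exact: Vpos (XV _ (ZX _ (fX v h))).
  exact: Vpos (ZV _ (gV v h)).
- by move=> q [/IP/dPQ//|h] _; rewrite (eN _ h); apply: ZV; apply: gV.
- by move=> p u [Ip|/NQ Qp] Pp pu; [right; right; apply: IN pu|case: (dPQ Pp)].
- move=> u v [Iu|Nu] [Iv|Nv] uv; rewrite ?(eI _ Iu) ?(eI _ Iv) ?(eN _ Nu) ?(eN _ Nv).
  + by case: (iP.2 u v (IP _ Iu) (IP _ Iv)).
  + by apply: cZ; [apply: fX|apply: gV].
  + by rewrite csym; apply: cZ; [apply: fX|apply: gV].
  + by case: (iQ.2 u v (NQ _ Nu) (NQ _ Nv)).
- move=> u v [Iu|Nu] Dv uv.
    by case: (IN_D v) => //; right; apply: IN uv.
  case: (IN_D u); first by right.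
  by apply: PD (adj_sym uv) => //; apply: adj_of_Q uv; apply: NQ.
exists (D `|` (I `|` N)), phi'; split=> //.
- move=> x /= /(fsurj _) []; first by rewrite cI.
  by move=> u Iu <-; exists u; [right; left|rewrite e ?eI//; left].
- move=> _ [v [Dv|Iv] <-]; last by right; rewrite /= e//; apply: psiZ.
  by left; exists v => //; rewrite ext.2.
Qed.

Lemma extend_tiles (s r k : nat) (X : set nat) (Y : 'I_k -> {fset nat} * {fset nat}) :
    rich s r -> X `<=` V (~~ b) -> finite_set X -> tiling E X (V b) s r Y ->
  forall l : seq 'I_k, uniq l -> forall D phi, partial_copy D phi ->
    (forall i, i \in l -> forall v, v \in ((Y i).1 `|` (Y i).2)%fset -> ~ (phi @` D) v) ->
  exists D' phi', [/\ partial_copy D' phi', extends D phi D' phi'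
    & (s * size l <= ncard (phi' @` D' `&` X))%N].
Proof.
move=> richsr XV fX [tY dY]; have [_ Vdis _ _] := tV.
suff key : forall l : seq 'I_k, uniq l -> forall D phi, partial_copy D phi ->
    (forall i, i \in l -> forall v, v \in ((Y i).1 `|` (Y i).2)%fset -> ~ (phi @` D) v) ->
  exists D' phi', [/\ partial_copy D' phi', extends D phi D' phi'
    & (s * size l + ncard (phi @` D `&` X) <= ncard (phi' @` D' `&` X))%N].
  move=> l ul D phi pD off; have [D' [phi' [? ? le]]] := key l ul D phi pD off.
  by exists D', phi'; split=> //; apply: leq_trans le; rewrite leq_addr.
elim=> [|i l IH] /= => [_ D phi pD _|/andP[il ul] D phi pD off].
  by exists D, phi; split=> //; [exact: extends_refl|rewrite muln0].
have [|D1 [phi1 [p1 e1 sub1 sup1]]] := extend_tile richsr XV (tY i) _ pD.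
  by apply: off; rewrite mem_head.
have [ZX cX ZV _ _] := tY i.
have [|D2 [phi2 [p2 e2 le2]]] := IH ul D1 phi1 p1.
  move=> j jl v vj /sup1 [|].
    by apply: off vj; rewrite inE jl orbT.
  have [ZX' _ ZV' _ _] := tY j.
  have ij : i != j by apply: contraNneq il => ->.
  have [/fdisjointP d1 /fdisjointP d2] := dY i j ij.
  rewrite /= inE; move: vj; rewrite inE => /orP[vj|vj] /orP[vi|vi].
  - by have := d1 v vi; rewrite vj.
  - by apply: (Vdis b v); [apply: ZV|apply: XV; apply: ZX'].
  - by apply: (Vdis b v); [apply: ZV'|apply: XV; apply: ZX].
  - by have := d2 v vi; rewrite vj.
exists D2, phi2; split=> //; first exact: extends_trans e2.
apply: leq_trans le2; rewrite mulnS -addnA addnCA leq_add2l addnC.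
have fI (S : set nat) : finite_set (S `&` X) by apply: sub_finite_set fX => v [].
have <- : ncard [set` (Y i).1] = s by rewrite ncard_fset.
rewrite -ncardU//; last first.
  by move=> v [vD _] /= vi; apply: (off i (mem_head _ _) v) vD; rewrite inE vi.
apply: ncard_le => // v [[vD vX]|vi]; first by split=> //; apply: (extends_image e1).
by split; [apply: sub1|apply: ZX].
Qed.

Section Stage.
Context {R : realType}.

(** At such n a copy of colour b can reach density theta, since all vertices of
    type b and all tiles fit into it, if H is rich in sets of these sizes. *)
Definition coverable (s r : nat) (theta : R) (n : nat) := exists k (Y : 'I_k -> _),
  tiling E (V (~~ b) `&` [set v | (1 <= v <= n)%N]) (V b) s r Y /\
  theta * n%:R <= (count_upto n (V b) + s * k)%:R.

(** The domain of the given piece spoils a bounded number of tiles, which is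
    negligible for large n. *)
Lemma extend_density (s r : nat) (theta theta1 : R) : rich s r -> theta < theta1 ->
    (forall N, exists2 n, (N < n)%N & coverable s r theta1 n) ->
  forall D phi v N, partial_copy D phi -> vert H v ->
  exists D' phi' n, [/\ partial_copy D' phi', extends D phi D' phi', D' v, (N < n)%N
    & theta * n%:R <= (count_upto n (phi' @` D'))%:R].
Proof.
move=> richsr lt often D phi v N pD Hv.
have fD : finite_set D by case: pD.
have fim := finite_image phi fD.
have [Z eZ] := (@finite_fsetP nat _).1 fim.
(* The used vertices lie in Z; each of them spoils at most one tile. *)
pose d := #|` Z|.
have [n Nn [k [Y [tY ge]]]] := often (maxn N (Num.bound ((s * d)%:R / (theta1 - theta)))).
move: Nn; rewrite gtn_max => /andP[Nn dn].
have ltsd : (s * d)%:R <= (theta1 - theta) * n%:R.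
  rewrite mulrC -ler_pdivrMr ?subr_gt0// ltW//.
  apply: lt_le_trans (archi_boundP _) _; last by rewrite ler_nat ltnW.
  by rewrite divr_ge0// subr_ge0 ltW.
pose touch (i : 'I_k) := has (fun x => x \in Z) ((Y i).1 `|` (Y i).2)%fset.
pose X := V (~~ b) `&` [set v | (1 <= v <= n)%N].
have fX : finite_set X by exact: finite_upto.
have XV : X `<=` V (~~ b) by move=> x [].
have [tile_Y disY] := tY.
have [_ Vdis _ _] := tV.
have touched_le : (#|touch| <= d)%N.
  pose w (i : 'I_k) := nth 0%N ((Y i).1 `|` (Y i).2)%fset
    (find (fun x => x \in Z) ((Y i).1 `|` (Y i).2)%fset).
  have wP i : touch i -> w i \in ((Y i).1 `|` (Y i).2)%fset /\ w i \in Z.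
    by move=> ti; split; [rewrite mem_nth// -has_find|exact: (@nth_find _ _ (fun x => x \in Z))].
  rewrite cardE -(size_map w); apply: uniq_leq_size.
    rewrite map_inj_in_uniq ?enum_uniq// => i j; rewrite !mem_enum => ti tj ew.
    apply: contraTeq isT => ij.
    have [/fdisjointP d1 /fdisjointP d2] := disY i j ij.
    have [ZX' _ ZV' _ _] := tile_Y j; have [ZX _ ZV _ _] := tile_Y i.
    have [+ _] := wP j tj; have [+ _] := wP i ti; rewrite -ew !inE.
    move=> /orP[vi|vi] /orP[vj|vj].
    - by have := d1 _ vi; rewrite vj.
    - by case: (Vdis b (w i)); [apply: ZV'|apply: XV; apply: ZX].
    - by case: (Vdis b (w i)); [apply: ZV|apply: XV; apply: ZX'].
    - by have := d2 _ vi; rewrite vj.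
  by move=> x /mapP[i]; rewrite mem_enum => /wP[_ wZ] ->.
pose l := enum (predC touch).
have sl : (k - d <= size l)%N.
  have e := cardC touch; rewrite card_ord in e.
  by rewrite -cardE leq_subLR -[X in (X <= _)%N]e leq_add2r.
have [|D1 [phi1 [p1 e1 le1]]] := extend_tiles richsr XV fX tY (enum_uniq (predC touch)) pD.
  move=> i; rewrite mem_enum inE => /hasPn nt x /nt xZ.
  by rewrite eZ /=; apply/negP.
have [||D2 [phi2 [p2 e2 sub2]]] := @extend_cover (V b `&` [set v | (1 <= v <= n)%N]) D1 phi1 _ _ p1.
- exact: finite_upto.
- by move=> x [].
have [D3 [phi3 [p3 e3 Dv]]] := extend_dom p2 Hv.
exists D3, phi3, n; split=> //.
  exact: extends_trans e1 (extends_trans e2 e3).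
have le3 : (s * size l + count_upto n (V b) <= count_upto n (phi3 @` D3))%N.
  apply: leq_trans (leq_add le1 (leqnn _)) _.
  have fI (S : set nat) : finite_set (S `&` X) by apply: sub_finite_set fX => x [].
  rewrite -ncardU//; last by move=> x [_ [Vx _]] [Vx' _]; apply: (Vdis b x).
    apply: ncard_le; first exact: finite_upto.
    move=> x [[xD [_ xn]]|[Vx xn]]; split=> //; apply: (extends_image e3).
      exact: (extends_image e2).
    exact: sub2.
  exact: finite_upto.
have : (count_upto n (V b) + s * k <= count_upto n (phi3 @` D3) + s * d)%N.
  apply: leq_trans (_ : s * size l + count_upto n (V b) + s * d <= _)%N; last by rewrite leq_add2r.
  have lk : (k <= size l + d)%N by rewrite addnC -leq_subLR.
  by rewrite addnAC -mulnDr addnC leq_add2r leq_mul2l lk orbT.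
rewrite -(ler_nat R) natrD => le4.
move: ge le4 ltsd; rewrite !natrD; lra.
Qed.

End Stage.

(** Extending finite pieces infinitely often, the n-th time so as to include the
    n-th vertex of H and to be dense in some interval longer than n. *)
Lemma monochromatic_copy (R : realType) (s r : nat) (theta theta1 : R) :
    countably_infinite H -> rich s r -> theta < theta1 ->
    (forall N, exists2 n, (N < n)%N & coverable s r theta1 n) ->
  exists H' : graph nat, [/\ subgraph H' KN, isomorphic H H', monochromatic c H'
    & (theta%:E <= upper_density (vert H'))%E].
Proof.
move=> /card_set_bijP[idx [_ idx_inj idx_surj]] richsr lt often.
have idx_ex n : exists v, vert H v /\ idx v = n.
  by have [v Hv vn] := idx_surj n I; exists v.
have [e eP] := choice idx_ex.
have eV i : vert H (e i) by case: (eP i).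
have idxP v : vert H v -> e (idx v) = v.
  by move=> Hv; apply: idx_inj; rewrite ?inE//; case: (eP (idx v)).
pose State := {p : set T * (T -> nat) | partial_copy p.1 p.2}.
have stepP (x : nat * State) : exists y : State,
    [/\ extends (sval x.2).1 (sval x.2).2 (sval y).1 (sval y).2, (sval y).1 (e x.1)
      & exists2 n, (x.1 < n)%N & theta * n%:R <= (count_upto n ((sval y).2 @` (sval y).1))%:R].
  have [D' [phi' [n [p' e' Dv Nn ge]]]] :=
    extend_density richsr lt often x.1 (svalP x.2) (eV x.1).
  by exists (exist _ (D', phi') p'); split=> //; exists n.
have [F FP] := choice stepP.
have p0 : partial_copy set0 (fun=> 0%N) by split.
pose st := fix st n : State := if n is m.+1 then F (m, st m) else exist _ (set0, fun=> 0%N) p0.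
pose D n := (sval (st n)).1; pose phi n := (sval (st n)).2.
have pD n : partial_copy (D n) (phi n) by exact: (svalP (st n)).
have ext m n : (m <= n)%N -> extends (D m) (phi m) (D n) (phi n).
  move=> /subnK <-; elim: (n - m)%N => [|k IH]; first exact: extends_refl.
  apply: extends_trans IH _; rewrite addSn.
  by have [] := FP ((k + m)%N, st (k + m)%N).
have De i : D i.+1 (e i) by have [] := FP (i, st i).
pose psi v := phi (idx v).+1 v.
have psiE n v : D n v -> psi v = phi n v.
  move=> Dv; have Hv : vert H v by have [_ DH _ _ _] := pD n; apply: DH.
  have Dv' : D (idx v).+1 v by have := De (idx v); rewrite idxP.
  rewrite -((ext _ _ (leq_maxl n (idx v).+1)).2 v Dv).
  by rewrite ((ext _ _ (leq_maxr n (idx v).+1)).2 v Dv').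
have inD v : vert H v -> D (idx v).+1 v.
  by move=> Hv; have := De (idx v); rewrite idxP.
have inD2 u v : vert H u -> vert H v -> exists n, D n u /\ D n v.
  move=> Hu Hv; exists (maxn (idx u).+1 (idx v).+1); split.
    by apply: (ext _ _ (leq_maxl _ _)).1; apply: inD.
  by apply: (ext _ _ (leq_maxr _ _)).1; apply: inD.
have psi_inj u v : vert H u -> vert H v -> psi u = psi v -> u = v.
  move=> Hu Hv; have [n [Du Dv]] := inD2 u v Hu Hv.
  rewrite (psiE n u Du) (psiE n v Dv); have [_ _ inj _ _] := pD n.
  exact: inj.
have psi_pos v : vert H v -> (0 < psi v)%N.
  by move=> Hv; have [_ _ _ pos _] := pD (idx v).+1; apply: pos; apply: inD.
pose adj' m n := exists u v, [/\ adj H u v, psi u = m & psi v = n].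
have adj'_vert m n : adj' m n -> (psi @` vert H) m /\ (psi @` vert H) n.
  by move=> [u [v [uv <- <-]]]; have [Hu Hv] := adj_vert uv; split; [exists u|exists v].
have adj'_sym m n : adj' m n -> adj' n m.
  by move=> [u [v [uv eu ev]]]; exists v, u; split=> //; apply: adj_sym.
have adj'_irr n : ~ adj' n n.
  move=> [u [v [uv eu ev]]]; have [Hu Hv] := adj_vert uv.
  have euv : u = v by apply: psi_inj => //; rewrite eu ev.
  by move: uv; rewrite euv; apply: adj_irr.
exists (Graph adj'_vert adj'_sym adj'_irr); split=> /=.
- split=> /= [_ [v Hv <-]|m n mn]; first exact: psi_pos.
  have [[u Hu eu] [v Hv ev]] := adj'_vert m n mn.
  split; rewrite /posnat /= -?eu -?ev; [exact: psi_pos|exact: psi_pos|].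
  by rewrite eu ev => emn; move: mn; rewrite emn; apply: adj'_irr.
- exists psi; split; last first.
    move=> u v Hu Hv; split=> [uv|]; first by exists u, v.
    by move=> [u' [v' [uv /psi_inj eu /psi_inj ev]]]; have [Hu' Hv'] := adj_vert uv;
      rewrite -eu// -ev.
  split=> //=.
  by move=> u v; rewrite !inE => Hu Hv; apply: psi_inj.
- exists b => m n /= [u [v [uv <- <-]]]; have [Hu Hv] := adj_vert uv.
  have [k [Du Dv]] := inD2 u v Hu Hv.
  rewrite (psiE k u Du) (psiE k v Dv); have [_ _ _ _ [_ _ cD]] := pD k.
  exact: cD.
- apply: upper_density_ge => N; have [_ _ [n Nn ge]] := FP (N, st N).
  exists n => //; apply: le_trans ge _; rewrite ler_nat.
  apply: count_upto_le => _ [v Dv <-].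
  have Hv : vert H v by have [_ DH _ _ _] := pD N.+1; apply: DH.
  by exists v => //; rewrite (psiE N.+1 v Dv).
Qed.
End Infinite.

End Embedding.

(** * Lipschitz interpolation and bounds on h *)

Section Profile.
Context {R : realType}.

(** The points of Up are upper constraints: the value at p.1 is to be at most
    p.2.  The last term forces the value 0 at 0. *)
Definition envelope (Up : set (R * R)) (x : R) : R :=
  inf ([set p.2 + `|x - p.1| | p in Up] `|` [set `|x|]).

Section Envelope.
Variables (Up Lo : set (R * R)).
Hypothesis UpP : forall p, Up p -> 0 <= p.1 /\ - p.1 <= p.2.
Hypothesis LoP : forall p, Lo p -> 0 <= p.1 /\ p.2 <= p.1.
Hypothesis UpLo : forall p q, Up p -> Lo q -> q.2 - p.2 <= `|p.1 - q.1|.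

Let S x := [set p.2 + `|x - p.1| | p in Up] `|` [set `|x|].

Let S_lb x : lbound (S x) (- `|x|).
Proof.
move=> _ [[p Up_p <-]|->] /=; last first.
  by rewrite (le_trans _ (normr_ge0 x))// oppr_le0.
have [p0 pp] := UpP Up_p.
have := ler_norm (p.1 - x); rewrite (distrC p.1) => h1; have := ler_norm x; lra.
Qed.

Let S_inf x : has_inf (S x).
Proof. by split; [exists `|x|; right|exists (- `|x|); apply: S_lb]. Qed.

Lemma envelope_le_Up p : Up p -> envelope Up p.1 <= p.2.
Proof.
move=> Up_p; apply: ge_inf; first by have [] := S_inf p.1.
by left; exists p => //; rewrite subrr normr0 addr0.
Qed.

Lemma envelope_ge_Lo q : Lo q -> q.2 <= envelope Up q.1.
Proof.
move=> Lo_q; apply: lb_le_inf; first by have [] := S_inf q.1.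
have [q0 qq] := LoP Lo_q.
move=> _ [[p Up_p <-]|->] /=; last by rewrite ger0_norm.
by have := UpLo Up_p Lo_q; rewrite (distrC q.1); lra.
Qed.

Lemma envelope0 : envelope Up 0 = 0.
Proof.
apply/eqP; rewrite eq_le; apply/andP; split.
  by apply: ge_inf; [have [] := S_inf 0|right; rewrite /= normr0].
apply: lb_le_inf; first by have [] := S_inf 0.
by move=> y /S_lb; rewrite normr0 oppr0.
Qed.

Lemma envelope_lipschitz : 1.-lipschitz_[set x : R | 0 <= x] (envelope Up).
Proof.
have key x y : envelope Up x <= envelope Up y + `|x - y|.
  rewrite -lerBlDr; apply: lb_le_inf; first by have [] := S_inf y.
  have t (p : R) : `|x - p| <= `|y - p| + `|x - y|.
    by rewrite (_ : x - p = (y - p) + (x - y)) ?ler_normD//; ring.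
  move=> _ [[p Up_p <-]|->] /=; rewrite lerBlDr.
    apply: (@le_trans _ _ (p.2 + `|x - p.1|)); last by have := t p.1; lra.
    by apply: ge_inf; [have [] := S_inf x|left; exists p].
  apply: (@le_trans _ _ `|x|); last by have := t 0; rewrite !subr0.
  by apply: ge_inf; [have [] := S_inf x|right].
move=> [x y] _ /=; rewrite mul1r ler_norml.
by have := key x y; have := key y x; rewrite (distrC y); lra.
Qed.

End Envelope.

Local Open Scope ereal_scope.

Lemma Gamma_plus_le (gamma : R) (g : R -> R) (t x : R) :
  (0 <= x)%R -> (t <= gamma * x + g x)%R -> Gamma_plus gamma g t <= x%:E.
Proof. by move=> x0 tx; apply: ereal_inf_lbound; exists x. Qed.

Lemma Gamma_minus_le (gamma : R) (g : R -> R) (t x : R) :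
  (0 <= x)%R -> (t <= gamma * x - g x)%R -> Gamma_minus gamma g t <= x%:E.
Proof. by move=> x0 tx; apply: ereal_inf_lbound; exists x. Qed.

Lemma Gamma_plus_ge0 (gamma : R) (g : R -> R) (t : R) : 0 <= Gamma_plus gamma g t.
Proof. by apply: le_ereal_inf_tmp => _ [x [x0 _] <-]; rewrite lee_fin. Qed.

Lemma Gamma_minus_ge0 (gamma : R) (g : R -> R) (t : R) : 0 <= Gamma_minus gamma g t.
Proof. by apply: le_ereal_inf_tmp => _ [x [x0 _] <-]; rewrite lee_fin. Qed.

Lemma h_ge0 (gamma : R) : 0 <= h gamma.
Proof.
apply: le_ereal_inf_tmp => _ [g _ <-]; apply: limf_esup_ge => A.
move=> [M [Mreal MA]]; pose t := (`|M| + 1)%R.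
exists t; first by apply: MA; rewrite /t; have := ler_norm M; lra.
apply: mule_ge0; first by apply: adde_ge0; [exact: Gamma_plus_ge0|exact: Gamma_minus_ge0].
by rewrite lee_fin invr_ge0 addr_ge0.
Qed.

(** An upper constraint (x, y) bounds Gamma_minus by x at t = gamma x - y, a
    lower constraint bounds Gamma_plus, and the envelope of the upper
    constraints is an admissible function that meets both kinds. *)
Lemma h_le_family (gamma L t0 : R) (Up Lo : set (R * R)) :
    (forall p, Up p -> 0 <= p.1 /\ - p.1 <= p.2)%R ->
    (forall p, Lo p -> 0 <= p.1 /\ p.2 <= p.1)%R ->
    (forall p q, Up p -> Lo q -> q.2 - p.2 <= `|p.1 - q.1|)%R ->
    (forall t, t0 <= t -> exists p q, [/\ Up p, Lo q, t <= gamma * p.1 - p.2,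
       t <= gamma * q.1 + q.2 & p.1 + q.1 <= L * t])%R ->
  h gamma <= L%:E.
Proof.
move=> UpP LoP UpLo cover.
apply: ge_ereal_inf; eexists.
  exists (envelope Up) => //; split; last exact: envelope0.
  exact: envelope_lipschitz.
apply: (@limf_esup_le _ _ _ _ _ _ [set t | (Num.max t0 0 < t)%R]).
  by exists (Num.max t0 0)%R; split; [exact: num_real|].
move=> t /=; rewrite gt_max => /andP[t0t t_gt0].
rewrite lee_pdivrMr//.
have [p [q [Up_p Lo_q tp tq pq]]] := cover t (ltW t0t).
apply: (@le_trans _ _ (q.1%:E + p.1%:E)); last by rewrite -EFinM -EFinD lee_fin addrC.
apply: leeD.
  apply: Gamma_plus_le; first by have [] := LoP q Lo_q.
  by have := envelope_ge_Lo UpP LoP UpLo Lo_q; lra.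
apply: Gamma_minus_le; first by have [] := UpP p Up_p.
by have := envelope_le_Up UpP Up_p; lra.
Qed.


(** A zigzag that touches the lines of slope cc and - cc alternately at the
    powers of a large q, where |gamma| < cc < 1. *)
Lemma h_bounded (gamma : R) : (`|gamma| < 1)%R -> exists L : R, h gamma <= L%:E.
Proof.
move=> g1; pose cc : R := ((1 + `|gamma|) / 2)%R.
have [gc c1] : (`|gamma| < cc /\ cc < 1)%R by rewrite /cc; split; lra.
have c0 : (0 <= cc)%R := le_trans (normr_ge0 _) (ltW gc).
(* Upper constraints sit at the odd powers of q and lower ones at the even
   powers; this q is large enough for slopes 1 and - 1 to connect them. *)
pose q : R := (2 + (1 + cc) / (1 - cc))%R.
have q2 : (2 <= q)%R by rewrite /q lerDl divr_ge0//; lra.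
have qc : (1 + cc <= (1 - cc) * q)%R.
  by rewrite -ler_pdivrMl ?subr_gt0// /q mulrC; lra.
have qpos n : (0 < q ^+ n)%R by rewrite exprn_gt0//; lra.
have sep m n : (m < n)%N -> (cc * (q ^+ m + q ^+ n) <= q ^+ n - q ^+ m)%R.
  move=> mn; have : (q * q ^+ m <= q ^+ n)%R.
    by rewrite -exprS ler_weXn2l//; lra.
  move=> h1; have h2 := ler_wpM2l (_ : 0 <= 1 - cc)%R h1.
  have := h2 (_ : _); rewrite subr_ge0 ltW// => /(_ isT) h3.
  have := ler_wpM2r (ltW (qpos m)) qc; rewrite -mulrA; lra.
have sep2 m n : m != n -> (cc * (q ^+ m + q ^+ n) <= `|q ^+ m - q ^+ n|)%R.
  case: ltngtP => // mn _; have := sep _ _ mn => h1.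
    by rewrite distrC (le_trans h1)// ler_norm.
  by rewrite [X in (cc * X)%R]addrC (le_trans h1)// ler_norm.
pose kap := (cc - `|gamma|)%R.
have kap0 : (0 < kap)%R by rewrite subr_gt0.
have [g_lo g_hi] : (- `|gamma| <= gamma /\ gamma <= `|gamma|)%R.
  by split; [have := ler_norm (- gamma); rewrite normrN; lra|exact: ler_norm].
exists (q ^+ 2 * (q + 1) / kap)%R.
apply: (@h_le_family _ _ (kap + 1)%R
  [set p | exists k, p = (q ^+ k.*2.+1, - cc * q ^+ k.*2.+1)%R]
  [set p | exists k, p = (q ^+ k.*2, cc * q ^+ k.*2)%R]).
- move=> _ [k ->] /=; split; first exact: ltW.
  by rewrite mulNr lerN2 ler_piMl// ltW.
- move=> _ [k ->] /=; split; first exact: ltW.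
  by rewrite ler_piMl// ltW.
- move=> _ _ [k ->] [l ->] /=; rewrite mulNr opprK -mulrDr addrC sep2//.
  by apply/eqP => /(congr1 odd); rewrite /= !odd_double.
move=> t tk.
have [k tk1 kmin] : exists2 k, (t <= kap * q ^+ k.*2)%R &
    forall k', (t <= kap * q ^+ k'.*2)%R -> (k <= k')%N.
  have ex : exists k, (t <= kap * q ^+ k.*2)%R.
    exists (Num.bound (t / kap)); rewrite -ler_pdivrMl// mulrC.
    apply: le_trans (ltW (archi_boundP _)) _; first by rewrite divr_ge0//; lra.
    set n := Num.bound _; apply: (@le_trans _ _ (2 ^+ n.*2)%R).
      rewrite -natrX ler_nat; apply: leq_trans (ltnW (ltn_expl _ (ltnSn 1))) _.
      by rewrite leq_exp2l// -addnn leq_addr.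
    by rewrite lerXn2r// nnegrE; lra.
  by exists (ex_minn ex); case: ex_minnP.
case: k => [|k] in tk1 kmin *; first by move: tk1; rewrite expr0; lra.
have tk2 : (kap * q ^+ k.*2 < t)%R.
  by rewrite ltNge; apply/negP => /kmin; rewrite ltnn.
exists (q ^+ k.+1.*2.+1, - cc * q ^+ k.+1.*2.+1)%R, (q ^+ k.+1.*2, cc * q ^+ k.+1.*2)%R.
split=> /=; [by exists k.+1|by exists k.+1| | |].
- rewrite mulNr opprK -mulrDl (le_trans tk1)//.
  apply: (@le_trans _ _ (kap * q ^+ k.+1.*2.+1)%R).
    by rewrite ler_pM2l// ler_weXn2l//; lra.
  by rewrite ler_wpM2r ?(ltW (qpos _))// /kap; lra.
- rewrite -mulrDl (le_trans tk1)// ler_wpM2r ?(ltW (qpos _))// /kap; lra.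
- rewrite (_ : _ + _ = (q ^+ 2 * (q + 1)) * q ^+ k.*2)%R; last by rewrite doubleS !exprS; ring.
  rewrite -[leRHS]mulrA ler_wpM2l//; first by rewrite mulr_ge0 ?exprn_ge0//; lra.
  by rewrite ler_pdivlMl// ltW.
Qed.

End Profile.

(** * The colouring defined by a lattice path *)

Lemma ncard_sum (q : pred nat) (x : nat) :
  ncard [set y | (y < x)%N /\ q y] = (\sum_(y < x) q y)%N.
Proof.
rewrite (_ : [set _ | _] = [set` [fset y in iota 0 x | q y]%fset]).
  rewrite ncard_fset -(big_mkord xpredT (fun y => q y : nat)) -big_mkcond -big_filter.
  rewrite sum1_size; apply: perm_size; apply: uniq_perm; rewrite ?fset_uniq ?filter_uniq ?iota_uniq//.
  by move=> y; rewrite mem_filter !inE /= mem_index_iota mem_iota andbC.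
by apply/seteqP; split=> y /=; rewrite !inE mem_iota /= => /andP.
Qed.

(** The path is given by the sequence st of the types of its steps. *)
Section Path.
Context {R : realType}.
Variables (lam : R) (st : nat -> bool).
Hypothesis lam_gt0 : 0 < lam.

Definition cnt (b : bool) (x : nat) : nat := \sum_(y < x) (st y == b).

Lemma cnt0 b : cnt b 0 = 0%N. Proof. by rewrite /cnt big_ord0. Qed.

Lemma cntS b x : cnt b x.+1 = (cnt b x + (st x == b))%N.
Proof. by rewrite /cnt big_ord_recr. Qed.

Lemma cntC b x : (cnt b x + cnt (~~ b) x)%N = x.
Proof.
elim: x => [|x IH]; first by rewrite !cnt0.
by rewrite !cntS addnACA IH; case: (st x); case: (b); rewrite addn1.
Qed.

Lemma cnt_le b x y : (x <= y)%N -> (cnt b x <= cnt b y)%N.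
Proof.
move=> /subnK <-; elim: (y - x)%N => // k; rewrite addSn cntS => /leq_trans; apply.
exact: leq_addr.
Qed.

Definition excess (b : bool) (x : nat) : R := lam * (cnt b x)%:R - (cnt (~~ b) x)%:R.

Lemma excess0 b : excess b 0 = 0.
Proof. by rewrite /excess !cnt0 mulr0 subr0. Qed.

Lemma excessE b x : (1 + lam) * (cnt b x)%:R = excess b x + x%:R.
Proof. by rewrite -[in x%:R](cntC b x) natrD /excess; ring. Qed.

Lemma excess_le b x y : (x <= y)%N -> st x = b ->
  (cnt b y <= (cnt b x).+1)%N -> excess b y <= excess b x + lam.
Proof.
move=> xy sx; rewrite -(ler_nat R) -addn1 natrD => c1.
have := cnt_le (~~ b) xy; rewrite -(ler_nat R) => c2.
have := ler_wpM2l (ltW lam_gt0) c1; rewrite /excess; lra.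
Qed.

Lemma excessS b x : excess b x.+1 <= excess b x + lam.
Proof.
rewrite /excess !cntS !natrD mulrDr.
have : 0 <= (st x == ~~ b)%:R :> R by [].
have : lam * (st x == b)%:R <= lam by case: (_ == _); rewrite ?mulr1// mulr0 ltW.
lra.
Qed.

Hypothesis unbounded : forall b (M : R), exists x, M <= excess b x.

Lemma step_ex b i : exists x, (i < cnt b x.+1)%N.
Proof.
have [x] := unbounded b (lam * i.+1%:R); exists x.
rewrite cntS; apply: leq_trans (leq_addr _ _); rewrite -(ler_nat R).
rewrite -(ler_pM2l lam_gt0); apply: le_trans p _.
by rewrite /excess gerBl.
Qed.

(** The position of step number i of type b, counted from 0. *)
Definition step_pos b i : nat := ex_minn (step_ex b i).

Lemma step_posP b i : cnt b (step_pos b i) = i /\ st (step_pos b i) = b.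
Proof.
rewrite /step_pos; case: ex_minnP => x ix xmin.
have le : (cnt b x <= i)%N.
  case: x ix xmin => [|x] ix xmin; first by rewrite cnt0.
  by rewrite leqNgt; apply/negP => /xmin; rewrite ltnn.
move: ix; rewrite cntS; case: eqP => [->|_]; last by rewrite addn0 ltnNge le.
by rewrite addn1 ltnS => ge; split=> //; apply/eqP; rewrite eqn_leq le.
Qed.

Lemma le_step_pos b i x : (x <= step_pos b i)%N = (cnt b x <= i)%N.
Proof.
have [ci si] := step_posP b i; apply/idP/idP => [/(cnt_le b)|]; first by rewrite ci.
rewrite leqNgt [in X in _ -> X]leqNgt; apply: contra => /(cnt_le b).
by rewrite cntS ci si eqxx addn1.
Qed.

Lemma peak_ex b i : exists x, (x <= step_pos b i)%N /\
  forall y, (y <= step_pos b i)%N -> excess b y <= excess b x.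
Proof.
elim: (step_pos b i) => [|k [x [xk IH]]].
  by exists 0%N; split=> // y; rewrite leqn0 => /eqP ->.
have [le|/ltW ge] := leP (excess b k.+1) (excess b x).
  exists x; split; first exact: leqW.
  by move=> y; rewrite leq_eqVlt ltnS => /orP[/eqP ->|/IH].
exists k.+1; split=> // y; rewrite leq_eqVlt ltnS => /orP[/eqP ->//|/IH le].
exact: le_trans le ge.
Qed.

(** [height b i] is the greatest excess of type b at the points of the path
    reached with at most i steps of type b; the steps of type b that are made
    before [peak b i] are thus among those of number 0, ..., i - 1. *)
Definition peak b i : nat := sval (cid (peak_ex b i)).
Definition height b i : R := excess b (peak b i).

Lemma peak_le b i : (peak b i <= step_pos b i)%N.
Proof. by have [] := svalP (cid (peak_ex b i)). Qed.

Lemma height_ge b i y : (y <= step_pos b i)%N -> excess b y <= height b i.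
Proof. by have [_] := svalP (cid (peak_ex b i)); apply. Qed.

Lemma height_ge0 b i : 0 <= height b i.
Proof. by rewrite -(excess0 b); apply: height_ge. Qed.

Lemma height_le b i : height b i <= height b i.+1.
Proof.
apply: height_ge; rewrite le_step_pos; apply: leqW.
by rewrite -le_step_pos peak_le.
Qed.

Lemma heightS b i : height b i.+1 <= height b i + lam.
Proof.
have [le|gt] := leqP (peak b i.+1) (step_pos b i).
  by apply: le_trans (height_ge le) _; rewrite lerDl ltW.
have [ci si] := step_posP b i.
apply: le_trans (_ : excess b (step_pos b i) + lam <= _); last first.
  by rewrite lerD2r height_ge.
apply: excess_le (ltnW gt) si _; rewrite ci.
by rewrite -le_step_pos peak_le.
Qed.

(** The first position where the excess reaches tau comes after step number i
    of type b, not later than x, and its excess is at most tau + lam. *)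
Lemma height_lt_cnt b i (tau : R) x : height b i < tau -> tau <= excess b x ->
  (1 + lam) * i%:R <= tau + lam + x%:R.
Proof.
move=> htau taux.
have ex : exists y, tau <= excess b y by exists x.
case: (ex_minnP ex) => y tauy ymin; have yx := ymin x taux.
case: y tauy yx ymin => [|y] tauy yx ymin.
  by move: tauy; rewrite excess0 leNgt (le_lt_trans (height_ge0 b i) htau).
have iy : (i <= cnt b y.+1)%N.
  rewrite ltnW// ltnNge -le_step_pos; apply/negP => /height_ge.
  by rewrite leNgt (lt_le_trans htau tauy).
have lt : excess b y < tau.
  by rewrite ltNge; apply/negP => /ymin; rewrite ltnn.
have h1 : (1 + lam) * i%:R <= (1 + lam) * (cnt b y.+1)%:R.
  by rewrite ler_pM2l ?ler_nat// addr_gt0.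
apply: le_trans h1 _; rewrite excessE.
have := excessS b y; move: yx; rewrite -(ler_nat R); lra.
Qed.

(** The numbering of the vertices: the next vertex is a step of the type whose
    height is the smaller one.  This is what keeps the heights balanced. *)
Fixpoint merge_state (n : nat) : nat * nat :=
  if n is m.+1 then
    let: (i, j) := merge_state m in
    if height true i <= height false j then (i.+1, j) else (i, j.+1)
  else (0%N, 0%N).

Definition placed (b : bool) (n : nat) : nat :=
  if b then (merge_state n).1 else (merge_state n).2.

(** The type of the vertex n.+1; vertices of KN are numbered from 1, so they are
    shifted by one here and in [place]. *)
Definition kind (n : nat) : bool :=
  height true (placed true n) <= height false (placed false n).

Lemma placed0 b : placed b 0 = 0%N. Proof. by case: b. Qed.

Lemma placedS b n : placed b n.+1 = (placed b n + (kind n == b))%N.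
Proof.
rewrite /kind /placed /=; case: (merge_state n) => i j /=.
by case: b; case: (_ <= _); rewrite ?addn0 ?addn1.
Qed.

Lemma placed_le b m n : (m <= n)%N -> (placed b m <= placed b n)%N.
Proof.
move=> /subnK <-; elim: (n - m)%N => // k; rewrite addSn placedS => /leq_trans; apply.
exact: leq_addr.
Qed.

Lemma placed_sum n : (placed true n + placed false n)%N = n.
Proof.
elim: n => [|n IH]; first by rewrite !placed0.
by rewrite !placedS addnACA IH; case: (kind n); rewrite addn1.
Qed.

(** Only the smaller height grows, and by at most lam. *)
Lemma height_balanced n :
  `|height true (placed true n) - height false (placed false n)| <= lam.
Proof.
elim: n => [|n IH].
  have h0 b : height b 0 <= 0.
    have := step_posP b 0; have := peak_le b 0; rewrite le_step_pos => c0 _.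
    rewrite /height /excess; move: c0; rewrite leqn0 => /eqP ->.
    by rewrite mulr0 sub0r oppr_le0.
  rewrite !placed0 ler_norml; move: (h0 true) (h0 false) (height_ge0 true 0) (height_ge0 false 0).
  by move: lam_gt0; lra.
rewrite !placedS; move: IH; rewrite !ler_norml.
case: (boolP (kind n)) => /=; rewrite /kind.
  rewrite addn1 addn0; move: (heightS true (placed true n)) (height_le true (placed true n)).
  by lra.
rewrite -ltNge addn1 addn0.
by move: (heightS false (placed false n)) (height_le false (placed false n)); lra.
Qed.

Lemma height_le_placed b b' n :
  height b (placed b n) <= height b' (placed b' n) + lam.
Proof.
have := height_balanced n; rewrite ler_norml.
by case: b; case: b'; move: lam_gt0; lra.
Qed.

Definition place (n : nat) : nat := step_pos (kind n) (placed (kind n) n).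

Lemma st_place n : st (place n) = kind n.
Proof. by have [] := step_posP (kind n) (placed (kind n) n). Qed.

Lemma place_inj : injective place.
Proof.
suff wlog m n : (m < n)%N -> place m <> place n.
  by move=> m n e; case: (ltngtP m n) => // /wlog; rewrite e.
move=> mn e; have ek : kind m = kind n by rewrite -!st_place e.
have := congr1 (cnt (kind m)) e.
rewrite {2}ek !(step_posP _ _).1 -ek => ep.
by have := placed_le (kind m) mn; rewrite placedS eqxx addn1 ep ltnn.
Qed.

Lemma placed_below b k n : (\sum_(m < n) ((kind m == b) && (placed b m < k))%N)%N
  = minn k (placed b n).
Proof.
elim: n => [|n IH]; first by rewrite big_ord0 placed0 minn0.
rewrite big_ord_recr /= IH placedS; case: eqP => /= _; last by rewrite !addn0.
by case: ltnP; lia.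
Qed.

Lemma place_lt n x : (place n < x)%N = (placed (kind n) n < cnt (kind n) x)%N.
Proof. by rewrite ltnNge le_step_pos -ltnNge. Qed.

Definition path_coloring (m n : nat) : bool :=
  (place m.-1 < place n.-1)%N && kind m.-1 || (place n.-1 < place m.-1)%N && kind n.-1.

Lemma path_coloring_sym : coloring path_coloring.
Proof. by move=> m n; rewrite /path_coloring orbC. Qed.

Lemma path_coloringP b u v : (0 < u)%N -> (0 < v)%N -> u <> v ->
  path_coloring u v = b -> kind u.-1 = ~~ b ->
  kind v.-1 = b /\ (place v.-1 < place u.-1)%N.
Proof.
move=> u0 v0 uv; rewrite /path_coloring => + ku.
have : place u.-1 <> place v.-1 by move=> /place_inj; lia.
by case: ltngtP => //= _ _; rewrite ?orbF ?ku//; case: (b).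
Qed.

End Path.

(** * Copies are sparse in path colourings *)

Section UpperBound.
Context {R : realType}.

Lemma isomorphic_expansion (T T' : Type) (H : graph T) (H' : graph T') (I : set T') :
  locally_finite H -> isomorphic H H' -> independent H' I -> finite_set I ->
  exists J, [/\ independent H J, finite_set J, ncard J = ncard I
    & ncard (nbrs H J) = ncard (nbrs H' I)].
Proof.
move=> lfH [phi [[phiV phi_inj phi_surj] phi_adj]] [IV indI] fI.
pose J := vert H `&` phi @^-1` I.
have JV : J `<=` vert H by move=> v [].
have imJ : phi @` J = I.
  apply/seteqP; split=> [_ [v [_ Iv] <-]//|x Ix].
  by have [v Hv vx] := phi_surj x (IV x Ix); exists v => //; split=> //; rewrite /preimage /= vx.
have inj u v : vert H u -> vert H v -> phi u = phi v -> u = v.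
  by move=> Hu Hv; apply: phi_inj; rewrite inE.
have injJ u v : J u -> J v -> phi u = phi v -> u = v.
  by move=> [Hu _] [Hv _]; apply: inj.
have fJ : finite_set J.
  have : (phi @` J #= J)%card by apply: inj_card_eq => u v; rewrite !inE; apply: injJ.
  by move=> /eq_finite_set <-; rewrite imJ.
have indJ : independent H J.
  split=> // u v [Hu Iu] [Hv Iv] uv; apply: (indI (phi u) (phi v)) => //.
  exact: (phi_adj u v Hu Hv).1.
exists J; split=> //; first by rewrite -imJ ncard_image.
have NV v : nbrs H J v -> vert H v by move=> [[u _ uv] _]; have [] := adj_vert uv.
have imN : phi @` nbrs H J = nbrs H' I.
  apply/seteqP; split=> [_ [v Nv <-]|x [[y Iy yx] nIx]].
    have Hv := NV v Nv; case: Nv => -[u [Hu Iu] uv] nJv.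
    split; last by move=> Iv; apply: nJv.
    by exists (phi u) => //; exact: (phi_adj u v Hu Hv).1.
  have [Hy Hx] := adj_vert yx.
  have [u Hu eu] := phi_surj y Hy; have [v Hv ev] := phi_surj x Hx.
  exists v => //; split; last by move=> [_]; rewrite /preimage /= ev.
  exists u; first by split=> //; rewrite /preimage /= eu.
  by apply: (phi_adj u v Hu Hv).2; rewrite eu ev.
rewrite -imN ncard_image//; last by move=> u v /NV Hu /NV Hv; apply: inj.
apply: finite_nbrs fJ; exact: lfH.
Qed.

Section Copy.
Variables (lam : R) (st : nat -> bool).
Hypothesis lam_gt0 : 0 < lam.
Hypothesis unb : forall b (M : R), exists x, M <= excess lam st b x.

Local Notation hgt := (height lam_gt0 unb).
Local Notation pld := (placed lam_gt0 unb).
Local Notation knd := (kind lam_gt0 unb).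
Local Notation plc := (place lam_gt0 unb).

(** Let x be the point of greatest excess of type ~~ b among the points reached
    with no more steps of this type than [n] contains.  The vertices of this
    type before x all lie in [n]; those in the copy are independent, with all
    neighbours of type b before x.  Expansion bounds their number by the number
    of steps of type b before x over kappa, and what is missing is the excess
    over lam. *)
Lemma copy_sparse (H' : graph nat) (kappa : R) (n0 : nat) (b : bool) (n : nat) :
    subgraph H' KN -> (forall u v, adj H' u v -> path_coloring lam_gt0 unb u v = b) ->
    0 < kappa <= lam ->
    (forall I, independent H' I -> finite_set I -> (n0 <= ncard I)%N ->
       kappa * (ncard I)%:R <= (ncard (nbrs H' I))%:R) ->
  (count_upto n (vert H'))%:R <=
    n%:R * (lam / kappa) + n0%:R - hgt (~~ b) (pld (~~ b) n) / lam.
Proof.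
move=> [HV Hadj] mono /andP[kap0 kaplam] expand.
set d := ~~ b; set j := pld d n; set x := peak lam_gt0 unb d j.
have xj : (cnt st d x <= j)%N by rewrite -(le_step_pos lam_gt0 unb); exact: peak_le.
pose M := [set v | (0 < v)%N /\ (knd v.-1 == d) && (plc v.-1 < x)%N].
have Mn v : M v -> (1 <= v <= n)%N.
  move=> [v0 /andP[/eqP kv]]; rewrite v0 /= place_lt kv => lt.
  have ltj : (pld d v.-1 < j)%N.
    by apply: leq_trans lt _.
  rewrite leqNgt; apply/negP => nv; move: ltj; rewrite ltnNge placed_le//.
  by rewrite -ltnS prednK.
have fM : finite_set M by apply: sub_finite_set (finite_upto n M) => v Mv; split=> //; exact: Mn.
have cM : ncard M = cnt st d x.
  rewrite (_ : M = succn @` [set m | (m < n)%N /\ (knd m == d) && (pld d m < cnt st d x)%N]).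
    rewrite ncard_image; first last.
    - by move=> u v _ _ [].
    - by apply: sub_finite_set (finite_II n) => m [].
    rewrite (@ncard_sum (fun m => (knd m == d) && (pld d m < cnt st d x)%N)) placed_below.
    by apply/minn_idPl.
  apply/seteqP; split=> [[|v] Mv|_ [m [mn /andP[/eqP km lt]] <-]].
  - by case: Mv.
  - have /andP[_ vn] := Mn _ Mv; have [_ /andP[/eqP kv lt]] := Mv.
    by exists v => //; split=> //; rewrite kv eqxx /=; move: lt; rewrite place_lt /= kv.
  - by split=> //=; rewrite place_lt km eqxx.
have cMn : (cnt st d x <= n)%N.
  by rewrite -cM -[leqRHS]ncard_upto; apply: ncard_le; [apply: sub_finite_set (finite_upto n setT)|exact: Mn].
pose I := vert H' `&` M.
have fI : finite_set I by apply: sub_finite_set fM => v [].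
have nbrI u v : I u -> adj H' u v -> knd v.-1 = b /\ (plc v.-1 < x)%N.
  move=> [_ [u0 /andP[/eqP ku lt]]] uv; have [_ v0 ne] := Hadj u v uv.
  have [kv lt'] := path_coloringP u0 v0 ne (mono u v uv) ku.
  by split=> //; apply: ltn_trans lt.
have indI : independent H' I.
  split=> [v []//|u v Iu [_ [_ /andP[/eqP kv _]]] uv].
  by have [kv' _] := nbrI u v Iu uv; move: kv; rewrite kv' /d; case: (b).
have cN : (ncard (nbrs H' I) <= cnt st b x)%N.
  have plcinj u v : nbrs H' I u -> nbrs H' I v -> plc u.-1 = plc v.-1 -> u = v.
    move=> [[u' _ /Hadj[_ u0 _]] _] [[v' _ /Hadj[_ v0 _]] _] /place_inj e.
    by rewrite -(prednK u0) e prednK.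
  have fS : finite_set [set y | (y < x)%N /\ st y == b].
    by apply: sub_finite_set (finite_II x) => y [].
  have sub : (fun v => plc v.-1) @` nbrs H' I `<=` [set y | (y < x)%N /\ st y == b].
    by move=> _ [v [[u Iu uv] _] <-]; have [kv lt] := nbrI u v Iu uv; rewrite /= st_place kv.
  have fN : finite_set (nbrs H' I).
    have : ((fun v => plc v.-1) @` nbrs H' I #= nbrs H' I)%card.
      by apply: inj_card_eq => u v; rewrite !inE; apply: plcinj.
    by move=> /eq_finite_set <-; apply: sub_finite_set sub fS.
  rewrite -(ncard_image fN plcinj); apply: leq_trans (ncard_le fS sub) _.
  by rewrite (@ncard_sum (fun y => st y == b)).
have cI : (ncard I)%:R <= n0%:R + (cnt st b x)%:R / kappa.
  have [le|/ltnW gt] := leqP n0 (ncard I); last first.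
    apply: (@le_trans _ _ n0%:R); first by rewrite ler_nat.
    by rewrite lerDl divr_ge0// ltW.
  apply: (@le_trans _ _ ((cnt st b x)%:R / kappa)); last by rewrite lerDr.
  rewrite ler_pdivlMr// mulrC; apply: le_trans (expand I indI fI le) _.
  by rewrite ler_nat.
have cV : (count_upto n (vert H') + cnt st d x <= n + ncard I)%N.
  pose C := [set k | (1 <= k <= n)%N] `\` M.
  have fC : finite_set C by apply: sub_finite_set (finite_upto n setT) => v [].
  have : (count_upto n (vert H') <= ncard C + ncard I)%N.
    rewrite -ncardU//; last by move=> v [_ nM] [].
    apply: ncard_le; first by rewrite finite_setU.
    by move=> v [Hv vn]; have [Mv|nMv] := pselect (M v); [right|left].
  have : (ncard C + ncard M = n)%N.
    rewrite -ncardU//; last by move=> v [].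
    rewrite -[RHS]ncard_upto; congr ncard; apply/seteqP.
    split=> [v [[]//|/Mn//]|v vn].
    by have [Mv|nMv] := pselect (M v); [right|left].
  by rewrite cM; lia.
have eW : hgt d j = lam * (cnt st d x)%:R - (cnt st b x)%:R.
  by rewrite /height -/x /excess negbK.
have hW : 0 <= hgt d j := height_ge0 _ _ _ _.
move: cV; rewrite -(ler_nat R) !natrD => cV.
have cMn' : (cnt st d x)%:R <= n%:R :> R by rewrite ler_nat.
set B := (cnt st b x)%:R in eW cI; set C := (cnt st d x)%:R in eW cV cMn'.
have hB : B / kappa <= hgt d j * 0 + C * (lam / kappa) - hgt d j / lam.
  have -> : C * (lam / kappa) = (hgt d j + B) / kappa by rewrite eW; field; rewrite gt_eqF.
  rewrite mulr0 add0r mulrDl.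
  have : hgt d j / lam <= hgt d j / kappa by rewrite ler_wpM2l// lef_pV2.
  by lra.
have hlk : 1 <= lam / kappa by rewrite ler_pdivlMr// mul1r.
have := ler_wpM2r (_ : 0 <= lam / kappa - 1) cMn'.
by rewrite subr_ge0 => /(_ hlk); lra.
Qed.

End Copy.

Definition expanding (T : Type) (H : graph T) (kappa : R) := exists n0, forall I,
  independent H I -> finite_set I -> (n0 <= ncard I)%N ->
  kappa * (ncard I)%:R <= (ncard (nbrs H I))%:R.

(** The heights at n are about equal to some tau, so n is at most the number of
    steps of type true before the excess of this type exceeds tau plus the same
    for type false.  The hypothesis bounds this linearly in tau. *)
Lemma ramsey_density_le_path (T : Type) (H : graph T) (lam L tau0 C0 : R)
    (st : nat -> bool) : locally_finite H -> 0 < lam -> 0 <= L ->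
    (forall kappa, 0 < kappa < lam -> expanding H kappa) ->
    (forall tau, tau0 <= tau -> exists x y, [/\ tau <= excess lam st true x,
       tau <= excess lam st false y & x%:R + y%:R <= L * tau + C0]) ->
  (ramsey_upper_density H <= (1 - (1 + lam) / (lam * (2 + L)))%:E)%E.
Proof.
move=> lfH lam0 L0 expH cov.
have unb b (M : R) : exists x, M <= excess lam st b x.
  have [|x [y [hx hy _]]] := cov (Num.max tau0 M); first by rewrite le_max lexx.
  by exists (if b then x else y); case: b; [apply: le_trans hx|apply: le_trans hy];
    rewrite le_max lexx orbT.
apply: ge_ereal_sup => _ [l hl <-]; rewrite lee_fin; apply/ler_addgt0Pr => e e0.
have [H' [sub iso [b mono] ge]] := hl _ (path_coloring_sym lam0 unb).
rewrite -lee_fin; apply: le_trans ge _.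
(* One half of e is spent on kappa < lam, the other on additive constants. *)
pose kappa := lam / (1 + e / 2).
have e1 : 1 < 1 + e / 2 by rewrite ltrDl divr_gt0.
have e10 : 0 < 1 + e / 2 by apply: lt_trans e1.
have kap : 0 < kappa < lam by rewrite /kappa divr_gt0//= ltr_pdivrMr// ltr_pMr.
have [n0 exp0] := expH kappa kap.
have expH' I : independent H' I -> finite_set I -> (n0 <= ncard I)%N ->
    kappa * (ncard I)%:R <= (ncard (nbrs H' I))%:R.
  move=> indI fI; have [J [indJ fJ <- <-]] := isomorphic_expansion lfH iso indI fI.
  exact: exp0.
have kap' : 0 < kappa <= lam by case/andP: kap => -> /ltW.
have [a [a0 tau0a]] : exists a : R, 0 <= a /\ tau0 <= a.
  by exists `|tau0|; split; [exact: normr_ge0|exact: ler_norm].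
pose C1 := (2 * lam + C0) / (2 + L) + lam + 1 + a.
pose N := Num.bound (2 * (n0%:R + `|C1| / lam) / e).
apply: (@upper_density_le _ _ _ N) => n Nn.
have := copy_sparse n sub mono kap' expH'.
set d := ~~ b; set W := height _ _ _ _ => le.
have W0 : 0 <= W := height_ge0 _ _ _ _.
have L2 : 0 < 2 + L by rewrite ltr_wpDr.
have hW : (1 + lam) * n%:R <= (2 + L) * (W + C1).
  pose tau := W + lam + 1 + a.
  have [|x [y [hx hy hxy]]] := cov tau.
    by rewrite /tau; lra.
  have ht b' : height lam0 unb b' (placed lam0 unb b' n) < tau.
    by apply: le_lt_trans (height_le_placed _ _ _ d _) _; rewrite -/W /tau; lra.
  have h1 := height_lt_cnt (ht true) hx; have h2 := height_lt_cnt (ht false) hy.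
  have <- : (placed lam0 unb true n + placed lam0 unb false n)%N = n by exact: placed_sum.
  rewrite natrD mulrDr; apply: le_trans (lerD h1 h2) _.
  rewrite (_ : (2 + L) * (W + C1) = 2 * tau + L * tau + 2 * lam + C0); first lra.
  by rewrite /C1 /tau; field; rewrite gt_eqF.
have nbig : n0%:R + C1 / lam <= e / 2 * n%:R.
  apply: (@le_trans _ _ (n0%:R + `|C1| / lam)).
    by rewrite lerD2l ler_pM2r ?invr_gt0// ler_norm.
  set X := n0%:R + _ in N Nn *.
  have X0 : 0 <= X by rewrite addr_ge0// divr_ge0// ltW.
  have : 2 * X / e < n%:R.
    apply: lt_trans (_ : N%:R < _); last by rewrite ltr_nat.
    by apply: archi_boundP; rewrite divr_ge0 ?(ltW e0)// mulr_ge0.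
  by rewrite ltr_pdivrMr//; lra.
have eW : (1 + lam) / (lam * (2 + L)) * n%:R <= (W + C1) / lam.
  rewrite (_ : _ * n%:R = ((1 + lam) * n%:R) / (2 + L) / lam); last first.
    by field; rewrite !gt_eqF.
  by rewrite ler_pM2r ?invr_gt0// ler_pdivrMr// [leRHS]mulrC.
move: le; rewrite (_ : lam / kappa = 1 + e / 2); last first.
  by rewrite /kappa invf_div mulrCA divff ?mulr1// gt_eqF.
move: eW; set F := (1 + lam) / _; rewrite [leRHS]mulrDl => eW le.
by apply: le_trans le _; lra.
Qed.

Section PathOfProfile.
Variables (g : R -> R).
Hypothesis glip : 1.-lipschitz_[set x : R | 0 <= x] g.
Hypothesis g0 : g 0 = 0.

Let glip1 x y : 0 <= x -> 0 <= y -> `|g x - g y| <= `|x - y|.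
Proof. by move=> x0 y0; have := @glip (x, y) (conj x0 y0); rewrite /= mul1r. Qed.

Let gbound x : 0 <= x -> `|g x| <= x.
Proof. by move=> x0; have := glip1 x0 (lexx 0); rewrite g0 !subr0 (ger0_norm x0). Qed.

(** Rounding down (x + g x) / 2 gives a lattice path because g is 1-Lipschitz:
    the rounded value grows by 0 or 1 at each step. *)
Definition profile_count (x : nat) : nat := Num.truncn ((x%:R + g x%:R) / 2).
Definition profile_path (x : nat) : bool := profile_count x.+1 != profile_count x.

Let u_ge0 (x : nat) : 0 <= (x%:R + g x%:R) / 2.
Proof.
rewrite divr_ge0//; have := gbound (ler0n R x); rewrite ler_norml; lra.
Qed.

Let profile_count_bounds x :
  (profile_count x)%:R <= (x%:R + g x%:R) / 2 < (profile_count x).+1%:R.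
Proof.
by rewrite Num.Theory.truncn_le u_ge0 /= -Num.Theory.truncn_le_nat.
Qed.

Lemma cnt_profile_path x : cnt profile_path true x = profile_count x.
Proof.
elim: x => [|x IH].
  rewrite cnt0; apply/esym/eqP; rewrite -leqn0 Num.Theory.truncn_le_nat g0; lra.
rewrite cntS IH /profile_path eqb_id.
have := @glip1 x.+1%:R x%:R (ler0n _ _) (ler0n _ _).
rewrite -!(@natr1 R x) (_ : x%:R + 1 - x%:R = 1) ?normr1 ?ler_norml; last by ring.
move=> /andP[h1 h2].
have le1 : (profile_count x <= profile_count x.+1)%N.
  by apply: Num.Theory.le_truncn; rewrite -(@natr1 R x); lra.
have le2 : (profile_count x.+1 <= (profile_count x).+1)%N.
  rewrite Num.Theory.truncn_le_nat -(@natr1 R x) -!(@natr1 R (profile_count x).+1) -!(@natr1 R (profile_count x)).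
  by have /andP[_] := profile_count_bounds x; rewrite -(@natr1 R (profile_count x)); lra.
case: eqP => [->|/eqP ne] /=; first by rewrite addn0.
by apply/eqP; rewrite addn1 eqn_leq le2 ltn_neqAle eq_sym ne le1.
Qed.

Lemma excess_profile (lam : R) (b : bool) (x : nat) : 0 < lam ->
  (1 + lam) / 2 * ((lam - 1) / (lam + 1) * x%:R + (if b then g x%:R else - g x%:R))
    - (1 + lam) <= excess lam profile_path b x.
Proof.
move=> lam0; have := profile_count_bounds x; rewrite -cnt_profile_path -(@natr1 R (cnt _ _ _)).
have e := excessE lam profile_path b x; have lam10 : 1 + lam != 0 by rewrite gt_eqF// addr_gt0.
have -> : excess lam profile_path b x = (1 + lam) * (cnt profile_path b x)%:R - x%:R by lra.
move=> /andP[h1 h2].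
have cb : (x%:R + (if b then g x%:R else - g x%:R)) / 2 - 1 <= (cnt profile_path b x)%:R.
  case: b {e} => /=; first lra.
  have : (cnt profile_path true x + cnt profile_path false x)%N = x := cntC _ true x.
  by move=> /(congr1 (fun n => n%:R : R)); rewrite natrD; lra.
have : 0 <= 1 + lam by rewrite addr_ge0// ltW.
move=> /(ler_wpM2l)/(_ _ _ cb) h3; apply: le_trans (lerB h3 (lexx x%:R)).
rewrite le_eqVlt; apply/orP; left; apply/eqP.
by field; rewrite addrC.
Qed.

(** Rounding costs a constant only, so that the reals x and y that witness
    Gamma_plus and Gamma_minus can be rounded to steps of the path. *)
Lemma excess_profile_floor (lam : R) (b : bool) (y : R) : 0 < lam -> 0 <= y ->
  (1 + lam) / 2 * ((lam - 1) / (lam + 1) * y + (if b then g y else - g y))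
    - 2 * (1 + lam) <= excess lam profile_path b (Num.truncn y).
Proof.
move=> lam0 y0; apply: le_trans (excess_profile b _ lam0).
set x := (Num.truncn y)%:R; have x0 : 0 <= x := ler0n _ _.
have xy : x <= y by rewrite Num.Theory.truncn_le.
have yx : y < x + 1 by rewrite natr1 -Num.Theory.truncn_le_nat.
have := glip1 y0 x0; rewrite [leRHS]ger0_norm ?subr_ge0// ler_norml => /andP[h1 h2].
have gam : `|(lam - 1) / (lam + 1)| <= 1.
  rewrite normrM normfV [X in _ / X]gtr0_norm ?addr_gt0// ler_pdivrMr ?addr_gt0// mul1r.
  by rewrite ler_norml; lra.
have h3 : (lam - 1) / (lam + 1) * (y - x) <= 1.
  apply: le_trans (ler_norm _) _; rewrite normrM (ger0_norm (_ : 0 <= y - x)) ?subr_ge0//.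
  by rewrite mulr_ile1 ?subr_ge0//; lra.
have h4 : (if b then g y else - g y) - (if b then g x else - g x) <= 1.
  by case: b; lra.
have : 0 <= (1 + lam) / 2 by lra.
move=> /(ler_wpM2l)/(_ _ _ (lerD h3 h4)); rewrite mulrBr; lra.
Qed.

End PathOfProfile.

Lemma ramsey_density_le (T : Type) (H : graph T) (lam L : R) (g : R -> R) (t0 : R) :
    locally_finite H -> 0 < lam -> 0 <= L ->
    (forall kappa, 0 < kappa < lam -> expanding H kappa) ->
    1.-lipschitz_[set x : R | 0 <= x] g -> g 0 = 0 ->
    (forall t, t0 <= t -> (Gamma_plus ((lam - 1) / (lam + 1)) g t
       + Gamma_minus ((lam - 1) / (lam + 1)) g t <= (L * t)%:E)%E) ->
  (ramsey_upper_density H <=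
    (1 - 1 / (2 * lam / (1 + lam) ^+ 2 * L + 2 * lam / (1 + lam)))%:E)%E.
Proof.
move=> lfH lam0 L0 expH glip g0 cov.
have lam1 : 0 < 1 + lam by rewrite addr_gt0.
rewrite (_ : 1 / _ = (1 + lam) / (lam * (2 + 2 * L / (1 + lam)))); last first.
  by field; rewrite ?gt_eqF//; repeat (apply/andP; split); rewrite ?gt_eqF//; nra.
apply: (@ramsey_density_le_path _ _ _ _ ((1 + lam) * `|t0|) (4 * L + 2) (profile_path g)) => //.
  by rewrite divr_ge0 ?mulr_ge0// ltW.
(* The summand 4 of t makes up for the rounding in [excess_profile_floor]. *)
move=> tau tau_ge; pose t := 2 * tau / (1 + lam) + 4.
have t0t : t0 <= t.
  have : `|t0| <= tau / (1 + lam) by rewrite ler_pdivlMr// mulrC.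
  have := ler_norm t0; have := normr_ge0 t0; rewrite /t; lra.
have le := cov t t0t; set gam := (lam - 1) / (lam + 1) in cov le *.
have fin_P : Gamma_plus gam g t \is a fin_num.
  rewrite fin_numE; apply/andP; split.
    by rewrite gt_eqF// (lt_le_trans _ (Gamma_plus_ge0 _ _ _)).
  apply/negP => /eqP eP; move: le; rewrite eP addye ?leye_eq//.
  by rewrite gt_eqF// (lt_le_trans _ (Gamma_minus_ge0 _ _ _)).
have fin_M : Gamma_minus gam g t \is a fin_num.
  rewrite fin_numE; apply/andP; split.
    by rewrite gt_eqF// (lt_le_trans _ (Gamma_minus_ge0 _ _ _)).
  apply/negP => /eqP eP; move: le; rewrite eP addey ?leye_eq//.
  by rewrite gt_eqF// (lt_le_trans _ (Gamma_plus_ge0 _ _ _)).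
have [_ [x [x0 tx] <-] ltx] := lb_ereal_inf_adherent ltr01 fin_P.
have [_ [y [y0 ty] <-] lty] := lb_ereal_inf_adherent ltr01 fin_M.
exists (Num.truncn x), (Num.truncn y).
have lam2 : 0 <= (1 + lam) / 2 by lra.
have et : (1 + lam) / 2 * t - 2 * (1 + lam) = tau by rewrite /t; field; rewrite gt_eqF.
split.
- apply: le_trans (excess_profile_floor glip g0 true lam0 x0).
  by rewrite -{1}et lerD2r ler_wpM2l.
- apply: le_trans (excess_profile_floor glip g0 false lam0 y0).
  by rewrite -{1}et lerD2r ler_wpM2l.
- have h1 : (Num.truncn x)%:R <= x by rewrite Num.Theory.truncn_le.
  have h2 : (Num.truncn y)%:R <= y by rewrite Num.Theory.truncn_le.
  have h3 : x + y < L * t + 2.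
    move: le ltx lty; rewrite -/(Gamma_plus gam g t) -/(Gamma_minus gam g t).
    by rewrite -(fineK fin_P) -(fineK fin_M) -!EFinD !lte_fin lee_fin; lra.
  have -> : 2 * L / (1 + lam) * tau + (4 * L + 2) = L * t + 2 by rewrite /t; field; rewrite gt_eqF.
  lra.
Qed.
End UpperBound.

(** * Independent sets with few neighbours in one part of H *)

Section Richness.
Context {R : realType} {T : Type}.
Variable H : graph T.
Hypothesis lfH : locally_finite H.

Definition bipartition (P Q : set T) :=
  [/\ vert H = P `|` Q, forall v, P v -> ~ Q v, independent H P & independent H Q].

Lemma bipartition_sym P Q : bipartition P Q -> bipartition Q P.
Proof.
by move=> [HPQ d iP iQ]; split=> //; [rewrite HPQ setUC|move=> v Qv /d].
Qed.

Lemma rich0 P : rich H P 0 0.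
Proof.
move=> D fD; exists set0.
have N0 : nbrs H set0 = set0 by rewrite /nbrs bigcup_set0 set0D.
by split=> //; rewrite ?N0 ?ncard0// => v [].
Qed.

Lemma rich_le P s r r' : (r <= r')%N -> rich H P s r -> rich H P s r'.
Proof.
move=> rr' richr D fD; have [I [? ? ? ? le]] := richr D fD.
by exists I; split=> //; apply: leq_trans rr'.
Qed.

Lemma richD P s r s' r' : rich H P s r -> rich H P s' r' -> rich H P (s + s') (r + r').
Proof.
move=> rich1 rich2 D fD; have [I [IP fI cI dI nI]] := rich1 D fD.
have fN := finite_nbrs lfH fI.
have [|J [JP fJ cJ dJ nJ]] := rich2 (D `|` (I `|` nbrs H I)).
  by rewrite !finite_setU.
have sub : nbrs H (I `|` J) `<=` nbrs H I `|` nbrs H J.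
  move=> v [[u [Iu|Ju] uv] nv]; [left|right]; split; try by exists u.
    by move=> Iv; apply: nv; left.
  by move=> Jv; apply: nv; right.
exists (I `|` J); split.
- by move=> v [/IP|/JP].
- by rewrite finite_setU.
- rewrite ncardU ?cI ?cJ// => v Iv Jv.
  by apply: (dJ v); [left|right; left].
- move=> v [[Iv|Jv]|/sub[Nv|Nv]] Dv.
  + by apply: (dI v) => //; left.
  + by apply: (dJ v); [left|left].
  + by apply: (dI v) => //; right.
  + by apply: (dJ v); [right|left].
- apply: leq_trans (ncard_le _ sub) _; first by rewrite finite_setU; split=> //; exact: finite_nbrs.
  by apply: leq_trans (ncardU_le fN (finite_nbrs lfH fJ)) _; rewrite leq_add.
Qed.

Lemma richM P s u : rich H P s 0 -> rich H P (u * s) 0.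
Proof.
move=> rs; elim: u => [|u IH]; first exact: rich0.
by rewrite mulSn -[0%N]addn0; apply: richD.
Qed.

(** If Q is finite, local finiteness makes all but finitely many vertices of P
    isolated. *)
Lemma free_vertex_ex P Q : countably_infinite H -> bipartition P Q ->
  forall D, finite_set D ->
  exists v, [/\ vert H v, ~ D v & Q v \/ (forall u, ~ adj H v u)].
Proof.
move=> cH [HPQ dPQ iP iQ] D fD.
have [[v [Qv nDv]]|QD] := pselect (exists v, Q v /\ ~ D v).
  by exists v; split=> //; [rewrite HPQ; right|left].
have {}QD : Q `<=` D by move=> v Qv; apply: contrapT => nDv; apply: QD; exists v.
pose B := D `|` \bigcup_(q in Q) nbr H q.
have fB : finite_set B.
  rewrite finite_setU; split=> //; apply: bigcup_finite; first exact: sub_finite_set fD.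
  by move=> q _; apply: finite_nbr.
have [v [Hv nBv]] : exists v, vert H v /\ ~ B v.
  apply: contrapT => no; apply: infinite_nat.
  rewrite -(eq_finite_set cH); apply: sub_finite_set fB => v Hv.
  by apply: contrapT => nBv; apply: no; exists v.
exists v; split=> //; first by move=> Dv; apply: nBv; left.
right=> u vu; apply: (nBv); right.
have [_] := adj_vert vu; rewrite HPQ => -[Pu|Qu]; last by exists u => //; exact: adj_sym.
move: Hv; rewrite HPQ => -[Pv|Qv]; first by case: (iP.2 v u Pv Pu vu).
by case: nBv; left; apply: QD.
Qed.

Lemma infinite_pigeonhole (X : finType) (u : nat -> X) :
  exists x, forall N, exists2 i, (N <= i)%N & u i = x.
Proof.
apply: contrapT => no.
have bound x : exists N, forall i, (N <= i)%N -> u i <> x.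
  apply: contrapT => h; apply: no; exists x => N; apply: contrapT => h'.
  by apply: h; exists N => i Ni e; apply: h'; exists i.
have [B BP] := choice bound.
apply: (BP (u (\max_x B x)%N) (\max_x B x)%N) => //.
exact: leq_bigmax.
Qed.

Lemma finite_uniform_bound (D : set T) (p : T -> nat -> Prop) : finite_set D ->
  (forall d, exists N, forall i, (N <= i)%N -> p d i) ->
  exists N, forall i, (N <= i)%N -> forall d, D d -> p d i.
Proof.
move=> fD /choice[B BP].
have [X DX] := (@finite_fsetP {classic T} D).1 fD.
exists (\max_(d <- X) B d)%N => i Ni d Dd; apply: BP.
by apply: leq_trans Ni; apply: leq_bigmax_seq => //; move: Dd; rewrite DX.
Qed.

(** The traces of an independent set I on the two parts of H have disjoint
    neighbourhoods, both contained in N(I), so one of them has ratio at most lam.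
    Infinitely many members of the family agree on the part and the size, and
    disjointness with local finiteness sends them away from any finite set.
    When the neighbourhoods are empty, unions of several members make room for
    r' = 1, so that tiles have two nonempty sides. *)
Lemma rich_of_disjoint (lam : R) (I : nat -> set T) (s : nat) :
    0 < lam -> bipartite H -> trivIset setT I ->
    (forall i, [/\ finite_set (I i), I i !=set0 & independent H (I i)]) ->
    (forall i, ncard (I i) = s) ->
    (forall i, (ncard (nbrs H (I i)))%:R / (ncard (I i))%:R <= lam) ->
  exists P Q s' r', [/\ bipartition P Q, (0 < s')%N, (0 < r')%N,
    r'%:R <= lam * s'%:R & rich H P s' r'].
Proof.
move=> lam0 [A [B [AB dAB iA iB]]] trivI IP cI ratio.
have dAB' v : A v -> ~ B v.
  by move=> Av Bv; have : (A `&` B) v by []; rewrite dAB.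
have bAB : bipartition A B by split.
pose part (b : bool) := if b then A else B.
have bpart b : bipartition (part b) (part (~~ b)).
  by case: b => //; apply: bipartition_sym.
pose J b i := I i `&` part b.
have fJ b i : finite_set (J b i).
  by have [fI _ _] := IP i; apply: sub_finite_set fI => v [].
have NJ b i v : nbrs H (J b i) v -> nbrs H (I i) v /\ part (~~ b) v.
  move=> [[u [Iu pu] uv] nJ]; split.
    split; first by exists u.
    by move=> Iv; have [_ _ [_ ind]] := IP i; apply: (ind u v).
  have [HPQ _ iP _] := bpart b; have [_] := adj_vert uv; rewrite HPQ => -[pv|//].
  by case: (iP.2 u v).
have cardJ i : (ncard (J true i) + ncard (J false i))%N = s.
  rewrite -ncardU//; last by move=> v [_ Av] [_ /(dAB' v Av)].
  rewrite -(cI i); congr ncard; apply/seteqP; split=> [v [[]//|[]//]|v Iv].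
  have [_ _ [/(_ v Iv)]] := IP i; rewrite -AB => -[Av|Bv] _; first by left.
  by right.
have cardN i : (ncard (nbrs H (J true i)) + ncard (nbrs H (J false i)) <= ncard (nbrs H (I i)))%N.
  have [fI _ _] := IP i.
  rewrite -ncardU; try by apply: finite_nbrs.
    apply: ncard_le; first exact: finite_nbrs.
    by move=> v [/NJ[]|/NJ[]].
  by move=> v /NJ[_ Bv] /NJ[_ Av]; apply: (dAB' v).
have s0 : (0 < s)%N.
  have [fI [v Iv] _] := IP 0%N; rewrite -(cI 0%N) lt0n; apply/eqP => /(ncard_eq0 fI) I0.
  by move: Iv; rewrite I0.
have good i : exists b, (0 < ncard (J b i))%N /\
    (ncard (nbrs H (J b i)))%:R <= lam * (ncard (J b i))%:R.
  apply: contrapT => no.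
  have bad b : lam * (ncard (J b i))%:R <= (ncard (nbrs H (J b i)))%:R /\
      ((0 < ncard (J b i))%N -> lam * (ncard (J b i))%:R < (ncard (nbrs H (J b i)))%:R).
    have [J0|Jpos] := posnP (ncard (J b i)).
      by rewrite J0 mulr0; split.
    have lt : lam * (ncard (J b i))%:R < (ncard (nbrs H (J b i)))%:R.
      by rewrite ltNge; apply/negP => le; apply: no; exists b.
    by split=> //; apply: ltW.
  have := ratio i; rewrite cI ler_pdivrMr ?ltr0n// => le.
  have := cardN i; rewrite -(ler_nat R) natrD => leN.
  have := cardJ i => eJ; have eJR := congr1 (fun n => n%:R : R) eJ; rewrite /= natrD in eJR.
  have [le1 lt1] := bad true; have [le2 lt2] := bad false.
  rewrite -eJR in le.
  have [J0|/lt1 ?] := posnP (ncard (J true i)); last by lra.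
  have /lt2 ? : (0 < ncard (J false i))%N by move: eJ; rewrite J0 add0n => ->.
  by lra.
have [bb bbP] := choice good.
have sz b i : (ncard (J b i) < s.+1)%N.
  by rewrite ltnS -(cardJ i); case: b; rewrite ?leq_addr ?leq_addl.
have [[b t] many] := infinite_pigeonhole (fun i => (bb i, Ordinal (sz (bb i) i))).
have t0 : (0 < t)%N.
  by have [i _ [eb <-]] := many 0%N; have [] := bbP i.
have rich1 : rich H (part b) t (Num.truncn (lam * t%:R)).
  move=> D fD; pose D' := D `|` \bigcup_(d in D) nbr H d.
  have fD' : finite_set D'.
    by rewrite finite_setU; split=> //; apply: bigcup_finite => // d _; exact: finite_nbr.
  have [d|N NP] := @finite_uniform_bound D' (fun d i => ~ I i d) fD'.
    have [[i Id]|no] := pselect (exists i, I i d); last by exists 0%N => i _ Id; apply: no; exists i.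
    exists i.+1 => j ij Jd; have := trivI i j Logic.I Logic.I.
    have ne : I i `&` I j !=set0 by exists d.
    by move=> /(_ ne) e; move: ij; rewrite e ltnn.
  have [i Ni [eb et]] := many N.
  have et' : ncard (J b i) = t by rewrite -et eb.
  exists (J b i); split=> //.
  - by move=> v [].
  - move=> v [[Iv _]|Nv] Dv; first by apply: (NP i Ni v) => //; left.
    case: Nv => -[u [Iu _] uv] _; apply: (NP i Ni u) => //; right.
    by exists v => //; apply: adj_sym.
  - have [_] := bbP i; rewrite eb et' => le.
    by rewrite -(@natrK R (ncard (nbrs H _))); apply: Num.Theory.le_truncn.
have [r0|rpos] := posnP (Num.truncn (lam * t%:R)); last first.
  exists (part b), (part (~~ b)), t, (Num.truncn (lam * t%:R)); split=> //.
  by rewrite Num.Theory.truncn_le mulr_ge0// ltW.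
have lt0 : 0 < lam * t%:R by rewrite mulr_gt0// ltr0n.
(* Here the neighbourhoods are empty, and u members together have size at
   least 1 / lam. *)
pose u := Num.bound (lam * t%:R)^-1.
have u1 : (lam * t%:R)^-1 < u%:R by apply: archi_boundP; rewrite invr_ge0 ltW.
have u0 : (0 < u)%N by rewrite -(ltr0n R); apply: lt_trans u1; rewrite invr_gt0.
exists (part b), (part (~~ b)), (u * t)%N, 1%N; split=> //.
- by rewrite muln_gt0 u0.
- by rewrite natrM mulrCA -ler_pdivrMr// div1r ltW.
- by apply: (@rich_le _ _ 0) => //; apply: richM; rewrite -r0.
Qed.

End Richness.

(** * Cuts in the absence of dense copies *)

Section LowerBound.
Context {R : realType}.

Definition dense_copy (T : Type) (H : graph T) (c : nat -> nat -> bool) (theta : R) :=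
  exists H' : graph nat, [/\ subgraph H' KN, isomorphic H H',
    monochromatic c H' & (theta%:E <= upper_density (vert H'))%E].

Lemma count_types (c : nat -> nat -> bool) (V : bool -> set nat) b n :
  vertex_types c V -> (count_upto n (V b) + count_upto n (V (~~ b)))%N = n.
Proof.
move=> [Vcov Vdis _ _]; rewrite /count_upto -ncardU; try exact: finite_upto.
  rewrite -[RHS]ncard_upto; congr ncard; apply/seteqP.
  split=> [v [[]//|[]//]|v vn].
  have [b' Vb'] : exists b, V b v by apply: Vcov; case/andP: vn.
  have [<-|nb] := eqVneq b' b; first by left.
  by right; have -> : ~~ b = b' by case: (b) b' nb {Vb'} => -[].
by move=> v [/Vdis nV _] [/nV].
Qed.

Section Cuts.
Variables (s r : nat) (c : nat -> nat -> bool) (V : bool -> set nat).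
Hypotheses (csym : coloring c) (tV : vertex_types c V).

Lemma coverable_of_count b (theta1 : R) n :
  theta1 * n%:R <= (count_upto n (V b))%:R -> coverable c V b s r theta1 n.
Proof.
move=> le; exists 0%N, (fun=> (fset0, fset0)); split.
  by split=> [[]|[]].
by rewrite muln0 addn0.
Qed.

(** Colour b can use little of S, a set of vertices of type ~~ b in [n]: nearly
    all edges of colour b from S to type b lead to W, and W is small compared
    with lam |S|. *)
Definition cut_at (lam : R) (b : bool) (k n : nat) (slack : R) (S W : {fset nat}) :=
  [/\ forall x, x \in S -> V (~~ b) x /\ (1 <= x <= n)%N, forall y, y \in W -> V b y,
      forall Z, ~ tile (fun x y => c x y = b) [set` S] (V b `\` [set` W]) (k * s) (k * r) Z
    & #|` W|%:R / lam + slack * n%:R <= #|` S|%:R].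

(** The vertices of type ~~ b in [n] that are not tiled number at least
    (1 - theta1) n, and [tiling_or_cut] turns them into a cut. *)
Lemma cut_of_not_coverable (lam eps theta1 : R) : (0 < s)%N -> (0 < r)%N ->
    0 < lam -> r%:R <= lam * s%:R -> 0 < eps -> theta1 <= 1 ->
  exists k, forall b n, ~ coverable c V b s r theta1 n ->
  exists S W, cut_at lam b k n (1 - theta1 - eps) S W.
Proof.
move=> s0 r0 lam0 rs eps0 theta11.
pose e := (Num.bound (4 / eps)).+1.
have e4 : 4 / e%:R <= eps.
  rewrite ler_pdivrMr ?ltr0n// mulrC -ler_pdivrMr//; apply: ltW.
  apply: lt_trans (archi_boundP _) _; first by rewrite divr_ge0// ltW.
  by rewrite ltr_nat ltnSn.
have [k k0 kP] := @tiling_or_cut s r e s0 r0 isT.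
exists k => b n ncov; have [_ Vdis _ _] := tV.
have [X eX] := (@finite_fsetP nat _).1 (finite_upto n (V (~~ b))).
have XV x : x \in X -> V (~~ b) x /\ (1 <= x <= n)%N.
  by move=> xX; have : [set` X] x by []; rewrite -eX.
have cX : #|` X| = count_upto n (V (~~ b)) by rewrite /count_upto eX ncard_fset.
have XA x : x \in X -> ~ V b x by move=> /XV[Vx _] /Vdis.
have [n' [Y [S [W [tY SX WA notile le]]]]] := kP (fun x y => c x y = b) X (V b) XA.
exists S, W; split=> //; first by move=> x /(fsubsetP SX)/XV.
have lt : (count_upto n (V b) + s * n')%:R < theta1 * n%:R.
  rewrite ltNge; apply/negP => le'; apply: ncov; exists n', Y; split=> //.
  by rewrite eX.
have cV := count_types b n tV; rewrite -cX in cV.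
have cSX : (#|` (X `\` S)%fset| + #|` S|)%N = #|` X|.
  by rewrite cardfsDS// subnK// fsubset_leq_card.
have s0R : 0 < s%:R :> R by rewrite ltr0n.
have r0R : 0 < r%:R :> R by rewrite ltr0n.
have e0R : 0 < e%:R :> R by rewrite ltr0n.
have le1 : #|` (X `\` S)%fset|%:R + #|` W|%:R / lam <= (1 + 4 / e%:R) * (s * n')%:R :> R.
  apply: (@le_trans _ _ (#|` (X `\` S)%fset|%:R + #|` W|%:R * (s%:R / r%:R))).
    rewrite lerD2l ler_wpM2l// -[leLHS]mul1r ler_pdivrMr// mulrAC ler_pdivlMr// mul1r.
    by rewrite mulrC.
  have : (e * (r * #|` (X `\` S)%fset| + s * #|` W|))%:R <= ((e + 4) * (s * r * n'))%:R :> R.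
    by rewrite ler_nat.
  rewrite !natrM !natrD !natrM => h.
  have er0 : 0 < e%:R * r%:R :> R by rewrite mulr_gt0.
  rewrite -(ler_pM2l er0); move: h; set A := #|` (X `\` S)%fset|%:R; set B := #|` W|%:R.
  rewrite (_ : e%:R * r%:R * (A + B * (s%:R / r%:R)) = e%:R * (r%:R * A + s%:R * B)); last first.
    by field; rewrite gt_eqF.
  by move=> /le_trans; apply; rewrite le_eqVlt; apply/orP; left; apply/eqP; field; rewrite gt_eqF.
have cVR := congr1 (fun n => n%:R : R) cV; have cSXR := congr1 (fun n => n%:R : R) cSX.
rewrite /= !natrD in cVR cSXR; rewrite natrD in lt.
have sn : (s * n')%:R <= n%:R :> R.
  have : theta1 * n%:R <= n%:R by rewrite ler_piMl.
  by have := ler0n R (count_upto n (V b)); lra.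
have : 4 / e%:R * (s * n')%:R <= eps * n%:R.
  by apply: ler_pM => //; rewrite divr_ge0// ltW.
lra.
Qed.

(** Otherwise S outside W' and S' outside W are both large, and a big
    monochromatic complete bipartite graph between them is forbidden by one of
    the two cuts, according to its colour. *)
Lemma cuts_cross (k : nat) : exists M, forall (lam slack : R) n m S W S' W',
    cut_at lam true k n slack S W -> cut_at lam false k m slack S' W' ->
  (#|` S| <= #|` W'| + M)%N \/ (#|` S'| <= #|` W| + M)%N.
Proof.
have [M MP] := bipartite_ramsey (maxn (k * s) (k * r)).
exists M => lam slack n m S W S' W' [SV WV noS _] [SV' WV' noS' _].
apply: contrapT => /not_orP[/negP + /negP]; rewrite -!ltnNge => lt lt'.
have le : (M <= #|` (S `\` W')%fset|)%N.
  by rewrite cardfsD leq_subRL; [|rewrite fsubset_leq_card ?fsubsetIl];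
    have := fsubset_leq_card (fsubsetIr S W'); lia.
have le' : (M <= #|` (S' `\` W)%fset|)%N.
  have := fsubset_leq_card (fsubsetIr S' W); rewrite cardfsD; lia.
have [b [X [Y [XS YS cX cY XY]]]] := MP c _ _ le le'.
have sub (Z : {fset nat}) p : (p <= maxn (k * s) (k * r))%N -> #|` Z| = maxn (k * s) (k * r) ->
    exists2 Z' : {fset nat}, (Z' `<=` Z)%fset & #|` Z'| = p.
  by move=> pm cZ; apply: fsubset_card_ex; rewrite cZ.
have XP x : x \in X -> x \in S /\ x \notin W'.
  by move=> /(fsubsetP XS); rewrite inE => /andP[].
have YP y : y \in Y -> y \in S' /\ y \notin W.
  by move=> /(fsubsetP YS); rewrite inE => /andP[].
case: b XY => XY.
  have [X' X'X cX'] := sub X (k * s)%N (leq_maxl _ _) cX.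
  have [Y' Y'Y cY'] := sub Y (k * r)%N (leq_maxr _ _) cY.
  apply: (noS (X', Y')); split=> //= [x /(fsubsetP X'X)/XP[]//|y /(fsubsetP Y'Y)/YP[yS yW]|x y].
    by split; [case: (SV' y yS)|apply/negP].
  by move=> /(fsubsetP X'X) xX /(fsubsetP Y'Y); apply: XY.
have [X' X'X cX'] := sub X (k * r)%N (leq_maxr _ _) cX.
have [Y' Y'Y cY'] := sub Y (k * s)%N (leq_maxl _ _) cY.
apply: (noS' (Y', X')); split=> //= [y /(fsubsetP Y'Y)/YP[]//|x /(fsubsetP X'X)/XP[xS xW]|y x].
  by split; [case: (SV x xS)|apply/negP].
by move=> /(fsubsetP Y'Y) yY /(fsubsetP X'X) xX; rewrite csym; apply: XY.
Qed.

End Cuts.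

Section Copies.
Context {T : Type}.
Variables (H : graph T) (P Q : set T) (s r : nat).
Hypotheses (lfH : locally_finite H) (cH : countably_infinite H).
Hypotheses (bPQ : bipartition H P Q) (richsr : rich H P s r).
Variables (c : nat -> nat -> bool) (V : bool -> set nat).
Hypotheses (csym : coloring c) (tV : vertex_types c V).

Lemma dense_copy_of_coverable b (theta theta1 : R) :
    (forall Z : {fset nat}, exists2 a, V b a & a \notin Z) -> theta < theta1 ->
    (forall N, exists2 n, (N < n)%N & coverable c V b s r theta1 n) ->
  dense_copy H c theta.
Proof.
move=> Vinf lt often; have [HPQ dPQ iP iQ] := bPQ.
by apply: (monochromatic_copy HPQ dPQ iP iQ lfH csym tV Vinf
  (free_vertex_ex lfH cH bPQ) cH richsr lt often).
Qed.

(** If one type were finite, the other would be cofinite, and a copy of its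
    colour could contain all of it. *)
Lemma types_infinite (theta : R) : theta < 1 -> ~ dense_copy H c theta ->
  forall b (Z : {fset nat}), exists2 a, V b a & a \notin Z.
Proof.
move=> theta1 no b Z; apply: contrapT => fin; apply: no.
have VZ a : V b a -> a \in Z.
  by move=> Va; apply/negPn/negP => aZ; apply: fin; exists a.
have countZ n : (count_upto n (V b) <= #|` Z|)%N.
  by rewrite -ncard_fset; apply: ncard_le => // a [/VZ].
have countC n : (n <= count_upto n (V (~~ b)) + #|` Z|)%N.
  by rewrite -[leqLHS](count_types b n tV) addnC leq_add2l.
have [t1 [tt1 t11]] : exists t1, theta < t1 /\ t1 < 1.
  by exists ((theta + 1) / 2); split; lra.
apply: (@dense_copy_of_coverable (~~ b) theta t1) => //.
  move=> Z'; apply: contrapT => fin'.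
  have := countC (#|` Z'| + #|` Z|).+1; rewrite leqNgt => /negP; apply.
  rewrite ltnS leq_add2r -ncard_fset; apply: ncard_le => // a [Va _] /=.
  by apply/negPn/negP => aZ; apply: fin'; exists a.
move=> N; pose n := maxn N.+1 (Num.bound (#|` Z|%:R / (1 - t1))).
exists n; first by rewrite /n leq_max ltnSn.
apply: coverable_of_count.
have : #|` Z|%:R <= (1 - t1) * n%:R.
  rewrite mulrC -ler_pdivrMr ?subr_gt0//; apply: ltW.
  apply: lt_le_trans (archi_boundP _) _; first by rewrite divr_ge0// subr_ge0 ltW.
  by rewrite ler_nat leq_maxr.
by have := countC n; rewrite -(ler_nat R) natrD; lra.
Qed.

Lemma cuts_of_no_copy (lam theta slack : R) : (0 < s)%N -> (0 < r)%N ->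
    0 < lam -> r%:R <= lam * s%:R -> 0 < slack -> slack < 1 - theta ->
    ~ dense_copy H c theta ->
  exists k N, forall b n, (N <= n)%N -> exists S W, cut_at s r c V lam b k n slack S W.
Proof.
move=> s0 r0 lam0 rs slack0 st no.
pose theta1 := theta + (1 - theta - slack) / 2; pose eps := (1 - theta - slack) / 2.
have [k kP] := @cut_of_not_coverable s r c V tV lam eps theta1 s0 r0 lam0 rs
  ltac:(rewrite /eps; lra) ltac:(rewrite /theta1; lra).
have inf := @types_infinite theta ltac:(lra) no.
have few b : exists N, forall n, (N <= n)%N -> ~ coverable c V b s r theta1 n.
  apply: contrapT => often; apply: no.
  apply: (@dense_copy_of_coverable b theta theta1 (inf b)).
    by rewrite /theta1; lra.
  move=> N; apply: contrapT => h; apply: often; exists N.+1 => n Nn cov.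
  by apply: h; exists n.
have [N1 N1P] := few true; have [N2 N2P] := few false.
exists k, (maxn N1 N2) => b n; rewrite geq_max => /andP[n1 n2].
have -> : slack = 1 - theta1 - eps by rewrite /theta1 /eps; field.
by apply: kP; case: b; [apply: N1P|apply: N2P].
Qed.

End Copies.

End LowerBound.

(** * Dense copies in every colouring *)

Lemma cuts_card (R : realType) (s r : nat) (c : nat -> nat -> bool) (V : bool -> set nat)
    (lam slack : R) k n S W S' W' : vertex_types c V ->
  cut_at s r c V lam true k n slack S W -> cut_at s r c V lam false k n slack S' W' ->
  (#|` S| + #|` S'| <= n)%N.
Proof.
move=> tV [SV _ _ _] [SV' _ _ _]; rewrite -[leqRHS](count_types false n tV).
by apply: leq_add; rewrite -ncard_fset; apply: ncard_le (finite_upto n _) _;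
  [move=> x /SV|move=> x /SV'].
Qed.

Section Main.
Context {R : realType} {T : Type}.
Variable H : graph T.
Hypotheses (lfH : locally_finite H) (cH : countably_infinite H) (bH : bipartite H).

Definition sparse_family (lam : R) := exists (I : nat -> set T) (s : nat),
  [/\ trivIset setT I,
      forall i, [/\ finite_set (I i), I i !=set0 & independent H (I i)],
      forall i, ncard (I i) = s
    & forall i, (ncard (nbrs H (I i)))%:R / (ncard (I i))%:R <= lam].

(** The set of vertices of one of the types fills half of [n] for infinitely many
    n; the empty set serves as I, and no tiles are used. *)
Lemma dense_copy_half (c : nat -> nat -> bool) (theta : R) :
  coloring c -> theta < 1 / 2 -> dense_copy H c theta.
Proof.
move=> csym lt; have [V tV] := vertex_types_exist c.
apply: contrapT => no.
have [P [Q bPQ]] : exists P Q, bipartition H P Q.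
  have [A [B [AB dAB iA iB]]] := bH; exists A, B; split=> // v Av Bv.
  by have : (A `&` B) v by []; rewrite dAB.
have richP := @rich0 _ H P.
have inf := types_infinite lfH cH bPQ richP csym tV (_ : theta < 1) no.
have few b : exists N, forall n, (N <= n)%N -> ~ coverable c V b 0 0 (1 / 2 : R) n.
  apply: contrapT => often; apply: no.
  apply: (dense_copy_of_coverable lfH cH bPQ richP csym tV (inf _ b) lt); first lra.
  move=> N; apply: contrapT => h; apply: often; exists N.+1 => n Nn cov.
  by apply: h; exists n.
have [N1 N1P] := few true; have [N2 N2P] := few false.
pose n := maxn N1 N2.
have lt_half b : (count_upto n (V b))%:R < 1 / 2 * n%:R :> R.
  rewrite ltNge; apply/negP => /(coverable_of_count 0 0 c); case: b.
    by apply: N1P; rewrite leq_maxl.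
  by apply: N2P; rewrite leq_maxr.
have := congr1 (fun n => n%:R : R) (count_types true n tV).
by rewrite natrD; have := lt_half true; have := lt_half false; rewrite /=; lra.
Qed.

(** With lam small against the slack, the sets W and W' are negligible and S, S'
    are not. *)
Lemma dense_copy_zero (c : nat -> nat -> bool) (theta : R) :
  (forall lam, 0 < lam -> sparse_family lam) ->
  coloring c -> theta < 1 -> dense_copy H c theta.
Proof.
move=> sparse csym lt; have [V tV] := vertex_types_exist c.
apply: contrapT => no.
pose eps := (1 - theta) / 2; have eps0 : 0 < eps by rewrite /eps; lra.
pose lam := eps / 2; have lam0 : 0 < lam by rewrite /lam; lra.
have [I [s0 [trivI IP cI ratio]]] := sparse lam lam0.
have [P [Q [s [r [bPQ s_gt0 r_gt0 rs richsr]]]]] := rich_of_disjoint lfH lam0 bH trivI IP cI ratio.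
have slt : eps < 1 - theta by rewrite /eps; lra.
have [k [N NP]] := cuts_of_no_copy lfH cH bPQ richsr csym tV s_gt0 r_gt0 lam0 rs eps0 slt no.
have [M MP] := @cuts_cross R s r c V csym k.
pose n := maxn N (Num.bound (2 * M%:R / eps)).+1.
have [S [W cutS]] := NP true n (leq_maxl _ _).
have [S' [W' cutS']] := NP false n (leq_maxl _ _).
have cross := MP _ _ _ _ _ _ _ _ cutS cutS'.
have Mn : 2 * M%:R < eps * n%:R.
  rewrite [ltRHS]mulrC -ltr_pdivrMr//.
  apply: lt_trans (archi_boundP _) _; first by apply: divr_ge0; [exact: mulr_ge0|exact: ltW].
  by rewrite ltr_nat /n leq_max ltnSn orbT.
have := cuts_card tV cutS cutS'; rewrite -(ler_nat R) natrD => cardS.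
have [_ _ _ leS] := cutS; have [_ _ _ leS'] := cutS'.
have lamS : #|` W|%:R <= lam * n%:R.
  rewrite mulrC -ler_pdivrMr//; apply: (@le_trans _ _ #|` S|%:R).
    by apply: le_trans leS; rewrite lerDl mulr_ge0// ltW.
  by apply: le_trans cardS; rewrite lerDl.
have lamS' : #|` W'|%:R <= lam * n%:R.
  rewrite mulrC -ler_pdivrMr//; apply: (@le_trans _ _ #|` S'|%:R).
    by apply: le_trans leS'; rewrite lerDl mulr_ge0// ltW.
  by apply: le_trans cardS; rewrite lerDr.
have epsS : eps * n%:R <= #|` S|%:R.
  by apply: le_trans leS; rewrite lerDr divr_ge0// ltW.
have epsS' : eps * n%:R <= #|` S'|%:R.
  by apply: le_trans leS'; rewrite lerDr divr_ge0// ltW.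
have elam : 2 * lam = eps by rewrite /lam; field.
have elamn : 2 * (lam * n%:R) = eps * n%:R by rewrite mulrA elam.
by case: cross; rewrite -(ler_nat R) natrD; lra.
Qed.

(** After discarding the bounded number M of elements of S, the cuts become
    constraints as in [h_le_family]: a cut of colour true at n gives the point
    with abscissa |S| + |W| and ordinate |W| - |S|, and a cut of colour false the
    point with abscissa |S'| + |W'| and ordinate |S'| - |W'|.  Since S and S' are
    disjoint subsets of [n], the sum of the abscissas at the same n is at most
    (1 + lam - 2 lam D) n, while t is about 2 lam D n / (1 + lam).  The quotient
    L0 is below h because D exceeds delta, the density that f allows to miss. *)
Lemma dense_copy_pos (c : nat -> nat -> bool) (lam theta hh : R) : 0 < lam ->
  (forall lam', lam < lam' -> sparse_family lam') ->
  h ((lam - 1) / (lam + 1)) = hh%:E -> 0 <= hh ->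
  coloring c ->
  theta < 1 - 1 / (2 * lam / (1 + lam) ^+ 2 * hh + 2 * lam / (1 + lam)) ->
  dense_copy H c theta.
Proof.
move=> lam0 sparse eh hh0 csym lt; have [V tV] := vertex_types_exist c.
apply: contrapT => no.
have lam1 : 0 < 1 + lam by rewrite addr_gt0.
set den := _ + 2 * lam / (1 + lam) in lt.
have den0 : 0 < den.
  have lam2 : 0 < 2 * lam by lra.
  apply: ltr_wpDl; last exact: divr_gt0.
  by apply: mulr_ge0 => //; apply: divr_ge0; [exact: ltW|exact/exprn_ge0/ltW].
pose delta := den^-1; have delta0 : 0 < delta by rewrite invr_gt0.
have edelta : 1 / den = delta by rewrite div1r.
have [eps [eps0 epslt]] : exists eps, 0 < eps /\ 1 - theta = delta + 4 * eps.
  by exists ((1 - theta - delta) / 4); split; [lra|field].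
(* Of the gap 4 eps, one eps is lost in [slack], one by passing from lam' to
   lam, and one by discarding M elements; D = delta + eps remains. *)
pose lam' := lam * (1 + eps).
have lt' : lam < lam' by rewrite /lam' ltr_pMr// ltrDl.
have lam'0 : 0 < lam' by apply: lt_trans lt'.
have [I [s0 [trivI IP cI ratio]]] := sparse lam' lt'.
have [P [Q [s [r [bPQ s_gt0 r_gt0 rs richsr]]]]] := rich_of_disjoint lfH lam'0 bH trivI IP cI ratio.
pose slack := delta + 3 * eps.
have slack0 : 0 < slack by rewrite /slack; lra.
have slt : slack < 1 - theta by rewrite /slack; lra.
have [k [N NP]] := cuts_of_no_copy lfH cH bPQ richsr csym tV s_gt0 r_gt0 lam'0 rs slack0 slt no.
have [M MP] := @cuts_cross R s r c V csym k.
pose D := delta + eps; have D0 : 0 < D by rewrite /D; lra.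
pose N' := maxn N (Num.bound (M%:R / eps)).+1.
have cutP b n S W : (N' <= n)%N -> cut_at s r c V lam' b k n slack S W ->
    D * n%:R <= #|` S|%:R - M%:R - #|` W|%:R / lam /\ #|` S|%:R <= n%:R :> R.
  move=> N'n cutS; have [SV _ _ leS] := cutS.
  have Sn : #|` S|%:R <= n%:R :> R.
    rewrite ler_nat -[leqRHS]ncard_upto -ncard_fset; apply: ncard_le.
      by apply: sub_finite_set (finite_upto n setT) => x; split.
    by move=> x /SV[].
  split=> //.
  have Mn : M%:R <= eps * n%:R.
    rewrite mulrC -ler_pdivrMr//; apply: ltW.
    apply: lt_trans (archi_boundP _) _; first by rewrite divr_ge0// ltW.
    by rewrite ltr_nat; apply: leq_trans N'n; rewrite /N' leq_max ltnSn orbT.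
  have slackn : 0 <= slack * n%:R by rewrite mulr_ge0// ltW.
  have Wl : #|` W|%:R / lam = #|` W|%:R / lam' + eps * (#|` W|%:R / lam') :> R.
    rewrite -[X in X + _]mul1r -mulrDl /lam' invfM; field.
    by rewrite !gt_eqF// addr_gt0.
  have : eps * (#|` W|%:R / lam') <= eps * n%:R by rewrite ler_pM2l//; lra.
  by rewrite Wl; move: leS; rewrite /slack /D; lra.
pose kap := 1 + lam - 2 * lam * D.
pose L0 := kap * ((1 + lam) / (2 * lam * D)).
have hE : hh = (1 + lam) ^+ 2 / (2 * lam * delta) - (1 + lam).
  have lamhh := mulr_ge0 (ltW lam0) hh0; have lamlam := mulr_gt0 lam0 lam1.
  rewrite /delta /den; field; apply/and3P.
  by split; rewrite gt_eqF//; lra.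
have L0E : L0 = (1 + lam) ^+ 2 / (2 * lam * D) - (1 + lam).
  by rewrite /L0 /kap; field; rewrite !gt_eqF.
have L0h : L0 < hh.
  rewrite hE L0E ltrD2r ltr_pM2l ?exprn_gt0// ltf_pV2 ?posrE ?mulr_gt0//.
  by rewrite ltr_pM2l ?mulr_gt0// /D; lra.
pose eta := (hh - L0) / 2; have eta0 : 0 < eta by rewrite /eta; lra.
suff : (h ((lam - 1) / (lam + 1)) <= (L0 + eta)%:E)%E.
  by rewrite eh lee_fin /eta; lra.
have gamE x y : (lam - 1) / (lam + 1) * (x + y) - (y - x) = 2 / (1 + lam) * (lam * x - y).
  by field; rewrite gt_eqF// addrC.
pose point b (p : R * R) := exists n S W, [/\ (N' <= n)%N, cut_at s r c V lam' b k n slack S W &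
   p = (#|` S|%:R - M%:R + #|` W|%:R, (if b then 1 else -1) * (#|` W|%:R - (#|` S|%:R - M%:R)))].
apply: (@h_le_family R _ _ (Num.max (`|kap| / eta) (2 * lam * D / (1 + lam) * N'%:R))
  (point true) (point false)).
- move=> _ [n [S [W [N'n cutS ->]]]] /=; have [le _] := cutP _ _ _ _ N'n cutS.
  have W0 : 0 <= #|` W|%:R / lam by rewrite divr_ge0// ltW.
  have Dn : 0 <= D * n%:R by rewrite mulr_ge0// ltW.
  by have := ler0n R #|` W|; lra.
- move=> _ [n [S [W [N'n cutS ->]]]] /=; have [le _] := cutP _ _ _ _ N'n cutS.
  have W0 : 0 <= #|` W|%:R / lam by rewrite divr_ge0// ltW.
  have Dn : 0 <= D * n%:R by rewrite mulr_ge0// ltW.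
  by have := ler0n R #|` W|; lra.
- move=> _ _ [n [S [W [N'n cutS ->]]]] [m [S' [W' [N'm cutS' ->]]]] /=.
  have [le|le] := MP _ _ _ _ _ _ _ _ cutS cutS'; move: le; rewrite -(ler_nat R) natrD => le.
    by rewrite ler_normr; apply/orP; right; lra.
  by rewrite ler_normr; apply/orP; left; lra.
- move=> t; rewrite ge_max => /andP[t1 t2].
  pose nu := t * ((1 + lam) / (2 * lam * D)).
  have c0 : 0 < (1 + lam) / (2 * lam * D) by rewrite divr_gt0 ?mulr_gt0.
  have nu_ge : N'%:R <= nu.
    by rewrite /nu -ler_pdivrMr// invf_div mulrC.
  have nu0 : 0 <= nu by apply: le_trans nu_ge.
  pose n := (Num.truncn nu).+1.
  have nun : nu < n%:R by rewrite -Num.Theory.truncn_le_nat.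
  have nn : n%:R <= nu + 1 by rewrite -natr1 lerD2r Num.Theory.truncn_le.
  have N'n : (N' <= n)%N by rewrite -(ler_nat R); lra.
  have Nn : (N <= n)%N by apply: leq_trans N'n; rewrite leq_maxl.
  have [S [W cutS]] := NP true n Nn; have [S' [W' cutS']] := NP false n Nn.
  have [le _] := cutP _ _ _ _ N'n cutS; have [le' _] := cutP _ _ _ _ N'n cutS'.
  have tn : t <= 2 / (1 + lam) * (lam * (D * n%:R)).
    rewrite (_ : t = 2 / (1 + lam) * (lam * (D * nu))).
      by rewrite !ler_pM2l ?divr_gt0// ltW.
    by rewrite /nu; field; rewrite !gt_eqF.
  have mulW (U : {fset nat}) : lam * (#|` U|%:R / lam) = #|` U|%:R :> R.
    by rewrite mulrC divfK// gt_eqF.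
  have lamle := ler_wpM2l (ltW lam0) le; rewrite mulrBr mulW in lamle.
  have lamle' := ler_wpM2l (ltW lam0) le'; rewrite mulrBr mulW in lamle'.
  have c20 : 0 <= 2 / (1 + lam) by rewrite divr_ge0// ltW.
  exists (#|` S|%:R - M%:R + #|` W|%:R, 1 * (#|` W|%:R - (#|` S|%:R - M%:R))).
  exists (#|` S'|%:R - M%:R + #|` W'|%:R, -1 * (#|` W'|%:R - (#|` S'|%:R - M%:R))).
  split=> /=; [by exists n, S, W|by exists n, S', W'| | |].
  + rewrite mul1r gamE; apply: le_trans tn _.
    by rewrite ler_wpM2l//; lra.
  + rewrite mulN1r gamE; apply: le_trans tn _.
    by rewrite ler_wpM2l//; lra.
  + have := cuts_card tV cutS cutS'; rewrite -(ler_nat R) natrD => cardS.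
    have h1 : #|` S|%:R - M%:R + #|` W|%:R + (#|` S'|%:R - M%:R + #|` W'|%:R)
        <= kap * n%:R.
      have : (1 + lam) * (#|` S|%:R + #|` S'|%:R) <= (1 + lam) * n%:R by rewrite ler_pM2l.
      have : 0 <= (1 + lam) * M%:R by rewrite mulr_ge0// ltW.
      by move: lamle lamle'; rewrite /kap; lra.
    have h2 : kap * n%:R <= kap * nu + `|kap|.
      have : kap * (n%:R - nu) <= `|kap| * 1.
        apply: le_trans (ler_norm _) _; rewrite normrM ler_wpM2l//.
        by rewrite ger0_norm; lra.
      by rewrite mulr1; lra.
    have h3 : `|kap| <= eta * t by rewrite mulrC -ler_pdivrMr.
    have h4 : kap * nu = L0 * t by rewrite /nu /L0; ring.
    by lra.
Qed.

End Main.

(** * The Ramsey upper density *)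

Section Expansion.
Context {R : realType} {T : Type}.
Variable H : graph T.

Lemma expanding_of_expansion (kappa : R) :
  (kappa%:E < expansion H)%E -> expanding H kappa.
Proof.
rewrite /expansion /limn_einf lteNr => lt0.
have [_ [A [N _ NA] <-] lt] := ereal_inf_lt lt0.
exists N.+1 => I indI fI Nn; set n := ncard I in Nn *.
have n0 : 0 < n%:R :> R by rewrite ltr0n (leq_trans _ Nn).
have An : A n by apply: NA; exact: ltnW.
rewrite -ler_pdivlMr// -lee_fin EFinM.
apply: (@le_trans _ _ (mu H n * (n%:R^-1)%:E)%E).
  rewrite -leeN2 -EFinN; apply: le_trans _ (ltW lt).
  by apply: ereal_sup_ubound; exists n.
rewrite lee_pmul2r//; last by rewrite lte_fin invr_gt0.
by apply: ereal_inf_lbound; exists I.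
Qed.

Lemma expansion_ge0 : (0 <= @expansion R T H)%E.
Proof.
rewrite /expansion /limn_einf leeNr oppe0; apply: (@limf_esup_le _ _ _ _ _ _ setT).
  by exists 0%N.
move=> n _; rewrite leeNl oppe0; apply: mule_ge0; last by rewrite lee_fin invr_ge0.
by apply: le_ereal_inf_tmp => _ [I _ <-]; rewrite lee_fin.
Qed.

Lemma le_ramsey_upper_density (x : R) :
  (forall theta, theta < x -> forall c, coloring c -> dense_copy H c theta) ->
  (x%:E <= @ramsey_upper_density R T H)%E.
Proof.
move=> copies; apply/lee_addgt0Pr => e e0; rewrite -leeBlDr// -EFinB.
apply: ereal_sup_ubound; exists (x - e) => // c csym.
by apply: copies => //; lra.
Qed.

Lemma ramsey_upper_density_le1 : (@ramsey_upper_density R T H <= 1%:E)%E.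
Proof.
apply: ge_ereal_sup => _ [l /(_ (fun _ _ => true)) copy <-].
have [//|H' [_ _ _ le]] := copy.
apply: le_trans le _; apply: (@upper_density_le _ _ _ 0) => n _.
by rewrite mul1r ler_nat count_upto_leq.
Qed.

Hypothesis lfH : locally_finite H.

Lemma ramsey_upper_density_le_h (lam hh : R) : 0 < lam ->
  (forall kappa : R, 0 < kappa < lam -> expanding H kappa) ->
  h ((lam - 1) / (lam + 1)) = hh%:E -> 0 <= hh ->
  (@ramsey_upper_density R T H <=
    (1 - 1 / (2 * lam / (1 + lam) ^+ 2 * hh + 2 * lam / (1 + lam)))%:E)%E.
Proof.
move=> lam0 expH eh hh0.
set a := 2 * lam / (1 + lam) ^+ 2; set b := 2 * lam / (1 + lam).
have lam1 : 0 < 1 + lam by rewrite addr_gt0.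
have a0 : 0 < a by rewrite divr_gt0 ?exprn_gt0 ?mulr_gt0.
have b0 : 0 < b by rewrite divr_gt0 ?mulr_gt0.
have den L : 0 <= L -> 0 < a * L + b.
  by move=> L0; apply: ltr_wpDl => //; rewrite mulr_ge0// ltW.
have bound L : hh < L -> (@ramsey_upper_density R T H <= (1 - 1 / (a * L + b))%:E)%E.
  move=> hL; have : (h ((lam - 1) / (lam + 1)) < L%:E)%E by rewrite eh lte_fin.
  move=> lt1; have [_ [g [glip g0] <-] lt2] := ereal_inf_lt lt1.
  have [_ [A [M [_ MA]] <-] lt] := ereal_inf_lt lt2.
  apply: (@ramsey_density_le _ _ _ lam L g (`|M| + 1)) => //; first by lra.
  move=> t tM; have t0 : 0 < t by have := normr_ge0 M; lra.
  rewrite EFinM -lee_pdivrMr//; apply: le_trans _ (ltW lt).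
  by apply: ereal_sup_ubound; exists t => //; apply: MA; have := ler_norm M; lra.
apply: ge_ereal_sup => _ [l hl <-]; rewrite lee_fin.
have lb L : hh < L -> l <= 1 - 1 / (a * L + b).
  move=> /bound le; rewrite -lee_fin; apply: le_trans le.
  by apply: ereal_sup_ubound; exists l.
have den0 := den hh hh0.
rewrite lerBrDr addrC -lerBrDr ler_pdivrMr//; apply/ler_addgt0Pr => e e0.
have l1 : 0 < 1 - l.
  have := lb (hh + 1) (_ : _); rewrite ltrDl => /(_ ltr01).
  have : 0 < 1 / (a * (hh + 1) + b) by rewrite divr_gt0// den// addr_ge0.
  lra.
have ax : 0 < (1 - l) * a by rewrite mulr_gt0.
have := lb (hh + e / ((1 - l) * a)) (_ : _); rewrite ltrDl divr_gt0// => /(_ isT).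
rewrite lerBrDr addrC -lerBrDr ler_pdivrMr; last first.
  by apply: den; rewrite addr_ge0// divr_ge0// ltW.
move=> /le_trans; apply; rewrite le_eqVlt; apply/orP; left; apply/eqP.
by field; rewrite !gt_eqF.
Qed.

(** The bound for a finite lam, with g = 0, tends to 1 / 2 as lam grows. *)
Lemma ramsey_upper_density_le_half :
  (forall kappa : R, 0 < kappa -> expanding H kappa) ->
  (@ramsey_upper_density R T H <= (1 / 2)%:E)%E.
Proof.
move=> expH; apply/lee_addgt0Pr => e e0.
(* At lam the bound is 1 / 2 + 1 / (2 lam). *)
pose lam := 1 + e^-1; have lam1 : 1 < lam by rewrite ltrDl invr_gt0.
have lam0 : 0 < lam by apply: lt_trans lam1.
have lamm : 0 < lam - 1 by rewrite subr_gt0.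
pose gam := (lam - 1) / (lam + 1).
have gam0 : 0 < gam by rewrite divr_gt0// addr_gt0.
pose L := 2 / gam.
have L0 : 0 <= L by rewrite divr_ge0// ltW.
apply: le_trans (@ramsey_density_le _ _ _ lam L (fun=> 0) 0 lfH lam0 L0 _ _ _ _) _ => //.
- by move=> kappa /andP[k0 _]; apply: expH.
- by move=> x _ /=; rewrite subrr normr0 mul1r.
- move=> t t0; rewrite -/gam.
  have tg : 0 <= t / gam by rewrite divr_ge0// ltW.
  have eg : gam * (t / gam) = t by rewrite mulrC divfK// gt_eqF.
  rewrite (_ : L * t = t / gam + t / gam); last by rewrite /L; field; rewrite gt_eqF.
  rewrite EFinD; apply: leeD.
    by apply: Gamma_plus_le => //; rewrite eg addr0.
  by apply: Gamma_minus_le => //; rewrite eg subr0.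
- rewrite -EFinD lee_fin /L /gam.
  have -> : 1 - 1 / (2 * lam / (1 + lam) ^+ 2 * (2 / ((lam - 1) / (lam + 1))) + 2 * lam / (1 + lam))
     = 1 / 2 + 1 / (2 * lam).
    have p1 : 0 < lam * (lam + 1) by rewrite mulr_gt0// addr_gt0.
    have p2 : 0 < lam * ((1 + lam) * (lam - 1)) by rewrite !mulr_gt0// addr_gt0.
    by field; apply/and4P; split; rewrite gt_eqF//; lra.
  have elam : e * lam = e + 1 by rewrite /lam; field; rewrite gt_eqF.
  by rewrite lerD2l ler_pdivrMr ?mulr_gt0//; lra.
Qed.

End Expansion.

Theorem theorem12 (R : realType) (T : Type) (H : graph T) (lambda : \bar R) :
  locally_finite H ->
  countably_infinite H ->
  bipartite H ->
  lambda = expansion H ->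
  (forall lambda' : R, (lambda < lambda'%:E)%E ->
    exists (I : nat -> set T) (s : nat),
      [/\ trivIset setT I,
          forall i, [/\ finite_set (I i), I i !=set0 & independent H (I i)],
          forall i, ncard (I i) = s
        & forall i, (ncard (nbrs H (I i)))%:R / (ncard (I i))%:R <= lambda']) ->
  ramsey_upper_density H = (f lambda)%:E.
Proof.
move=> lfH cH bH elam sparse.
have := @expansion_ge0 R T H; rewrite -elam.
case: lambda elam sparse => [lam| |] elam sparse // lam_ge0.
- have exp kappa : kappa < lam -> expanding H kappa.
    by move=> lt; apply: expanding_of_expansion; rewrite -elam lte_fin.
  rewrite lee_fin in lam_ge0; rewrite /f; case: eqP => [lam0|/eqP lam_neq0].
    apply/eqP; rewrite eq_le ramsey_upper_density_le1 /=.
    apply: le_ramsey_upper_density => theta lt c csym.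
    apply: dense_copy_zero => // lam' lt'; apply: sparse.
    by rewrite lte_fin lam0.
  have lam0 : 0 < lam by rewrite lt_neqAle eq_sym lam_neq0.
  set gam := (lam - 1) / (lam + 1).
  have [L hL] : exists L : R, (h gam <= L%:E)%E.
    apply: h_bounded; rewrite /gam normrM normfV [X in _ / X]gtr0_norm ?addr_gt0//.
    by rewrite ltr_pdivrMr ?addr_gt0// mul1r ltr_norml; lra.
  have fin : h gam \is a fin_num.
    by rewrite fin_numE gt_eqF ?(lt_le_trans _ (h_ge0 _))//= lt_eqF// (le_lt_trans hL)// ltry.
  have eh : h gam = (fine (h gam))%:E by rewrite fineK.
  have hh0 : 0 <= fine (h gam) by rewrite fine_ge0// h_ge0.
  apply/eqP; rewrite eq_le; apply/andP; split.
    apply: ramsey_upper_density_le_h => // kappa /andP[_ lt]; exact: exp.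
  apply: le_ramsey_upper_density => theta lt c csym.
  by apply: (dense_copy_pos lfH cH bH lam0 _ eh hh0 csym lt) => lam' lt'; apply: sparse.
- rewrite /f; apply/eqP; rewrite eq_le; apply/andP; split.
    apply: ramsey_upper_density_le_half => // kappa _.
    by apply: expanding_of_expansion; rewrite -elam ltry.
  apply: le_ramsey_upper_density => theta lt c csym.
  exact: dense_copy_half.
Qed.
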